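(* Let $r,R>0$. The Radon transform $\mathcal{R}$ maps $\mathcal{BP}_{rR}(\mathbb{R}^2)$ isomorphically (as a linear bijection, continuous with continuous inverse) onto $$\mathcal{BP}_{rR}(\mathbb{R}\times S^1):=\{g\in \mathcal{BP}_{rR}(\mathbb{R})\otimes L^2(S^1): g(-s,-\omega)=g(s,\omega)\ \text{for a.e. } (s,\omega)\in\mathbb{R}\times S^1\},$$ the latter being equipped with the norm of $L^2(\mathbb{R}\times S^1,ds\otimes d\omega)$.
   Context: $S^1$ is the unit circle in $\mathbb{R}^2$ with arc length measure $d\omega$. $\mathcal{F}$ denotes the Fourier transform $(\mathcal{F}f)(\xi)=\int f(x)e^{-ix\cdot\xi}\,dx$, extended to $L^2(\mathbb{R}^d)$, and $\mathcal{F}_s$ denotes the one-dimensional Fourier transform (same convention) of a function $g(s,\omega)$ on $\mathbb{R}\times S^1$ with respect to the radial variable $s$, with dual variable $\sigma\in\mathbb{R}$. Bandpass space: for $r,R>0$, with $B_\rho^d$ the ball of radius $\rho$ centered at the origin of $\mathbb{R}^d$, $$\mathcal{BP}_{rR}(\mathbb{R}^d)=\{f\in L^2(\mathbb{R}^d): \mathcal{F}f=0 \text{ (a.e.) on } \mathbb{R}^d\setminus(B_R^d\setminus B_r^d)\},$$ a Hilbert space with the $L^2$-norm. Tensor products are Hilbert space tensor products, and $L^2(\mathbb{R},ds)\otimes L^2(S^1,d\omega)$ is identified with $L^2(\mathbb{R}\times S^1,ds\otimes d\omega)$. Under this identification $\mathcal{BP}_{rR}(\mathbb{R})\otimes L^2(S^1)$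 is the closed subspace of those $g\in L^2(\mathbb{R}\times S^1)$ with $(\mathcal{F}_s g)(\sigma,\omega)=0$ for a.e. $(\sigma,\omega)$ with $\sigma\notin[-R,-r]\cup[r,R]$ (for $r<R$). Radon transform on bandpass functions: it is defined through the Fourier slice theorem, $\mathcal{R}=\mathcal{F}_s^{-1}\circ\mathrm{id}\circ\Phi\circ\mathcal{F}$. Here $\Phi: L^2(\mathbb{R}^2)\to L^2(\mathbb{R}^+\times S^1,\sigma\,d\sigma\otimes d\omega)$ is the change to polar coordinates, and $\mathrm{id}$ regards a function $g$ on $\mathbb{R}^+\times S^1$ as a function on $\mathbb{R}\times S^1$ with measure $d\sigma\otimes d\omega$ by setting $(\mathrm{id}\,g)(\sigma,\omega)=g(-\sigma,-\omega)$ for $\sigma<0$. Equivalently, $\mathcal{R}f$ is the element of $L^2(\mathbb{R}\times S^1)$ determined by $(\mathcal{F}_s\mathcal{R}f)(\sigma,\omega)=(\mathcal{F}f)(\sigma\omega)$ for a.e. $(\sigma,\omega)\in\mathbb{R}\times S^1$. For Schwartz functions this coincides with the classical Radon transform $(\mathcal{R}f)(s,\omega)=\int_{x\cdot\omega=s}f$. *)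

(* Defs.v *)
From HB Require Import structures.
From mathcomp Require Import all_boot all_order all_algebra.
From mathcomp Require Import all_classical all_reals all_analysis.
From mathcomp Require Import measurable_realfun complex.

Set Implicit Arguments.
Unset Strict Implicit.
Unset Printing Implicit Defensive.
Import Order.TTheory GRing.Theory Num.Theory.
Import numFieldNormedType.Exports.
Local Open Scope classical_set_scope.
Local Open Scope complex_scope.
Local Open Scope ring_scope.

(* Elements of a space L^2(mu) are represented by complex-valued measurable
   functions; equality in L^2(mu) is equality mu-almost everywhere. *)
Section complex_functions.
Context d (T : measurableType d) (R : realType).
Variable mu : {measure set T -> \bar R}.
Implicit Types f g : T -> R[i].

Definition cmeasurable f : Prop :=
  measurable_fun setT (fun x => complex.Re (f x)) /\
  measurable_fun setT (fun x => complex.Im (f x)).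

Definition cintegrable f : Prop :=
  mu.-integrable setT (fun x => (complex.Re (f x))%:E) /\
  mu.-integrable setT (fun x => (complex.Im (f x))%:E).

Definition cintegral f : R[i] :=
  (\int[mu]_x complex.Re (f x)) +i* (\int[mu]_x complex.Im (f x)).

Definition L2norm f : \bar R := 'N[mu]_2%:E[EFin \o (fun x => Normc.normc (f x))]%E.

Definition L2 : set (T -> R[i]) :=
  [set f | cmeasurable f /\ (L2norm f < +oo)%E].

End complex_functions.
Arguments L2norm {d T R} mu%_ereal_scope f%_ring_scope.

Section fourier.
Context d (T : measurableType d) (R : realType).
Variable mu : {measure set T -> \bar R}.
Variable dot : T -> T -> R.
Implicit Types f F : T -> R[i].

Definition expi (t : R) : R[i] := cos t +i* sin t.

Definition fourier f (xi : T) : R[i] :=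
  cintegral mu (fun x => f x * expi (- dot x xi)).

(* F is the Fourier transform of f in L^2: the extension of [fourier] by
   continuity from the dense subspace of functions that are both integrable
   and square integrable.  As an element of L^2, F is determined up to
   a null set only, whence a relation. *)
Definition is_fourier f F : Prop :=
  [/\ L2 mu f, L2 mu F &
    exists u : nat -> T -> R[i],
      [/\ forall n, cintegrable mu (u n) /\ L2 mu (u n),
          (fun n => L2norm mu (u n \- f)) @ \oo --> 0%E &
          (fun n => L2norm mu (fourier (u n) \- F)) @ \oo --> 0%E]].

Definition ball0 (rho : R) : set T := [set x | Num.sqrt (dot x x) < rho].

Definition bandpass (r r' : R) : set (T -> R[i]) :=
  [set f | L2 mu f /\
    exists F, is_fourier f F /\
      {ae mu, forall xi, (~` (ball0 r' `\` ball0 r)) xi -> F xi = 0}].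

End fourier.

Definition tensor_sum (T U : Type) (R : realType) n
    (a : 'I_n -> T -> R[i]) (b : 'I_n -> U -> R[i]) : T * U -> R[i] :=
  fun z => \sum_(i < n) a i z.1 * b i z.2.

(* The Hilbert tensor product of subspaces A of L^2(mu) and B of L^2(nu),
   realized inside L^2(mu \x nu) as the closure of the linear span of the
   functions (x, y) |-> a x * b y with a in A and b in B. *)
Definition hilbert_tensor d d' (T : measurableType d) (U : measurableType d')
    (R : realType) (mu : {measure set T -> \bar R})
    (nu : {sigma_finite_measure set U -> \bar R})
    (A : set (T -> R[i])) (B : set (U -> R[i])) : set (T * U -> R[i]) :=
  [set g | L2 (mu \x nu)%E g /\
    forall eps : R, 0 < eps ->
      exists n (a : 'I_n -> T -> R[i]) (b : 'I_n -> U -> R[i]),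
        (forall i, A (a i) /\ B (b i)) /\
        (L2norm (mu \x nu) (g \- tensor_sum a b) < eps%:E)%E].

Section L2_maps.
Context d d' (T : measurableType d) (U : measurableType d') (R : realType).
Variables (mu : {measure set T -> \bar R}) (nu : {measure set U -> \bar R}).
Variables (A : set (T -> R[i])) (B : set (U -> R[i])).
Variable S : (T -> R[i]) -> (U -> R[i]).

Definition L2_well_defined : Prop :=
  (forall f, A f -> B (S f)) /\
  (forall f f', A f -> A f' -> f = f' %[ae mu] -> S f = S f' %[ae nu]).

Definition L2_linear : Prop :=
  forall (a : R[i]) f f', A f -> A f' ->
    S (fun x => a * f x + f' x) = (fun y => a * S f y + S f' y) %[ae nu].

Definition L2_injective : Prop :=
  forall f f', A f -> A f' -> S f = S f' %[ae nu] -> f = f' %[ae mu].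

Definition L2_surjective : Prop :=
  forall g, B g -> exists f, A f /\ S f = g %[ae nu].

Definition L2_continuous : Prop :=
  forall f0, A f0 -> forall eps : R, 0 < eps ->
    exists delta : R, 0 < delta /\ forall f, A f ->
      (L2norm mu (f \- f0) < delta%:E)%E ->
      (L2norm nu (S f \- S f0) < eps%:E)%E.

Definition L2_inverse_continuous : Prop :=
  forall f0, A f0 -> forall eps : R, 0 < eps ->
    exists delta : R, 0 < delta /\ forall f, A f ->
      (L2norm nu (S f \- S f0) < delta%:E)%E ->
      (L2norm mu (f \- f0) < eps%:E)%E.

Definition L2_isomorphism : Prop :=
  [/\ L2_well_defined /\ L2_linear, L2_injective, L2_surjective,
      L2_continuous & L2_inverse_continuous].

End L2_maps.

Section circle_type.
Variable R : realType.

Definition circle : Type := {w : R * R | w.1 ^+ 2 + w.2 ^+ 2 == 1}.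

Definition circle_val (w : circle) : measurableTypeR R * measurableTypeR R :=
  val w.

Lemma circle_param_subproof (t : R) :
  ((cos t, sin t) : R * R).1 ^+ 2 + ((cos t, sin t) : R * R).2 ^+ 2 == 1.
Proof. by rewrite /= cos2Dsin2. Qed.

Definition circle_param (t : measurableTypeR R) : circle :=
  exist _ (cos t, sin t) (circle_param_subproof t).

Lemma circle_opp_subproof (w : circle) :
  ((- (val w).1, - (val w).2) : R * R).1 ^+ 2 +
  ((- (val w).1, - (val w).2) : R * R).2 ^+ 2 == 1.
Proof. by rewrite /= !sqrrN; exact: (valP w). Qed.

Definition circle_opp (w : circle) : circle :=
  exist _ (- (val w).1, - (val w).2) (circle_opp_subproof w).

HB.instance Definition _ := gen_eqMixin circle.
HB.instance Definition _ := gen_choiceMixin circle.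
HB.instance Definition _ := isPointed.Build circle (circle_param 0).

HB.instance Definition _ :=
  Measurable.copy circle (g_sigma_algebra_preimageType circle_val).


Lemma measurable_circle_param : measurable_fun setT circle_param.
Proof.
have m2 : measurable_fun setT (fun t : measurableTypeR R =>
    ((cos t, sin t) : measurableTypeR R * measurableTypeR R)).
  by apply/measurable_fun_pair; apply: continuous_measurable_fun;
    [exact: continuous_cos | exact: continuous_sin].
move=> _ _ [B mB <-]; rewrite !setTI.
by have := m2 measurableT _ mB; rewrite setTI.
Qed.

(* Arc length on the circle: the image of the Lebesgue measure on [0, 2pi[
   under t |-> (cos t, sin t). *)
Definition arc_length : set circle -> \bar R :=
  pushforward (mrestr lebesgue_measure (measurable_itv `[0, pi *+ 2[))
    circle_param.

Let arc_length0 : arc_length set0 = 0%E.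
Proof. by rewrite /arc_length /pushforward preimage_set0 measure0. Qed.

Let measurable_preimage_circle_param A :
  measurable A -> measurable (circle_param @^-1` A).
Proof. by move=> mA; rewrite -[_ @^-1` _]setTI; exact: measurable_circle_param. Qed.

Let arc_length_ge0 A : (0 <= arc_length A)%E.
Proof. by rewrite /arc_length /pushforward; exact: measure_ge0. Qed.

Let arc_length_sigma_additive : semi_sigma_additive arc_length.
Proof.
move=> F mF tF mUF; rewrite /arc_length /pushforward preimage_bigcup.
apply: measure_semi_sigma_additive.
- by move=> n; exact: measurable_preimage_circle_param.
- apply/trivIsetP => /= i j _ _ ij; rewrite -preimage_setI.
  by move/trivIsetP : tF => /(_ _ _ _ _ ij) ->//; rewrite preimage_set0.
- by rewrite -preimage_bigcup; exact: measurable_preimage_circle_param.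
Qed.

HB.instance Definition _ := isMeasure.Build _ _ _ arc_length
  arc_length0 arc_length_ge0 arc_length_sigma_additive.

Let arc_length_fin : fin_num_fun arc_length.
Proof.
move=> A mA; rewrite /arc_length /pushforward /mrestr ge0_fin_numE//.
apply: (@le_lt_trans _ _ (lebesgue_measure (`[0, pi *+ 2[%classic : set R))).
  apply: le_measure; rewrite ?inE//.
  by apply: measurableI => //; exact: measurable_preimage_circle_param.
by rewrite lebesgue_measure_itv /=; case: ifP => _; rewrite ltry.
Qed.

HB.instance Definition _ := Measure_isFinite.Build _ _ _ arc_length
  arc_length_fin.

End circle_type.
Arguments arc_length {R}.

Section radon_transform.
Variable R : realType.
Local Notation mu := (@lebesgue_measure R).

Definition lebesgue_measure2 :
    {measure set (measurableTypeR R * measurableTypeR R) -> \bar R} :=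
  (mu \x mu)%E.

Definition cylinder_measure :
    {measure set (measurableTypeR R * circle R) -> \bar R} :=
  (mu \x @arc_length R)%E.

Definition dot1 (s t : R) : R := s * t.

Definition dot2 (x y : R * R) : R := x.1 * y.1 + x.2 * y.2.

Definition bandpass1 (r r' : R) : set (R -> R[i]) := bandpass mu dot1 r r'.

Definition bandpass2 (r r' : R) : set (R * R -> R[i]) :=
  bandpass lebesgue_measure2 dot2 r r'.

Definition bandpass_cylinder (r r' : R) : set (R * circle R -> R[i]) :=
  [set g | hilbert_tensor mu arc_length (bandpass1 r r') (L2 arc_length) g /\
    {ae cylinder_measure, forall p, g (- p.1, circle_opp p.2) = g p}].

(* The Fourier transform in the first variable only. *)
Definition is_fourier_s (g h : R * circle R -> R[i]) : Prop :=
  [/\ L2 cylinder_measure g, L2 cylinder_measure h &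
    {ae (@arc_length R), forall w,
      is_fourier mu dot1 (fun s => g (s, w)) (fun sigma => h (sigma, w))}].

Definition polar (F : R * R -> R[i]) : R * circle R -> R[i] :=
  fun p => F (p.1 * (val p.2).1, p.1 * (val p.2).2).

(* Only the values g (sigma, w) with sigma >= 0 matter. *)
Definition even_ext (g : R * circle R -> R[i]) : R * circle R -> R[i] :=
  fun p => if p.1 < 0 then g (- p.1, circle_opp p.2) else g p.

(* g is the Radon transform of f: the inverse Fourier transform, in the radial
   variable, of the extension to R x S^1 of the Fourier transform of f in
   polar coordinates. *)
Definition is_radon (f : R * R -> R[i]) (g : R * circle R -> R[i]) : Prop :=
  exists F h, [/\ is_fourier lebesgue_measure2 dot2 f F, is_fourier_s g h &
    h = even_ext (polar F) %[ae cylinder_measure]].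

(* A representative of the Radon transform of f if there is one, 0 otherwise. *)
Definition radon (f : R * R -> R[i]) : R * circle R -> R[i] :=
  xget (fun=> 0) [set g | is_radon f g].

End radon_transform.

(* Main.v *)
(* The kernel of an approximate identity that is the Fourier transform of
   integrable weights increasing to 1 (the Poisson kernel on the line, and its
   product with itself on the plane) gives inversion and Plancherel for functions
   that are both integrable and square integrable. A spectrum supported in an
   annulus is of this kind, so all the inverse transforms that occur are actual
   integrals.

   In polar coordinates, the integral of Phi over the plane is half the integral
   of |s| Phi(s w) over R x S^1. On the band r <= |s| < r' the weight |s| lies
   between r and r': hence F |-> F(s w) is bounded with bounded inverse from the
   square integrable functions supported in the annulus onto the even ones
   supported in the band. The Radon transform is this map conjugated by the
   Fourier transforms, and Plancherel on the plane and on almost every line of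
   the cylinder turns the two bounds into bounds for the Radon transform.

   For surjectivity, an element of the Hilbert tensor product is a limit of
   tensor sums; by Plancherel their spectra are a Cauchy sequence, and its limit
   H is the spectrum of g. It is even because g is, hence of the form F(s w). *)

From HB Require Import structures.
Require Import Defs.
From mathcomp Require Import all_boot all_order all_algebra.
From mathcomp Require Import all_classical all_reals all_analysis.
From mathcomp Require Import measurable_realfun complex.
From mathcomp Require Import ring lra.

Set Implicit Arguments.
Unset Strict Implicit.
Unset Printing Implicit Defensive.
Import Order.TTheory GRing.Theory Num.Theory.
Import numFieldNormedType.Exports.
Local Open Scope classical_set_scope.
Local Open Scope ring_scope.

(** * Complex-valued functions *)

Section complex_facts.
Variable R : rcfType.
Implicit Types (z w : R[i]) (t : R).

(** On the cylinder, the Fourier transform is imposed on almost every line separately, as a relation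
    up to null sets. Inverting line by line leaves open whether the chosen functions fit together
    into a measurable function of [(s, w)]; since the spectra at hand have bounded support, one
    explicit integral with parameter, [inv_fourier_s], serves on almost all lines and is jointly
    measurable. The approximate identity is controlled by the double integral of
    [k x y * (h x - h y) ^+ 2]. This quadratic form in [h] is at most 4 times the squared norm of
    [h], so its limit only has to be computed on indicators: of intervals on the line, where
    arctangents give the answer, and of rectangles in the plane, one coordinate at a time. With
    [c = 2 pi], the constant of Plancherel on the line, the final bounds for the Radon transform [g]
    of [f] are [r c |g|^2 <= 2 c^2 |f|^2 <= r' c |g|^2]; the 2 appears because the cylinder covers
    the plane twice. *)

Definition sqn z : R := complex.Re z ^+ 2 + complex.Im z ^+ 2.

Lemma ReD z w : complex.Re (z + w) = complex.Re z + complex.Re w.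
Proof. by case: z; case: w. Qed.
Lemma ImD z w : complex.Im (z + w) = complex.Im z + complex.Im w.
Proof. by case: z; case: w. Qed.
Lemma ReN z : complex.Re (- z) = - complex.Re z.
Proof. by case: z. Qed.
Lemma ImN z : complex.Im (- z) = - complex.Im z.
Proof. by case: z. Qed.
Lemma ReM z w : complex.Re (z * w) =
  complex.Re z * complex.Re w - complex.Im z * complex.Im w.
Proof. by case: z; case: w. Qed.
Lemma ImM z w : complex.Im (z * w) =
  complex.Re z * complex.Im w + complex.Im z * complex.Re w.
Proof. by case: z; case: w. Qed.
Lemma ReJ z : complex.Re (conjc z) = complex.Re z.
Proof. by case: z. Qed.
Lemma ImJ z : complex.Im (conjc z) = - complex.Im z.
Proof. by case: z. Qed.

Lemma conjcM z w : conjc (z * w) = conjc z * conjc w.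
Proof. exact: rmorphM. Qed.

Lemma conjcZ t z : conjc (real_complex R t * z) = real_complex R t * conjc z.
Proof. by rewrite conjcM conjc_real. Qed.

Definition ReImE := (ReD, ImD, ReN, ImN, ReM, ImM, ReJ, ImJ).

Lemma complex_ext z w :
  complex.Re z = complex.Re w -> complex.Im z = complex.Im w -> z = w.
Proof. by case: z; case: w => a b c d /= -> ->. Qed.

Lemma sqn_ge0 z : 0 <= sqn z.
Proof. by rewrite addr_ge0// sqr_ge0. Qed.

Lemma sqnE z : sqn z = Normc.normc z ^+ 2.
Proof. by case: z => a b; rewrite /sqn /= sqr_sqrtr// addr_ge0// sqr_ge0. Qed.

Lemma sqnM z w : sqn (z * w) = sqn z * sqn w.
Proof. by rewrite !sqnE Normc.normcM exprMn. Qed.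

Lemma sqnN z : sqn (- z) = sqn z.
Proof. by rewrite /sqn !ReImE !sqrrN. Qed.

Lemma sqnJ z : sqn (conjc z) = sqn z.
Proof. by rewrite /sqn !ReImE sqrrN. Qed.

Lemma sqn0 : sqn 0 = 0.
Proof. by rewrite /sqn /= expr0n /= addr0. Qed.

Lemma sqnR t : sqn (real_complex R t) = t ^+ 2.
Proof. by rewrite /sqn /= expr0n /= addr0. Qed.

Lemma sqn_eq0 z : sqn z = 0 -> z = 0.
Proof.
rewrite sqnE => /eqP; rewrite expf_eq0 /= => /eqP.
exact: Normc.eq0_normc.
Qed.

(** By the parallelogram law, the gap between the two sides is [sqn (z + w)]. *)
Lemma sqnB_le z w : sqn (z - w) <= 2 * sqn z + 2 * sqn w.
Proof.
rewrite /sqn !ReImE.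
have := sqr_ge0 (complex.Re z + complex.Re w).
have := sqr_ge0 (complex.Im z + complex.Im w); nra.
Qed.

Lemma sqnD_le z w : sqn (z + w) <= 2 * sqn z + 2 * sqn w.
Proof. by rewrite -[w in sqn (z + w)]opprK (le_trans (sqnB_le _ _))// sqnN. Qed.

Lemma normc_ge0 z : 0 <= Normc.normc z.
Proof. by case: z => a b; exact: sqrtr_ge0. Qed.

Lemma normcJ z : Normc.normc (conjc z) = Normc.normc z.
Proof. by case: z => a b /=; rewrite sqrrN. Qed.

Lemma normcR t : Normc.normc (real_complex R t) = `|t|.
Proof. by rewrite /= expr0n /= addr0 sqrtr_sqr. Qed.

Lemma normc_Re z : `|complex.Re z| <= Normc.normc z.
Proof.
case: z => a b /=; rewrite -sqrtr_sqr ler_sqrt ?lerDl ?sqr_ge0//.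
by rewrite addr_ge0// sqr_ge0.
Qed.

Lemma normc_Im z : `|complex.Im z| <= Normc.normc z.
Proof.
case: z => a b /=; rewrite -sqrtr_sqr ler_sqrt ?lerDr ?sqr_ge0//.
by rewrite addr_ge0// sqr_ge0.
Qed.

Lemma normcD z w : Normc.normc (z + w) <= Normc.normc z + Normc.normc w.
Proof. exact: (@le_normcD R z w). Qed.

Lemma normcN z : Normc.normc (- z) = Normc.normc z.
Proof. exact: (@complex.normcN R z). Qed.

Lemma normc_ReIm z :
  Normc.normc z <= `|complex.Re z| + `|complex.Im z|.
Proof.
rewrite -(@ler_pXn2r _ 2) ?nnegrE ?addr_ge0 ?normc_ge0//.
rewrite -sqnE /sqn -(real_normK (num_real (complex.Re z))).
rewrite -(real_normK (num_real (complex.Im z))).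
have := normr_ge0 (complex.Re z); have := normr_ge0 (complex.Im z); nra.
Qed.

End complex_facts.

Section expi_facts.
Variable R : realType.
Implicit Types s t : R.

Lemma expiD s t : expi (s + t) = expi s * expi t.
Proof. by apply: complex_ext; rewrite ReImE /= ?cosD ?sinD// addrC. Qed.

Lemma expiJ t : conjc (expi t) = expi (- t).
Proof. by rewrite /expi /= cosN sinN. Qed.

Lemma normc_expi t : Normc.normc (expi t) = 1.
Proof. by rewrite /= cos2Dsin2 sqrtr1. Qed.

End expi_facts.

Section cmeasurable.
Context d (T : measurableType d) (R : realType).
Implicit Types (f g : T -> R[i]) (u : T -> R).

Lemma cmeasurableD f g :
  cmeasurable f -> cmeasurable g -> cmeasurable (fun x => f x + g x).
Proof.
move=> [f1 f2] [g1 g2]; split.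
- by under eq_fun do rewrite ReImE; exact: measurable_funD.
- by under eq_fun do rewrite ReImE; exact: measurable_funD.
Qed.

Lemma cmeasurableN f : cmeasurable f -> cmeasurable (fun x => - f x).
Proof.
move=> [f1 f2]; split.
- by under eq_fun do rewrite ReImE; exact: measurable_funN.
- by under eq_fun do rewrite ReImE; exact: measurable_funN.
Qed.

Lemma cmeasurableB f g :
  cmeasurable f -> cmeasurable g -> cmeasurable (fun x => f x - g x).
Proof. by move=> mf mg; apply: cmeasurableD => //; exact: cmeasurableN. Qed.

Lemma cmeasurableM f g :
  cmeasurable f -> cmeasurable g -> cmeasurable (fun x => f x * g x).
Proof.
move=> [f1 f2] [g1 g2]; split.
- by under eq_fun do rewrite ReImE; apply: measurable_funB; exact: measurable_funM.
- by under eq_fun do rewrite ReImE; apply: measurable_funD; exact: measurable_funM.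
Qed.

Lemma cmeasurableJ f : cmeasurable f -> cmeasurable (fun x => conjc (f x)).
Proof.
move=> [f1 f2]; split.
- by under eq_fun do rewrite ReImE.
- by under eq_fun do rewrite ReImE; exact: measurable_funN.
Qed.

Lemma cmeasurable_cst (z : R[i]) : cmeasurable (fun _ : T => z).
Proof. by split; exact: measurable_cst. Qed.

Lemma cmeasurableR u : measurable_fun setT u ->
  cmeasurable (fun x => real_complex R (u x)).
Proof. by move=> mu; split => //=; exact: measurable_cst. Qed.

Lemma cmeasurable_expi u : measurable_fun setT u ->
  cmeasurable (fun x => expi (u x)).
Proof.
move=> mu; split => /=.
- by apply: measurableT_comp => //; by apply: continuous_measurable_fun; exact: continuous_cos.
- by apply: measurableT_comp => //; by apply: continuous_measurable_fun; exact: continuous_sin.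
Qed.

Lemma measurable_sqn f : cmeasurable f -> measurable_fun setT (fun x => sqn (f x)).
Proof. by move=> [f1 f2]; apply: measurable_funD; exact: measurable_funX. Qed.

Lemma measurable_normc f : cmeasurable f ->
  measurable_fun setT (fun x => Normc.normc (f x)).
Proof.
move=> mf; have -> : (fun x => Normc.normc (f x)) = (fun x => Num.sqrt (sqn (f x))).
  by apply/funext => x; rewrite sqnE sqrtr_sqr ger0_norm// normc_ge0.
apply: measurableT_comp (measurable_sqn mf).
by apply: continuous_measurable_fun; exact: sqrt_continuous.
Qed.

End cmeasurable.

Lemma cmeasurable_comp d d' (T : measurableType d) (U : measurableType d')
    (R : realType) (f : U -> R[i]) (phi : T -> U) :
  cmeasurable f -> measurable_fun setT phi -> cmeasurable (f \o phi).
Proof.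
move=> [f1 f2] mphi; split.
- exact: (measurableT_comp f1 mphi).
- exact: (measurableT_comp f2 mphi).
Qed.

(** * Convergence to 0 of nonnegative extended reals *)

Section ereal_limits.
Variable R : realType.
Local Open Scope ereal_scope.

(** Infinite values may occur at finitely many indices: the bound itself makes the tail finite. *)
Lemma ge0_ecvg0P (a : nat -> \bar R) : (forall n, 0 <= a n) ->
  (a @ \oo --> 0) <->
  (forall e : R, (0 < e)%R -> \forall n \near \oo, a n < e%:E).
Proof.
move=> a0; split => [/fine_cvgP[fa /cvgrPdist_lt a0'] e e0|ae].
  near=> n; have fan : a n \is a fin_num by near: n.
  rewrite -(fineK fan) lte_fin -[fine _]ger0_norm ?fine_ge0//.
  rewrite -normrN -[(- _)%R]add0r; near: n; exact: a0'.
apply/fine_cvgP; split.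
  by move: (ae _ ltr01); apply: filterS => n an; rewrite ge0_fin_numE// (lt_trans an) ?ltry.
apply/cvgrPdist_lt => e e0; move: (ae _ e0); apply: filterS => n an.
rewrite sub0r normrN ger0_norm ?fine_ge0//=.
by rewrite -lte_fin fineK// ge0_fin_numE// (lt_trans an) ?ltry.
Unshelve. all: by end_near. Qed.

Lemma ge0_ecvg0_le (a b : nat -> \bar R) : (forall n, 0 <= a n) ->
  (forall n, a n <= b n) -> b @ \oo --> 0 -> a @ \oo --> 0.
Proof.
move=> a0 ab b0; apply: (@squeeze_cvge _ _ _ _ (cst 0) _ b) => //.
  by near=> n; rewrite a0 ab.
exact: cvg_cst.
Unshelve. all: by end_near. Qed.

Lemma ge0_ecvg0D (a b : nat -> \bar R) :
  a @ \oo --> 0 -> b @ \oo --> 0 -> (fun n => a n + b n) @ \oo --> 0.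
Proof. by move=> a0 b0; rewrite -[0]adde0; apply: cvgeD. Qed.

Lemma ge0_ecvg0Z (k : R) (a : nat -> \bar R) :
  a @ \oo --> 0 -> (fun n => k%:E * a n) @ \oo --> 0.
Proof. by move=> a0; rewrite -(mule0 k%:E); exact: cvgeZl. Qed.

End ereal_limits.

(** * The norm of L^2 and its square *)

Section L2_norm.
Context d (T : measurableType d) (R : realType).
Variable mu : {measure set T -> \bar R}.
Implicit Types f g : T -> R[i].
Local Open Scope ereal_scope.

(** The square of [L2norm]. Being a plain integral, it passes through Tonelli, limit theorems and
    changes of variables without any root. *)
Definition N2 f : \bar R := \int[mu]_x (sqn (f x))%:E.

Lemma N2_ge0 f : 0 <= N2 f.
Proof. by apply: integral_ge0 => x _; rewrite lee_fin sqn_ge0. Qed.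

Lemma L2normE f : L2norm mu f = N2 f `^ 2^-1.
Proof.
rewrite /L2norm unlock /N2; congr (_ `^ _).
apply: eq_integral => x _ /=.
by rewrite sqnE ger0_norm ?normc_ge0// powR_mulrn ?normc_ge0.
Qed.

Lemma L2norm_ge0 f : 0 <= L2norm mu f.
Proof. by rewrite L2normE poweR_ge0. Qed.

Lemma L2norm_N2 f : L2norm mu f * L2norm mu f = N2 f.
Proof.
have := N2_ge0 f; rewrite L2normE; case: (N2 f) => [r r0| _|//].
- by rewrite poweR_EFin -EFinM powR12_sqrt// -expr2 sqr_sqrtr.
- by rewrite poweRyr ?mulyy// gt_eqF// invr_gt0.
Qed.

Lemma L2norm_ltE f (e : R) : (0 < e)%R ->
  (L2norm mu f < e%:E) = (N2 f < (e ^+ 2)%:E).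
Proof.
move=> e0; have := N2_ge0 f; rewrite L2normE; case: (N2 f) => [r r0| _|//].
- rewrite poweR_EFin !lte_fin powR12_sqrt//.
  by rewrite -[RHS]ltr_sqrt ?exprn_gt0// sqrtr_sqr gtr0_norm.
- by rewrite poweRyr ?gt_eqF ?invr_gt0// !ltNge !leey.
Qed.

Lemma L2norm_ltyE f : (L2norm mu f < +oo) = (N2 f < +oo).
Proof.
have := N2_ge0 f; rewrite L2normE; case: (N2 f) => [r r0| _|//].
- by rewrite poweR_EFin !ltry.
- by rewrite poweRyr ?gt_eqF ?invr_gt0.
Qed.

Lemma cvg_L2norm_N2 (u : nat -> T -> R[i]) :
  ((fun n => L2norm mu (u n)) @ \oo --> 0) <-> ((fun n => N2 (u n)) @ \oo --> 0).
Proof.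
rewrite !ge0_ecvg0P => [|n|n]; [|exact: N2_ge0|exact: L2norm_ge0].
split => h e e0.
- have s0 : (0 < Num.sqrt e)%R by rewrite sqrtr_gt0.
  have := h _ s0; apply: filterS => n; rewrite L2norm_ltE// sqr_sqrtr// ltW//.
- have := h _ (exprn_gt0 2 e0); apply: filterS => n; rewrite L2norm_ltE//.
Qed.

Lemma L2P f : L2 mu f <-> cmeasurable f /\ N2 f < +oo.
Proof. by rewrite /L2 /= L2norm_ltyE. Qed.

Lemma emeasurable_sqn f : cmeasurable f ->
  measurable_fun setT (fun x => (sqn (f x))%:E).
Proof. by move=> mf; apply/measurable_EFinP; exact: measurable_sqn. Qed.

(** Minkowski's inequality for the moduli, after the pointwise triangle inequality for complex
    numbers. *)
Lemma L2normD f g : cmeasurable f -> cmeasurable g ->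
  L2norm mu (f \+ g)%R <= L2norm mu f + L2norm mu g.
Proof.
move=> mf mg; rewrite {2 3}/L2norm.
apply: le_trans (minkowski_EFin mu (measurable_normc mf) (measurable_normc mg) _);
  last by rewrite ler1n.
rewrite /L2norm unlock /=; apply: gt0_ler_poweR.
- by rewrite invr_ge0.
- by rewrite in_itv/= leey andbT integral_ge0// => x _; rewrite lee_fin powR_ge0.
- by rewrite in_itv/= leey andbT integral_ge0// => x _; rewrite lee_fin powR_ge0.
have m (u : T -> R) : measurable_fun setT u ->
    measurable_fun setT (fun x => (`|u x| `^ 2)%R%:E).
  move=> mu'; apply/measurable_EFinP.
  apply: (@measurableT_comp _ _ _ _ _ _ (fun y : R => y `^ 2)%R _ (fun x => `|u x|)%R) => //.
  exact: measurableT_comp.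
apply: ge0_le_integral => //=.
- by apply: m; exact/measurable_normc/cmeasurableD.
- by apply: m; apply: measurable_funD; exact: measurable_normc.
- move=> x _; rewrite lee_fin ge0_ler_powR ?nnegrE//.
  by rewrite !ger0_norm ?addr_ge0 ?normc_ge0//; exact: normcD.
Qed.

Lemma L2normN f : L2norm mu (fun x => - f x)%R = L2norm mu f.
Proof. by rewrite !L2normE /N2; under eq_integral do rewrite sqnN. Qed.

Lemma N2_ae_eq f g : cmeasurable f -> cmeasurable g -> f = g %[ae mu] ->
  N2 f = N2 g.
Proof.
move=> mf mg fg; apply: ae_eq_integral => //; try exact: emeasurable_sqn.
by move: fg; apply: filterS => x /(_ I) + _ => ->.
Qed.

Lemma L2norm_ae_eq f g : cmeasurable f -> cmeasurable g -> f = g %[ae mu] ->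
  L2norm mu f = L2norm mu g.
Proof. by move=> mf mg fg; rewrite !L2normE (N2_ae_eq mf mg fg). Qed.

Lemma N2_eq0 f : cmeasurable f -> N2 f = 0 -> f = (fun=> 0%R) %[ae mu].
Proof.
move=> mf f0; have : \int[mu]_x `|(sqn (f x))%:E| = 0.
  by rewrite -f0; apply: eq_integral => x _; rewrite gee0_abs// lee_fin sqn_ge0.
move=> /(ae_eq_integral_abs mu measurableT (emeasurable_sqn mf)).
by apply: filterS => x /(_ I)[] h _; exact: sqn_eq0.
Qed.

Lemma N2_ae_eq0 f : cmeasurable f -> f = (fun=> 0%R) %[ae mu] -> N2 f = 0.
Proof.
move=> mf f0; rewrite (N2_ae_eq mf (cmeasurable_cst _ _) f0) /N2.
by under eq_integral do rewrite sqn0; rewrite integral0.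
Qed.

Lemma N2B_eq0 f g : cmeasurable f -> cmeasurable g ->
  N2 (fun x => f x - g x)%R = 0 <-> f = g %[ae mu].
Proof.
move=> mf mg; split => [/N2_eq0|fg].
- move=> /(_ (cmeasurableB mf mg)); apply: filterS => x /(_ I)/eqP.
  by rewrite subr_eq0 => /eqP.
- apply: N2_ae_eq0; first exact: cmeasurableB.
  by move: fg; apply: filterS => x /(_ I) -> _; rewrite subrr.
Qed.

Lemma N2Z (z : R[i]) f : cmeasurable f ->
  N2 (fun x => z * f x)%R = (sqn z)%:E * N2 f.
Proof.
move=> mf; rewrite /N2; under eq_integral do rewrite sqnM EFinM.
by rewrite ge0_integralZl//; [exact: emeasurable_sqn|
  move=> x _; rewrite lee_fin sqn_ge0|rewrite lee_fin sqn_ge0].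
Qed.

Lemma N2D_le f g : cmeasurable f -> cmeasurable g ->
  N2 (fun x => f x + g x)%R <= 2%:E * N2 f + 2%:E * N2 g.
Proof.
move=> mf mg; have m f' : cmeasurable f' ->
    measurable_fun setT (fun x => (2 * sqn (f' x))%:E).
  by move=> ?; apply/measurable_EFinP/measurable_funM => //; exact: measurable_sqn.
have p f' x : 0 <= (2 * sqn (f' x))%:E by rewrite lee_fin mulr_ge0// sqn_ge0.
have Z f' : cmeasurable f' -> 2%:E * N2 f' = \int[mu]_x (2 * sqn (f' x))%:E.
  move=> mf'; rewrite /N2 -ge0_integralZl//; first exact: emeasurable_sqn.
  by move=> x _; rewrite lee_fin sqn_ge0.
rewrite !Z//; clear Z.
rewrite -ge0_integralD//; try exact: m.
apply: ge0_le_integral => //.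
- by move=> x _; rewrite lee_fin sqn_ge0.
- by apply: emeasurable_sqn; exact: cmeasurableD.
- by apply: emeasurable_funD; exact: m.
- by move=> x _; rewrite lee_fin; exact: sqnD_le.
Qed.

Lemma N2N f : N2 (fun x => - f x)%R = N2 f.
Proof. by rewrite /N2; under eq_integral do rewrite sqnN. Qed.

Lemma N2J f : N2 (fun x => conjc (f x)) = N2 f.
Proof. by rewrite /N2; under eq_integral do rewrite sqnJ. Qed.

Lemma L2D f g : L2 mu f -> L2 mu g -> L2 mu (fun x => f x + g x)%R.
Proof.
move=> /L2P[mf f2] /L2P[mg g2]; apply/L2P; split; first exact: cmeasurableD.
apply: le_lt_trans (N2D_le mf mg) _.
by rewrite lte_add_pinfty// lte_mul_pinfty ?lee_fin//.
Qed.

Lemma L2Z (z : R[i]) f : L2 mu f -> L2 mu (fun x => z * f x)%R.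
Proof.
move=> /L2P[mf f2]; apply/L2P; split.
  by apply: cmeasurableM => //; exact: cmeasurable_cst.
by rewrite N2Z// lte_mul_pinfty// lee_fin sqn_ge0.
Qed.

Lemma L2N f : L2 mu f -> L2 mu (fun x => - f x)%R.
Proof.
by move=> /L2P[mf f2]; apply/L2P; rewrite N2N; split => //; exact: cmeasurableN.
Qed.

Lemma L2B f g : L2 mu f -> L2 mu g -> L2 mu (fun x => f x - g x)%R.
Proof. by move=> hf hg; apply: L2D => //; exact: L2N. Qed.

Lemma L2J f : L2 mu f -> L2 mu (fun x => conjc (f x)).
Proof.
by move=> /L2P[mf f2]; apply/L2P; rewrite N2J; split => //; exact: cmeasurableJ.
Qed.

Lemma L2_cst0 : L2 mu (fun=> 0%R).
Proof.
apply/L2P; split; first exact: cmeasurable_cst.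
by rewrite /N2; under eq_integral do rewrite sqn0; rewrite integral0.
Qed.

Lemma L2_sum (I : Type) (s : seq I) (f : I -> T -> R[i]) :
  (forall i, L2 mu (f i)) -> L2 mu (fun x => \sum_(i <- s) f i x)%R.
Proof.
move=> hf; elim: s => [|i s IH].
  by under [X in L2 _ X]eq_fun do rewrite big_nil; exact: L2_cst0.
by under [X in L2 _ X]eq_fun do rewrite big_cons; exact: L2D.
Qed.

Lemma L2_le f g : cmeasurable f -> L2 mu g ->
  (forall x, sqn (f x) <= sqn (g x))%R -> L2 mu f.
Proof.
move=> mf /L2P[mg g2] fg; apply/L2P; split => //.
apply: le_lt_trans g2; apply: ge0_le_integral => //.
- by move=> x _; rewrite lee_fin sqn_ge0.
- exact: emeasurable_sqn.
- exact: emeasurable_sqn.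
- by move=> x _; rewrite lee_fin.
Qed.

Lemma L2_ae_eq f g : cmeasurable g -> f = g %[ae mu] -> L2 mu f -> L2 mu g.
Proof.
by move=> mg fg /L2P[mf f2]; apply/L2P; rewrite -(N2_ae_eq mf mg fg).
Qed.

Lemma L2_integrable_sqn f : L2 mu f -> mu.-integrable setT (fun x => (sqn (f x))%:E).
Proof.
move=> /L2P[mf f2]; apply/integrableP; split; first exact: emeasurable_sqn.
by under eq_integral do rewrite gee0_abs ?lee_fin ?sqn_ge0//.
Qed.

Lemma L2_fine f : L2 mu f -> L2norm mu f \is a fin_num.
Proof. by move=> [_ ?]; rewrite ge0_fin_numE// L2norm_ge0. Qed.

End L2_norm.

Lemma ae_imply d (T : measurableType d) (R : realType)
    (mu : {measure set T -> \bar R}) (P Q : T -> Prop) :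
  (forall x, P x -> Q x) -> {ae mu, forall x, P x} -> {ae mu, forall x, Q x}.
Proof. by move=> PQ; apply: filterS. Qed.

Lemma ae_imply2 d (T : measurableType d) (R : realType)
    (mu : {measure set T -> \bar R}) (P Q S : T -> Prop) :
  (forall x, P x -> Q x -> S x) -> {ae mu, forall x, P x} ->
  {ae mu, forall x, Q x} -> {ae mu, forall x, S x}.
Proof. by move=> PQ; apply: filterS2. Qed.

(** * Integrals of complex functions *)

Section complex_integral.
Context d (T : measurableType d) (R : realType).
Variable mu : {measure set T -> \bar R}.
Implicit Types f g : T -> R[i].

Definition N1 f : \bar R := (\int[mu]_x (Normc.normc (f x))%:E)%E.

Lemma Re_cintegral f : complex.Re (cintegral mu f) = \int[mu]_x complex.Re (f x).
Proof. by []. Qed.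

Lemma emeasurable_normc f : cmeasurable f ->
  measurable_fun setT (fun x => (Normc.normc (f x))%:E).
Proof. by move=> mf; apply/measurable_EFinP; exact: measurable_normc. Qed.

Lemma cintegrableP f : cintegrable mu f <-> cmeasurable f /\ (N1 f < +oo)%E.
Proof.
split.
- move=> [f1 f2].
  have mf : cmeasurable f.
    by split; apply/measurable_EFinP; exact: (measurable_int mu).
  split => //.
  apply: (@le_lt_trans _ _ (\int[mu]_x (`|(complex.Re (f x))%:E| + `|(complex.Im (f x))%:E|))%E).
    apply: ge0_le_integral => //.
    + by move=> x _; rewrite lee_fin normc_ge0.
    + exact: emeasurable_normc.
    + by apply: emeasurable_funD; apply: measurableT_comp => //;
        [have := measurable_int mu f1|have := measurable_int mu f2].
    + by move=> x _; rewrite lee_fin normc_ReIm.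
  rewrite ge0_integralD//.
  + by apply: lte_add_pinfty; [have /integrableP[] := f1|have /integrableP[] := f2].
  + by apply: measurableT_comp => //; have := measurable_int mu f1.
  + by apply: measurableT_comp => //; have := measurable_int mu f2.
- move=> [mf f1]; split.
  + apply/integrableP; split; first by apply/measurable_EFinP; case: mf.
    apply: le_lt_trans f1; apply: ge0_le_integral => //.
    * by apply/measurable_EFinP; apply: measurableT_comp => //; case: mf.
    * exact: emeasurable_normc.
    * by move=> x _; rewrite lee_fin normc_Re.
  + apply/integrableP; split; first by apply/measurable_EFinP; case: mf.
    apply: le_lt_trans f1; apply: ge0_le_integral => //.
    * by apply/measurable_EFinP; apply: measurableT_comp => //; case: mf.
    * exact: emeasurable_normc.
    * by move=> x _; rewrite lee_fin normc_Im.
Qed.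

Lemma cintegrable_measurable f : cintegrable mu f -> cmeasurable f.
Proof. by move=> /cintegrableP[]. Qed.

Lemma cintegrable_le (M : R) f g : cmeasurable g -> cintegrable mu f ->
  (forall x, Normc.normc (g x) <= M * Normc.normc (f x)) -> cintegrable mu g.
Proof.
move=> mg /cintegrableP[mf f1] gf; apply/cintegrableP; split => //.
apply: (@le_lt_trans _ _ (\int[mu]_x (`|M|%:E * (Normc.normc (f x))%:E))%E).
  apply: ge0_le_integral => //.
  - by move=> x _; rewrite lee_fin normc_ge0.
  - exact: emeasurable_normc.
  - by apply/measurable_EFinP/measurable_funM => //; exact: measurable_normc.
  - move=> x _; rewrite lee_fin (le_trans (gf x))// ler_wpM2r ?normc_ge0//.
    exact: ler_norm.
rewrite ge0_integralZl//.
- by rewrite lte_mul_pinfty// lee_fin.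
- exact: emeasurable_normc.
- by move=> x _; rewrite lee_fin normc_ge0.
Qed.

Lemma cintegrable_bounded (M : R) f g : cmeasurable g -> cintegrable mu f ->
  (forall x, Normc.normc (g x) <= M) -> cintegrable mu (fun x => f x * g x).
Proof.
move=> mg hf gM; apply: (@cintegrable_le M _ _ _ hf).
  by apply: cmeasurableM => //; exact: cintegrable_measurable.
by move=> x; rewrite Normc.normcM mulrC ler_wpM2r ?normc_ge0.
Qed.

Lemma cintegrableD f g : cintegrable mu f -> cintegrable mu g ->
  cintegrable mu (fun x => f x + g x).
Proof.
move=> [f1 f2] [g1 g2]; split; under eq_fun do rewrite ReImE EFinD;
  exact: integrableD.
Qed.

Lemma cintegrableZ (z : R[i]) f : cintegrable mu f ->
  cintegrable mu (fun x => z * f x).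
Proof.
move=> hf; apply: (@cintegrable_le (Normc.normc z) f) => //.
  apply: cmeasurableM; first exact: cmeasurable_cst.
  exact: cintegrable_measurable.
by move=> x; rewrite Normc.normcM.
Qed.

Lemma cintegrableN f : cintegrable mu f -> cintegrable mu (fun x => - f x).
Proof.
by move=> /(cintegrableZ (-1)); under eq_fun do rewrite mulN1r.
Qed.

Lemma cintegrableB f g : cintegrable mu f -> cintegrable mu g ->
  cintegrable mu (fun x => f x - g x).
Proof. by move=> hf hg; apply: cintegrableD => //; exact: cintegrableN. Qed.

Lemma cintegrableJ f : cintegrable mu f -> cintegrable mu (fun x => conjc (f x)).
Proof.
move=> hf; apply: (@cintegrable_le 1 f) => //.
  by apply: cmeasurableJ; exact: cintegrable_measurable.
by move=> x; rewrite normcJ mul1r.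
Qed.

Lemma cintegralD f g : cintegrable mu f -> cintegrable mu g ->
  cintegral mu (fun x => f x + g x) = cintegral mu f + cintegral mu g.
Proof.
move=> [f1 f2] [g1 g2]; apply: complex_ext; rewrite ReImE /=.
- by under eq_Rintegral do rewrite ReImE; rewrite RintegralD.
- by under eq_Rintegral do rewrite ReImE; rewrite RintegralD.
Qed.

Lemma cintegralZ (z : R[i]) f : cintegrable mu f ->
  cintegral mu (fun x => z * f x) = z * cintegral mu f.
Proof.
move=> [f1 f2]; have Zi (k : R) (h : T -> R) : mu.-integrable setT (EFin \o h) ->
    mu.-integrable setT (EFin \o (fun x => k * h x)).
  by move=> /(integrableZl measurableT k); exact: eq_integrable.
apply: complex_ext; rewrite ReImE /=.
- by under eq_Rintegral do rewrite ReImE; rewrite RintegralB ?RintegralZl//; exact: Zi.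
- by under eq_Rintegral do rewrite ReImE; rewrite RintegralD ?RintegralZl//; exact: Zi.
Qed.

Lemma cintegralN f : cintegrable mu f ->
  cintegral mu (fun x => - f x) = - cintegral mu f.
Proof.
move=> hf; rewrite -mulN1r -cintegralZ//; congr cintegral.
by apply/funext => x; rewrite mulN1r.
Qed.

Lemma cintegralB f g : cintegrable mu f -> cintegrable mu g ->
  cintegral mu (fun x => f x - g x) = cintegral mu f - cintegral mu g.
Proof.
by move=> hf hg; rewrite cintegralD ?cintegralN//; exact: cintegrableN.
Qed.

Lemma cintegralJ f : cintegrable mu f ->
  cintegral mu (fun x => conjc (f x)) = conjc (cintegral mu f).
Proof.
move=> [f1 f2]; apply: complex_ext; rewrite ReImE /=.
- by under eq_Rintegral do rewrite ReImE.
- under eq_Rintegral do rewrite ReImE -mulN1r.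
  by rewrite RintegralZl// mulN1r.
Qed.

(** The usual rotation by the phase of the integral [I], left unnormalised: [|I|^2] is the real part
    of the integral of [conjc I * f], so a real estimate suffices, and [|I|] is divided out at the
    end. *)
Lemma cintegral_N1 f : cintegrable mu f ->
  ((Normc.normc (cintegral mu f))%:E <= N1 f)%E.
Proof.
move=> hf; have /cintegrableP[mf f1] := hf.
have iN : mu.-integrable setT (fun x => (Normc.normc (f x))%:E).
  apply/integrableP; split; first exact: emeasurable_normc.
  by under eq_integral do rewrite gee0_abs ?lee_fin ?normc_ge0//.
have [I IE] : exists I, I = cintegral mu f by exists (cintegral mu f).
rewrite -IE.
have [I0|I0] := eqVneq (Normc.normc I) 0.
  by rewrite I0; apply: integral_ge0 => x _; rewrite lee_fin normc_ge0.
have Igt0 : 0 < Normc.normc I by rewrite lt_neqAle eq_sym I0 normc_ge0.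
have key : Normc.normc I ^+ 2 <= Normc.normc I * fine (N1 f).
  have -> : Normc.normc I ^+ 2 = complex.Re (cintegral mu (fun x => conjc I * f x)).
    by rewrite cintegralZ// -IE ReM ReJ ImJ -sqnE /sqn mulNr opprK -!expr2.
  rewrite [complex.Re _]/= -RintegralZl//; apply: le_Rintegral => //.
  - by have [] := cintegrableZ (conjc I) hf.
  - by have := integrableZl measurableT (Normc.normc I) iN; exact: eq_integrable.
  - move=> x _; rewrite -[Normc.normc I]normcJ -Normc.normcM.
    by rewrite (le_trans (ler_norm _))// normc_Re.
have N1f : N1 f \is a fin_num.
  by rewrite ge0_fin_numE//; apply: integral_ge0 => x _; rewrite lee_fin normc_ge0.
by rewrite -(fineK N1f) lee_fin -(ler_pM2l Igt0).
Qed.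

(** The modulus of the product is at most the sum of the two squared moduli. *)
Lemma cintegrable_L2M f g : L2 mu f -> L2 mu g ->
  cintegrable mu (fun x => f x * g x).
Proof.
move=> f2 g2; have [/L2P[mf _] /L2P[mg _]] := (f2, g2).
apply: (@cintegrable_le 1 (fun x => real_complex R (sqn (f x) + sqn (g x)))).
- exact: cmeasurableM.
- split => /=; last exact: integrable0.
  under eq_fun do rewrite EFinD.
  by apply: integrableD => //; exact: L2_integrable_sqn.
- move=> x; rewrite normcR Normc.normcM mul1r !sqnE.
  rewrite (le_trans _ (ler_norm _))//.
  have := normc_ge0 (f x); have := normc_ge0 (g x).
  have := sqr_ge0 (Normc.normc (f x) - Normc.normc (g x)); nra.
Qed.

End complex_integral.

(** * Fubini for complex functions *)

Section complex_fubini.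
Context d d' (T : measurableType d) (U : measurableType d') (R : realType).
Variables (mu : {sigma_finite_measure set T -> \bar R}).
Variables (nu : {sigma_finite_measure set U -> \bar R}).
Implicit Types F : T * U -> R[i].

(** Positive and negative parts are integrated separately; the difference is measurable even where
    the inner integral diverges. *)
Lemma measurable_Rintegral (u : T * U -> R) : measurable_fun setT u ->
  measurable_fun setT (fun x => \int[nu]_y u (x, y)).
Proof.
move=> mu'; apply: measurableT_comp => //.
have -> : (fun x => \int[nu]_y (u (x, y))%:E)%E = (fun x =>
   \int[nu]_y (EFin \o u)^\+ (x, y) - \int[nu]_y (EFin \o u)^\- (x, y))%E.
  apply/funext => x; rewrite [LHS]integralE.
  by congr (_ - _)%E; apply: eq_integral => y _; rewrite unlock.
apply: emeasurable_funB.
- apply: (@measurable_fun_fubini_tonelli_F _ _ _ _ _ nu) => //.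
  by apply: measurable_funepos; exact/measurable_EFinP.
- apply: (@measurable_fun_fubini_tonelli_F _ _ _ _ _ nu) => //.
  by apply: measurable_funeneg; exact/measurable_EFinP.
Qed.

Lemma cmeasurable_cintegral F : cmeasurable F ->
  cmeasurable (fun x => cintegral nu (fun y => F (x, y))).
Proof.
move=> [m1 m2]; split.
- exact: (measurable_Rintegral m1).
- exact: (measurable_Rintegral m2).
Qed.

(** The inner integral is finite almost everywhere only; passing to its [fine] part changes it on a
    null set. *)
Lemma Rintegral12 (u : T * U -> R) : (mu \x nu)%E.-integrable setT (EFin \o u) ->
  \int[mu]_x \int[nu]_y u (x, y) = fine (\int[(mu \x nu)%E]_z (u z)%:E).
Proof.
move=> iu; rewrite /Rintegral; congr fine.
have iF := integrable_fubini_F iu.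
rewrite -(integral12_prod_meas1 iu); apply: ae_eq_integral => //.
- apply/measurable_EFinP; apply: measurable_Rintegral; apply/measurable_EFinP.
  exact: (measurable_int _ iu).
- exact: (measurable_int _ iF).
- have := integrable_ae measurableT iF; apply: filterS => x /(_ I) fx _.
  by rewrite fineK.
Qed.

Lemma Rintegral21 (u : T * U -> R) : (mu \x nu)%E.-integrable setT (EFin \o u) ->
  \int[nu]_y \int[mu]_x u (x, y) = fine (\int[(mu \x nu)%E]_z (u z)%:E).
Proof.
move=> iu; rewrite /Rintegral; congr fine.
rewrite -(integral21_prod_meas1 iu); apply: ae_eq_integral => //.
- apply/measurable_EFinP.
  have -> : (fun y => fine (\int[mu]_x (u (x, y))%:E)) =
     (fun y => fine (fubini_G mu (EFin \o u) y)) by [].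
  by apply: measurableT_comp => //; exact: (measurable_fubini_G iu).
- exact: (measurable_fubini_G iu).
- have := ae_integrable2 iu; apply: filterS => y iy _.
  by rewrite fineK//; exact: integrable_fin_num.
Qed.

Lemma cFubini F : cintegrable (mu \x nu)%E F ->
  cintegral mu (fun x => cintegral nu (fun y => F (x, y))) =
  cintegral nu (fun y => cintegral mu (fun x => F (x, y))).
Proof.
move=> [F1 F2]; apply: complex_ext => /=.
- by rewrite (Rintegral12 F1) (Rintegral21 F1).
- by rewrite (Rintegral12 F2) (Rintegral21 F2).
Qed.

Lemma N1_prod (a : T -> R[i]) (b : U -> R[i]) : cmeasurable a -> cmeasurable b ->
  N1 (mu \x nu)%E (fun z => a z.1 * b z.2) = (N1 mu a * N1 nu b)%E.
Proof.
move=> ma mb; rewrite /N1 fubini_tonelli1//; last 2 first.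
- apply: emeasurable_normc; apply: cmeasurableM.
  + exact: (cmeasurable_comp ma measurable_fst).
  + exact: (cmeasurable_comp mb measurable_snd).
- by move=> z; rewrite lee_fin normc_ge0.
rewrite /fubini_F /=.
under eq_integral => x _.
  under eq_integral do rewrite Normc.normcM EFinM.
  rewrite ge0_integralZl//; last 3 first.
  - exact: emeasurable_normc.
  - by move=> y _; rewrite lee_fin normc_ge0.
  - by rewrite lee_fin normc_ge0.
  over.
rewrite ge0_integralZr//.
- exact: emeasurable_normc.
- by move=> y _; rewrite lee_fin normc_ge0.
- by apply: integral_ge0 => y _; rewrite lee_fin normc_ge0.
Qed.

Lemma cintegrable_prod (a : T -> R[i]) (b : U -> R[i]) :
  cintegrable mu a -> cintegrable nu b ->
  cintegrable (mu \x nu)%E (fun z => a z.1 * b z.2).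
Proof.
move=> /cintegrableP[ma a1] /cintegrableP[mb b1]; apply/cintegrableP; split.
  apply: cmeasurableM.
  + exact: (cmeasurable_comp ma measurable_fst).
  + exact: (cmeasurable_comp mb measurable_snd).
rewrite N1_prod// lte_mul_pinfty//.
- by apply: integral_ge0 => y _; rewrite lee_fin normc_ge0.
- by rewrite ge0_fin_numE//; apply: integral_ge0 => y _; rewrite lee_fin normc_ge0.
Qed.

(** The multiplication formula: [a x * b y] is integrable on the product, a factor bounded by 1
    keeps it so, and Fubini applies. With a character for [e], it moves a Fourier integral from one
    factor to the other. *)
Lemma cintegral_kernel_swap (a : T -> R[i]) (b : U -> R[i]) (e : T * U -> R[i]) :
  cintegrable mu a -> cintegrable nu b -> cmeasurable e ->
  (forall z, Normc.normc (e z) <= 1) ->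
  cintegral mu (fun x => a x * cintegral nu (fun y => b y * e (x, y))) =
  cintegral nu (fun y => b y * cintegral mu (fun x => a x * e (x, y))).
Proof.
move=> ia ib me e1.
have m1 x : cmeasurable (fun y => e (x, y)).
  exact: (cmeasurable_comp me (measurable_pair1 x)).
have m2 y : cmeasurable (fun x => e (x, y)).
  exact: (cmeasurable_comp me (measurable_pair2 y)).
have iab := cintegrable_bounded me (cintegrable_prod ia ib) e1.
transitivity (cintegral mu (fun x => cintegral nu (fun y => a x * b y * e (x, y)))).
  congr cintegral; apply/funext => x; rewrite -cintegralZ.
    by congr cintegral; apply/funext => y; rewrite mulrA.
  by apply: (@cintegrable_bounded _ _ _ _ 1).
rewrite (cFubini iab).
congr cintegral; apply/funext => y; rewrite -cintegralZ.
  by congr cintegral; apply/funext => x /=; rewrite mulrA (mulrC (b y)).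
by apply: (@cintegrable_bounded _ _ _ _ 1).
Qed.

End complex_fubini.

(** * Fourier inversion and Plancherel from an approximate identity *)

Section weighted_mean.
Context d (T : measurableType d) (R : realType).
Variable mu : {measure set T -> \bar R}.

Lemma integrable_ge0_fin (u : T -> R) : measurable_fun setT u ->
  (forall x, 0 <= u x) -> (\int[mu]_x (u x)%:E < +oo)%E ->
  mu.-integrable setT (EFin \o u).
Proof.
move=> mu' u0 ui; apply/integrableP; split; first exact/measurable_EFinP.
by under eq_integral do rewrite gee0_abs ?lee_fin//.
Qed.

(** Jensen's inequality for the probability density [rho]: the variance of [u] is nonnegative. If
    the right side is infinite, the claim is immediate. *)
Lemma sqr_mean_le (rho u : T -> R) : measurable_fun setT rho ->
  measurable_fun setT u -> (forall x, 0 <= rho x) ->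
  (\int[mu]_x (rho x)%:E = 1)%E ->
  mu.-integrable setT (fun x => (u x * rho x)%:E) ->
  (((\int[mu]_x (u x * rho x)) ^+ 2)%:E <= \int[mu]_x (rho x * u x ^+ 2)%:E)%E.
Proof.
move=> mrho mu' rho0 rho1 iu.
have q0 x : (0 <= (rho x * u x ^+ 2)%:E)%E by rewrite lee_fin mulr_ge0// sqr_ge0.
have mq : measurable_fun setT (fun x => rho x * u x ^+ 2).
  by apply: measurable_funM => //; exact: measurable_funX.
have [|fin] := leP +oo%E (\int[mu]_x (rho x * u x ^+ 2)%:E)%E.
  by rewrite leye_eq => /eqP ->; rewrite leey.
have irho : mu.-integrable setT (EFin \o rho).
  by apply: integrable_ge0_fin => //; rewrite rho1 ltry.
have iq : mu.-integrable setT (EFin \o (fun x => rho x * u x ^+ 2)).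
  by apply: integrable_ge0_fin => // x; rewrite -lee_fin.
have iu' : mu.-integrable setT (EFin \o (fun x => u x * rho x)) by [].
set m := \int[mu]_x (u x * rho x).
have mE : (\int[mu]_x (u x * rho x)%:E = m%:E)%E.
  by rewrite /m /Rintegral fineK//; exact: (integrable_fin_num measurableT iu').
have Zi (k : R) (h : T -> R) : mu.-integrable setT (EFin \o h) ->
    mu.-integrable setT (EFin \o (fun x => k * h x)).
  by move=> /(integrableZl measurableT k); exact: eq_integrable.
have h0 : (0 <= \int[mu]_x (rho x * (u x - m) ^+ 2)%:E)%E.
  by apply: integral_ge0 => x _; rewrite lee_fin mulr_ge0// sqr_ge0.
have : (\int[mu]_x (rho x * (u x - m) ^+ 2)%:E =
    \int[mu]_x (rho x * u x ^+ 2)%:E - (m ^+ 2)%:E)%E.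
  under eq_integral => x _.
    rewrite (_ : rho x * (u x - m) ^+ 2 = rho x * u x ^+ 2 +
      ((- 2 * m) * (u x * rho x) + m ^+ 2 * rho x)); last by ring.
    rewrite EFinD; over.
  rewrite integralD//=; last first.
    by under eq_fun do rewrite EFinD; apply: integrableD => //; exact: Zi.
  under [X in (_ + X)%E]eq_integral do rewrite EFinD.
  rewrite integralD//=; [|exact: Zi|exact: Zi].
  under [X in (_ + (X + _))%E]eq_integral do rewrite EFinM.
  under [X in (_ + (_ + X))%E]eq_integral do rewrite EFinM.
  rewrite !integralZl// mE rho1 -!EFinM -EFinD.
  by congr (_ + _%:E)%E; ring.
by move=> E; move: h0; rewrite E sube_ge0// fin_numE.
Qed.

End weighted_mean.

Section cauchy_schwarz.
Context d (T : measurableType d) (R : realType).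
Variable mu : {measure set T -> \bar R}.

Lemma N1M_le (f g : T -> R[i]) : cmeasurable f -> cmeasurable g ->
  (N1 mu (fun x => f x * g x)%R <= L2norm mu f * L2norm mu g)%E.
Proof.
move=> mf mg.
have -> : N1 mu (fun x => f x * g x)%R = 'N[mu]_1[EFin \o ((fun x => Normc.normc (f x)) \* (fun x => Normc.normc (g x)))%R]%E.
  rewrite Lnorm1; apply: eq_integral => x _ /=.
  by rewrite Normc.normcM ger0_norm// mulr_ge0// normc_ge0.
apply: hoelder => //; try exact: measurable_normc.
by field.
Qed.

End cauchy_schwarz.

Section fourier_kernel.
Context d (T : measurableType d) (R : realType).
Variable mu : {sigma_finite_measure set T -> \bar R}.

(** A Dirichlet form. For a symmetric probability kernel it dominates the squared distance between
    [h] and its average by [k], and it is a quadratic form bounded on L^2, so its limits can be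
    tested on a dense set. *)
Definition oscillation (k : T -> T -> R) (h : T -> R) : \bar R :=
  (\int[mu]_x \int[mu]_y (k x y * (h x - h y) ^+ 2)%:E)%E.

(* The weights [w n] increase to 1 and [c * k n] is the Fourier transform of
   [w n]: an approximate identity, whence Fourier inversion and Plancherel. *)
Record fourier_kernel (dot : T -> T -> R) (c : R) (w : nat -> T -> R)
    (k : nat -> T -> T -> R) : Prop := FourierKernel {
  fk_dotC : forall x y, dot x y = dot y x;
  fk_mdot : measurable_fun setT (fun z : T * T => dot z.1 z.2);
  fk_c : 0 < c;
  fk_mw : forall n, measurable_fun setT (w n);
  fk_w0 : forall n x, 0 <= w n x;
  fk_w1 : forall n x, w n x <= 1;
  fk_wnd : forall x, nondecreasing_seq (w ^~ x);
  fk_wcvg : forall x, w n x @[n --> \oo] --> (1 : R);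
  fk_wint : forall n, mu.-integrable setT (EFin \o w n);
  fk_k0 : forall n x y, 0 <= k n x y;
  fk_kC : forall n x y, k n x y = k n y x;
  fk_mk : forall n, measurable_fun setT (fun z : T * T => k n z.1 z.2);
  fk_kint : forall n x, (\int[mu]_y (k n x y)%:E = 1)%E;
  fk_kbd : forall n, exists M : R, forall x y, k n x y <= M;
  fk_FT : forall n x y, cintegral mu (fun s => real_complex R (w n s) *
            (expi (dot s x) * expi (- dot s y))) = real_complex R (c * k n x y);
  fk_approx : forall h : T -> R, measurable_fun setT h ->
    (\int[mu]_x (h x ^+ 2)%:E < +oo)%E ->
    (fun n => oscillation (k n) h) @ \oo --> 0%E }.

End fourier_kernel.

Section fourier_theory.
Context d (T : measurableType d) (R : realType).
Variable mu : {sigma_finite_measure set T -> \bar R}.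
Variables (dot : T -> T -> R) (c : R) (w : nat -> T -> R) (k : nat -> T -> T -> R).
Hypothesis fk : fourier_kernel mu dot c w k.
Implicit Types (f g h F G : T -> R[i]).

Let C t := real_complex R t.

(** [c] is the constant of Plancherel: [2 pi] on the line, its square on the plane. *)
Definition inv_fourier h (s : T) : R[i] :=
  real_complex R c^-1 * cintegral mu (fun x => h x * expi (dot s x)).

Let mdot1 s : measurable_fun setT (dot s).
Proof. exact: (measurableT_comp (fk_mdot fk) (measurable_pair1 s)). Qed.

Let mdot2 s : measurable_fun setT (dot^~ s).
Proof. exact: (measurableT_comp (fk_mdot fk) (measurable_pair2 s)). Qed.

Let mk1 n x : measurable_fun setT (k n x).
Proof. exact: (measurableT_comp (fk_mk fk n) (measurable_pair1 x)). Qed.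

Let mk2 n x : measurable_fun setT (k n ^~ x).
Proof. exact: (measurableT_comp (fk_mk fk n) (measurable_pair2 x)). Qed.

Let me1 s : cmeasurable (fun x => expi (dot s x)).
Proof. exact: cmeasurable_expi. Qed.

Let me2 s : cmeasurable (fun x => expi (- dot x s)).
Proof. by apply: cmeasurable_expi; exact: measurableT_comp. Qed.

Let me1' s : cmeasurable (fun x => expi (- dot s x)).
Proof. by apply: cmeasurable_expi; exact: measurableT_comp. Qed.

Let meT : cmeasurable (fun z : T * T => expi (dot z.1 z.2)).
Proof. exact: cmeasurable_expi (fk_mdot fk). Qed.

Let meTN : cmeasurable (fun z : T * T => expi (- dot z.1 z.2)).
Proof. by apply: cmeasurable_expi; apply: measurableT_comp (fk_mdot fk). Qed.

Let ce1 t : Normc.normc (expi t : R[i]) <= 1.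
Proof. by rewrite normc_expi. Qed.

Let Cw n := fun s => C (w n s).

Let mCw n : cmeasurable (Cw n).
Proof. exact: cmeasurableR (fk_mw fk n). Qed.

Let iCw n : cintegrable mu (Cw n).
Proof. by split => /=; [exact: (fk_wint fk)|exact: integrable0]. Qed.

Lemma cmeasurable_inv_fourier h : cmeasurable h -> cmeasurable (inv_fourier h).
Proof.
move=> mh; apply: cmeasurableM; first exact: cmeasurable_cst.
apply: (@cmeasurable_cintegral _ _ _ _ _ mu (fun z => h z.2 * expi (dot z.1 z.2))).
by apply: cmeasurableM => //; exact: (cmeasurable_comp mh measurable_snd).
Qed.

Lemma cmeasurable_fourier h : cmeasurable h -> cmeasurable (fourier mu dot h).
Proof.
move=> mh.
apply: (@cmeasurable_cintegral _ _ _ _ _ mu (fun z => h z.2 * expi (- dot z.2 z.1))).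
apply: cmeasurableM; first exact: (cmeasurable_comp mh measurable_snd).
by under eq_fun do rewrite (fk_dotC fk).
Qed.

(** Conjugation exchanges the kernels of the two transforms; bounds and Plancherel shown for
    [inv_fourier] pass to [fourier] in this way. *)
Lemma fourier_conj h : cintegrable mu h ->
  fourier mu dot h =
  (fun xi => C c * conjc (inv_fourier (fun x => conjc (h x)) xi)).
Proof.
move=> ih; apply/funext => xi.
have cV : C c * C c^-1 = 1.
  by rewrite /C -[_ * _]rmorphM /= divff ?gt_eqF ?(fk_c fk).
rewrite /fourier /inv_fourier conjcZ mulrA cV mul1r.
rewrite -cintegralJ.
  congr cintegral; apply/funext => x.
  by rewrite conjcM conjcK expiJ (fk_dotC fk).
by apply: (@cintegrable_bounded _ _ _ _ 1) => //; exact: cintegrableJ.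
Qed.

Lemma fourierD (a : R[i]) f g : cintegrable mu f -> cintegrable mu g ->
  fourier mu dot (fun x => a * f x + g x) =
  (fun xi => a * fourier mu dot f xi + fourier mu dot g xi).
Proof.
move=> hf hg; apply/funext => xi; rewrite /fourier.
under [X in cintegral mu X]eq_fun do rewrite mulrDl -mulrA.
rewrite cintegralD ?cintegralZ//; try apply: cintegrableZ;
  exact: (@cintegrable_bounded _ _ _ _ 1).
Qed.

Lemma inv_fourier_bounded h : cintegrable mu h ->
  exists M : R, forall s, Normc.normc (inv_fourier h s) <= M.
Proof.
move=> ih; exists (c^-1 * fine (N1 mu h)) => s.
rewrite Normc.normcM normcR gtr0_norm ?invr_gt0 ?(fk_c fk)//.
rewrite ler_pM2l ?invr_gt0 ?(fk_c fk)//.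
have N1h : N1 mu h \is a fin_num.
  have /cintegrableP[_ h1] := ih.
  by rewrite ge0_fin_numE//; apply: integral_ge0 => x _; rewrite lee_fin normc_ge0.
rewrite -lee_fin fineK//; apply: le_trans (cintegral_N1 _) _.
  exact: (@cintegrable_bounded _ _ _ _ 1).
have -> : N1 mu (fun x => h x * expi (dot s x)) = N1 mu h; last by [].
by apply: eq_integral => x _; rewrite Normc.normcM normc_expi mulr1.
Qed.

(** [inv_fourier h] is bounded but perhaps not integrable; the integrable weight makes its Fourier
    transform an integral. *)
Definition regularized n h s : R[i] := C (w n s) * inv_fourier h s.

Lemma cintegrable_regularized n h : cintegrable mu h ->
  cintegrable mu (regularized n h).
Proof.
move=> ih; have [M hM] := inv_fourier_bounded ih.
apply: (cintegrable_bounded _ (iCw n) hM).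
exact: cmeasurable_inv_fourier (cintegrable_measurable ih).
Qed.

Definition smooth n h xi : R[i] := cintegral mu (fun x => h x * C (k n x xi)).

Lemma cmeasurable_smooth n h : cmeasurable h -> cmeasurable (smooth n h).
Proof.
move=> mh.
apply: (@cmeasurable_cintegral _ _ _ _ _ mu (fun z => h z.2 * C (k n z.2 z.1))).
apply: cmeasurableM; first exact: (cmeasurable_comp mh measurable_snd).
apply: cmeasurableR; under eq_fun do rewrite (fk_kC fk).
exact: (fk_mk fk).
Qed.

(** Once the two integrals are exchanged, the inner one is that of [fk_FT], namely [c * k n], and
    [c] cancels against the normalisation of [inv_fourier]. *)
Lemma fourier_regularized n h : cintegrable mu h ->
  fourier mu dot (regularized n h) = smooth n h.
Proof.
move=> ih; apply/funext => xi; rewrite /fourier /regularized /inv_fourier.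
have iwe : cintegrable mu (fun s => Cw n s * expi (- dot s xi)).
  exact: (@cintegrable_bounded _ _ _ _ 1).
transitivity (C c^-1 * cintegral mu (fun s => (Cw n s * expi (- dot s xi)) *
    cintegral mu (fun x => h x * expi (dot s x)))).
  rewrite -cintegralZ.
    by congr cintegral; apply/funext => s; rewrite /Cw -/C; ring.
  have [M hM] := inv_fourier_bounded ih.
  apply: (@cintegrable_bounded _ _ _ _ (c * M)) => // [|s].
    by apply: (@cmeasurable_cintegral _ _ _ _ _ mu (fun z => h z.2 * expi (dot z.1 z.2)));
      apply: cmeasurableM => //;
      exact: (cmeasurable_comp (cintegrable_measurable ih) measurable_snd).
  have := hM s; rewrite Normc.normcM normcR gtr0_norm ?invr_gt0 ?(fk_c fk)//.
  by rewrite mulrC ler_pdivrMr ?(fk_c fk)// mulrC.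
rewrite (cintegral_kernel_swap iwe ih meT) => [|z]; last exact: ce1.
rewrite -cintegralZ; last first.
  have [M hM] := fk_kbd fk n.
  apply: (@cintegrable_bounded _ _ _ _ (c * M)) => // [|x].
    apply: (@cmeasurable_cintegral _ _ _ _ _ mu (fun z => Cw n z.2 * expi (- dot z.2 xi) * expi (dot z.2 z.1))).
    apply: cmeasurableM; first exact: (cmeasurable_comp (cintegrable_measurable iwe) measurable_snd).
    by under eq_fun do rewrite (fk_dotC fk).
  have -> : cintegral mu (fun x0 => Cw n x0 * expi (- dot x0 xi) * expi (dot x0 x)) = C (c * k n x xi).
    by rewrite /C -(fk_FT fk); congr cintegral; apply/funext => s; rewrite /Cw -/C; ring.
  rewrite normcR ger0_norm; first by rewrite ler_pM2l ?(fk_c fk).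
  by apply: mulr_ge0; [exact/ltW/(fk_c fk)|exact: (fk_k0 fk)].
rewrite /smooth; congr cintegral; apply/funext => x.
have -> : cintegral mu (fun x0 => Cw n x0 * expi (- dot x0 xi) * expi (dot x0 x)) = C (c * k n x xi).
  by rewrite /C -(fk_FT fk); congr cintegral; apply/funext => s; rewrite /Cw -/C; ring.
rewrite mulrCA; congr (_ * _); rewrite /C -[_ * _]rmorphM /= mulrA mulVf ?mul1r//.
by rewrite gt_eqF// (fk_c fk).
Qed.

End fourier_theory.

(** * Continuity of the norm and uniqueness of limits in L^2 *)

Section L2_norm_continuity.
Context d (T : measurableType d) (R : realType).
Variable mu : {measure set T -> \bar R}.
Implicit Types f g : T -> R[i].
Local Open Scope ereal_scope.

Lemma L2normBC f g : L2norm mu (fun x => f x - g x)%R = L2norm mu (fun x => g x - f x)%R.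
Proof. by rewrite -L2normN; congr L2norm; apply/funext => x; rewrite opprB. Qed.

Lemma L2norm_triangle f g h : L2 mu f -> L2 mu g -> L2 mu h ->
  L2norm mu (fun x => f x - h x)%R <=
  L2norm mu (fun x => f x - g x)%R + L2norm mu (fun x => g x - h x)%R.
Proof.
move=> [mf _] [mg _] [mh _].
have -> : (fun x => f x - h x)%R = ((fun x => f x - g x) \+ (fun x => g x - h x))%R.
  by apply/funext => x /=; rewrite addrA subrK.
by apply: L2normD; exact: cmeasurableB.
Qed.

Lemma L2norm_leD f g : L2 mu f -> L2 mu g ->
  L2norm mu f <= L2norm mu g + L2norm mu (fun x => f x - g x)%R.
Proof.
move=> [mf _] [mg _].
have {1}-> : f = (g \+ (fun x => f x - g x))%R.
  by apply/funext => x /=; rewrite addrC subrK.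
by apply: L2normD => //; exact: cmeasurableB.
Qed.

Lemma cvg_L2norm (v : nat -> T -> R[i]) f : (forall n, L2 mu (v n)) -> L2 mu f ->
  (fun n => L2norm mu (v n \- f)%R) @ \oo --> 0 ->
  (fun n => L2norm mu (v n)) @ \oo --> L2norm mu f.
Proof.
move=> v2 f2 vf.
apply: (@squeeze_cvge _ _ _ _ (fun n => L2norm mu f - L2norm mu (v n \- f)%R) _
   (fun n => L2norm mu f + L2norm mu (v n \- f)%R)).
- near=> n; rewrite leeBlDr; last exact: (L2_fine (L2B (v2 n) f2)).
  by rewrite L2normBC !L2norm_leD//= L2normBC L2norm_leD.
- rewrite -[X in _ --> X]sube0; apply: cvgeB => //; last exact: cvg_cst.
  by rewrite fin_num_adde_defl// fin_numN.
- by rewrite -[X in _ --> X]adde0; apply: cvgeD => //; [rewrite fin_num_adde_defl|exact: cvg_cst].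
Unshelve. all: by end_near. Qed.

Lemma L2_cvg_ae_eq (v : nat -> T -> R[i]) f g : (forall n, L2 mu (v n)) ->
  L2 mu f -> L2 mu g ->
  (fun n => L2norm mu (v n \- f)%R) @ \oo --> 0 ->
  (fun n => L2norm mu (v n \- g)%R) @ \oo --> 0 -> f = g %[ae mu].
Proof.
move=> v2 f2 g2 vf vg.
have fg0 : L2norm mu (fun x => f x - g x)%R = 0.
  have fg n : L2norm mu (fun x => f x - g x)%R <= L2norm mu (v n \- f)%R + L2norm mu (v n \- g)%R.
    by rewrite [X in _ <= X + _]L2normBC; exact: L2norm_triangle.
  apply/eqP; rewrite eq_le L2norm_ge0 andbT.
  have := ge0_ecvg0_le (fun n => L2norm_ge0 mu (fun x => f x - g x)%R) fg (ge0_ecvg0D vf vg).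
  by move=> /(cvg_unique _ (cvg_cst _)) ->.
have [mf _] := f2; have [mg _] := g2.
by apply/(N2B_eq0 mu mf mg); rewrite -L2norm_N2 fg0 mule0.
Qed.

End L2_norm_continuity.

(** * Inversion and Plancherel for an arbitrary Fourier kernel *)

Section plancherel.
Context d (T : measurableType d) (R : realType).
Variable mu : {sigma_finite_measure set T -> \bar R}.
Variables (dot : T -> T -> R) (c : R) (w : nat -> T -> R) (k : nat -> T -> T -> R).
Hypothesis fk : fourier_kernel mu dot c w k.
Implicit Types (f g h F G : T -> R[i]).

Let C t := real_complex R t.
Let c0 : 0 < c. Proof. exact: (fk_c fk). Qed.
Local Notation inv_fourier := (inv_fourier mu dot c).
Local Notation regularized := (regularized mu dot c w).
Local Notation smooth := (smooth mu k).
Local Notation fourier := (fourier mu dot).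

Let mk1 n x : measurable_fun setT (k n x).
Proof. exact: (measurableT_comp (fk_mk fk n) (measurable_pair1 x)). Qed.

Let mk2 n x : measurable_fun setT (k n ^~ x).
Proof. exact: (measurableT_comp (fk_mk fk n) (measurable_pair2 x)). Qed.

Let me2 s : cmeasurable (fun x => expi (- dot x s)).
Proof.
apply: cmeasurable_expi; apply: measurableT_comp => //.
exact: (measurableT_comp (fk_mdot fk) (measurable_pair2 s)).
Qed.

(** [k n ^~ xi] is a probability density, so the left side is the square of a mean of [u x - u xi],
    to which Jensen's inequality applies. *)
Lemma smoothB_le n (u : T -> R) xi : mu.-integrable setT (EFin \o u) ->
  ((((\int[mu]_x (u x * k n x xi)) - u xi) ^+ 2)%:E <=
   \int[mu]_x (k n xi x * (u xi - u x) ^+ 2)%:E)%E.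
Proof.
move=> iu.
have mu' : measurable_fun setT u by exact/measurable_EFinP/(measurable_int mu).
have ik : mu.-integrable setT (EFin \o (fun x => k n x xi)).
  apply: integrable_ge0_fin => // [x|]; first exact: (fk_k0 fk).
  by under eq_integral do rewrite (fk_kC fk); rewrite (fk_kint fk) ltry.
have iuk : mu.-integrable setT (EFin \o (fun x => u x * k n x xi)).
  have [M hM] := fk_kbd fk n.
  apply: (@le_integrable _ _ _ mu setT measurableT _ (fun x => M%:E * (EFin \o u) x)%E).
  - by apply/measurable_EFinP; exact: measurable_funM.
  - move=> x _ /=; rewrite lee_fin !normrM mulrC ler_wpM2r//.
    rewrite ger0_norm; last exact: (fk_k0 fk).
    by rewrite (le_trans (hM _ _))// ler_norm.
  - exact: integrableZl.
have iuk' : mu.-integrable setT (EFin \o (fun x => u xi * k n x xi)).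
  by have := integrableZl measurableT (u xi) ik; exact: eq_integrable.
have -> : \int[mu]_x (u x * k n x xi) - u xi = \int[mu]_x ((u x - u xi) * k n x xi).
  under [RHS]eq_Rintegral do rewrite mulrBl.
  rewrite RintegralB//; congr (_ - _); rewrite RintegralZl//.
  rewrite /Rintegral; under eq_integral do rewrite (fk_kC fk).
  by rewrite (fk_kint fk) mulr1.
apply: le_trans (sqr_mean_le _ _ _ _ _) _ => //.
- exact: measurable_funB.
- by move=> x; exact: (fk_k0 fk).
- by under eq_integral do rewrite (fk_kC fk); exact: (fk_kint fk).
- under eq_fun do rewrite mulrBl EFinB; exact: integrableB.
- rewrite le_eqVlt; apply/orP; left; apply/eqP; apply: eq_integral => x _.
  by rewrite (fk_kC fk); congr (_ * _)%:E; ring.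
Qed.

Lemma N2_smoothB n h : cintegrable mu h ->
  (N2 mu (fun xi => smooth n h xi - h xi)%R <=
   oscillation mu (k n) (fun x => complex.Re (h x)) +
   oscillation mu (k n) (fun x => complex.Im (h x)))%E.
Proof.
move=> ih; have [iRe iIm] := ih.
have mh := cintegrable_measurable ih.
have mosc (u : T -> R) : measurable_fun setT u ->
    measurable_fun setT (fun x => \int[mu]_y (k n x y * (u x - u y) ^+ 2)%:E)%E.
  move=> mu'.
  apply: (@measurable_fun_fubini_tonelli_F _ _ _ _ _ mu
    (fun z => (k n z.1 z.2 * (u z.1 - u z.2) ^+ 2)%:E)) => [|z].
    apply/measurable_EFinP/measurable_funM; first exact: (fk_mk fk).
    apply: measurable_funX; apply: measurable_funB.
      exact: (measurableT_comp mu' measurable_fst).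
    exact: (measurableT_comp mu' measurable_snd).
  by rewrite lee_fin mulr_ge0// ?sqr_ge0//; exact: (fk_k0 fk).
have osc0 (u : T -> R) x : (0 <= \int[mu]_y (k n x y * (u x - u y) ^+ 2)%:E)%E.
  by apply: integral_ge0 => y _; rewrite lee_fin mulr_ge0// ?sqr_ge0//; exact: (fk_k0 fk).
have [m1 m2] := mh.
rewrite /oscillation -ge0_integralD//; try exact: mosc; try by move=> x _; exact: osc0.
apply: ge0_le_integral => //.
- by move=> x _; rewrite lee_fin sqn_ge0.
- by apply: emeasurable_sqn; apply: cmeasurableB => //; exact: (cmeasurable_smooth fk).
- by apply: emeasurable_funD; exact: mosc.
- move=> xi _; rewrite /sqn EFinD; apply: leeD.
  + rewrite !ReImE.
    have -> : complex.Re (smooth n h xi) = \int[mu]_x (complex.Re (h x) * k n x xi).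
      by apply: eq_Rintegral => x _; rewrite ReM /= mulr0 subr0.
    exact: smoothB_le.
  + rewrite !ReImE.
    have -> : complex.Im (smooth n h xi) = \int[mu]_x (complex.Im (h x) * k n x xi).
      by apply: eq_Rintegral => x _; rewrite ImM /= mulr0 add0r.
    exact: smoothB_le.
Qed.

Lemma L2_Re h : L2 mu h -> (\int[mu]_x (complex.Re (h x) ^+ 2)%:E < +oo)%E.
Proof.
move=> /L2P[mh]; apply: le_lt_trans; have [m1 m2] := mh.
apply: ge0_le_integral => //.
- by move=> x _; rewrite lee_fin sqr_ge0.
- by apply/measurable_EFinP/measurable_funX.
- exact: emeasurable_sqn.
- by move=> x _; rewrite lee_fin lerDl sqr_ge0.
Qed.

Lemma L2_Im h : L2 mu h -> (\int[mu]_x (complex.Im (h x) ^+ 2)%:E < +oo)%E.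
Proof.
move=> /L2P[mh]; apply: le_lt_trans; have [m1 m2] := mh.
apply: ge0_le_integral => //.
- by move=> x _; rewrite lee_fin sqr_ge0.
- by apply/measurable_EFinP/measurable_funX.
- exact: emeasurable_sqn.
- by move=> x _; rewrite lee_fin lerDr sqr_ge0.
Qed.

Lemma cvg_smooth h : cintegrable mu h -> L2 mu h ->
  (fun n => L2norm mu (smooth n h \- h)%R) @ \oo --> 0%E.
Proof.
move=> ih h2; apply/cvg_L2norm_N2.
have [mh _] := h2; have [m1 m2] := mh.
apply: (@ge0_ecvg0_le _ _ (fun n => oscillation mu (k n) (fun x => complex.Re (h x)) +
   oscillation mu (k n) (fun x => complex.Im (h x)))%E) => [n|n|].
- exact: N2_ge0.
- exact: N2_smoothB.
- apply: ge0_ecvg0D; apply: (fk_approx fk) => //; [exact: L2_Re|exact: L2_Im].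
Qed.

Lemma fourier_bounded f : cintegrable mu f ->
  exists M : R, forall xi, Normc.normc (fourier f xi) <= M.
Proof.
move=> hf; have [M hM] := inv_fourier_bounded fk (cintegrableJ hf).
exists (c * M) => xi; rewrite (fourier_conj fk)// Normc.normcM normcJ normcR.
by rewrite gtr0_norm// ler_pM2l.
Qed.

(** Plancherel before the limit. In [regularized n h * conjc (inv_fourier h)] the second factor is
    unfolded and the integrals are exchanged; the Fourier transform then falls on the first factor
    and turns it into [smooth n h]. *)
Lemma weighted_inv_fourier n h : cintegrable mu h ->
  (\int[mu]_s (w n s * sqn (inv_fourier h s))%:E)%E =
  (c^-1 * complex.Re (cintegral mu (fun xi => conjc (h xi) * smooth n h xi)))%:E.
Proof.
move=> ih; have ir := cintegrable_regularized fk n ih.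
have mh := cintegrable_measurable ih.
have minv := cmeasurable_inv_fourier fk mh.
have [M hM] := inv_fourier_bounded fk ih.
have iri : cintegrable mu (fun s => regularized n h s * conjc (inv_fourier h s)).
  apply: (@cintegrable_bounded _ _ _ _ M) => //; first exact: cmeasurableJ.
  by move=> s; rewrite normcJ.
have reE s : complex.Re (regularized n h s * conjc (inv_fourier h s)) =
    w n s * sqn (inv_fourier h s).
  by rewrite /regularized /sqn !ReImE /=; ring.
have -> : (\int[mu]_s (w n s * sqn (inv_fourier h s))%:E)%E =
  (complex.Re (cintegral mu (fun s => regularized n h s * conjc (inv_fourier h s))))%:E.
  rewrite Re_cintegral /Rintegral fineK; first by apply: eq_integral => s _; rewrite reE.
  by have [i1 _] := iri; exact: (integrable_fin_num measurableT i1).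
(* The scalar [c^-1] is read as a complex number with imaginary part 0, so that the claim becomes an
   identity between complex integrals. *)
congr EFin; rewrite -[RHS]/(c^-1 * _) -[RHS]subr0 -[X in _ - X](mul0r
  (complex.Im (cintegral mu (fun xi => conjc (h xi) * smooth n h xi)))).
rewrite -[c^-1]/(complex.Re (C c^-1)) -[0]/(complex.Im (C c^-1)) -ReM; congr complex.Re.
have ia : cintegrable mu (fun s => C c^-1 * regularized n h s) by exact: cintegrableZ.
have iJ := cintegrableJ ih.
transitivity (cintegral mu (fun s => (C c^-1 * regularized n h s) *
    cintegral mu (fun xi => conjc (h xi) * expi (- dot s xi)))).
  congr cintegral; apply/funext => s; rewrite /inv_fourier conjcZ -cintegralJ.
    rewrite mulrCA mulrA; congr (_ * cintegral mu _); apply/funext => xi.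
    by rewrite conjcM expiJ.
  apply: (@cintegrable_bounded _ _ _ _ 1) => //; last by move=> x; rewrite normc_expi.
  by apply: cmeasurable_expi; exact: (measurableT_comp (fk_mdot fk) (measurable_pair1 s)).
rewrite (cintegral_kernel_swap ia iJ (e := fun z => expi (- dot z.1 z.2))); last 2 first.
- by apply: cmeasurable_expi; apply: measurableT_comp (fk_mdot fk).
- by move=> z; rewrite normc_expi.
have [M' hM'] := fourier_bounded ir.
rewrite -cintegralZ; last first.
  rewrite -(fourier_regularized fk)//.
  apply: (@cintegrable_bounded _ _ _ _ M') => //.
  by apply: (cmeasurable_fourier fk); exact: (cintegrable_measurable ir).
congr cintegral; apply/funext => xi; rewrite mulrCA; congr (_ * _).
rewrite -(fourier_regularized fk)// /fourier -cintegralZ.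
  by congr cintegral; apply/funext => s; rewrite mulrA.
apply: (@cintegrable_bounded _ _ _ _ 1) => //.
by move=> x; rewrite normc_expi.
Qed.

(** Continuity of the inner product: by Cauchy-Schwarz the error is at most the norm of [h] times
    that of [smooth n h - h]. *)
Lemma cvg_inner_smooth h : cintegrable mu h -> L2 mu h ->
  complex.Re (cintegral mu (fun xi => conjc (h xi) * smooth n h xi))
    @[n --> \oo] --> fine (N2 mu h).
Proof.
move=> ih h2; have [mh _] := h2.
have msm n := cmeasurable_smooth fk n mh.
have hJ2 := L2J h2; have [mJ _] := hJ2.
pose K := fine (L2norm mu (fun x => conjc (h x))).
have bnd n : (`|complex.Re (cintegral mu (fun xi => conjc (h xi) * smooth n h xi))
      - fine (N2 mu h)|%:E <= K%:E * L2norm mu (smooth n h \- h)%R)%E.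
  have ihs : cintegrable mu (fun xi => conjc (h xi) * smooth n h xi).
    have [M hM] := fourier_bounded (cintegrable_regularized fk n ih).
    apply: (@cintegrable_bounded _ _ _ _ M) => //; first exact: cintegrableJ.
    by move=> x; rewrite -(fourier_regularized fk).
  have ihh := cintegrable_L2M hJ2 h2.
  have ihd : cintegrable mu (fun xi => conjc (h xi) * (smooth n h xi - h xi)).
    have -> : (fun xi => conjc (h xi) * (smooth n h xi - h xi)) =
              (fun xi => conjc (h xi) * smooth n h xi - conjc (h xi) * h xi).
      by apply/funext => xi; rewrite mulrBr.
    exact: cintegrableB.
  have -> : fine (N2 mu h) = complex.Re (cintegral mu (fun xi => conjc (h xi) * h xi)).
    rewrite Re_cintegral /Rintegral; congr fine; apply: eq_integral => x _.
    by rewrite !ReImE /sqn; congr (_%:E); ring.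
  rewrite -ReN -ReD -cintegralB//.
  under [X in cintegral mu X]eq_fun do rewrite -mulrBr.
  apply: (@le_trans _ _ (N1 mu (fun xi => conjc (h xi) * (smooth n h xi - h xi)))).
    by apply: le_trans (cintegral_N1 ihd); rewrite lee_fin normc_Re.
  rewrite /K fineK; last exact: L2_fine.
  by apply: N1M_le => //; exact: cmeasurableB.
have := ge0_ecvg0_le _ bnd (ge0_ecvg0Z K (cvg_smooth ih h2)).
move=> /(_ (fun n => normr_ge0 _))/ge0_ecvg0P => /(_ (fun n => normr_ge0 _)) cv.
by apply/cvgrPdist_lt => e e0; move: (cv e e0); apply: filterS => n; rewrite lte_fin distrC.
Qed.

(** One sequence with two limits. As the weights increase to 1, monotone convergence gives the left
    side, whose finiteness is not known beforehand; [weighted_inv_fourier] and [cvg_inner_smooth]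
    give the right side. *)
Lemma N2_inv_fourier h : cintegrable mu h -> L2 mu h ->
  N2 mu (inv_fourier h) = ((c^-1)%:E * N2 mu h)%E.
Proof.
move=> ih h2; have [mh _] := h2.
have minv := cmeasurable_inv_fourier fk mh.
have msq := measurable_sqn minv.
have cv1 : (\int[mu]_s (w n s * sqn (inv_fourier h s))%:E)%E @[n --> \oo] -->
    N2 mu (inv_fourier h).
  have -> : N2 mu (inv_fourier h) =
      (\int[mu]_s limn (fun n => (w n s * sqn (inv_fourier h s))%:E))%E.
    apply: eq_integral => s _; apply/esym/cvg_lim => //.
    apply: cvg_EFin; first exact: nearW.
    rewrite -[X in _ --> X]mul1r; apply: cvgMl; exact: (fk_wcvg fk).
  apply: cvg_monotone_convergence => //.
  - by move=> n; apply/measurable_EFinP/measurable_funM => //; exact: (fk_mw fk).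
  - by move=> n s _; rewrite lee_fin mulr_ge0 ?sqn_ge0//; exact: (fk_w0 fk).
  - move=> s _ m n mn; rewrite lee_fin ler_wpM2r ?sqn_ge0//.
    exact: (fk_wnd fk).
have cv2 : (\int[mu]_s (w n s * sqn (inv_fourier h s))%:E)%E @[n --> \oo] -->
    ((c^-1)%:E * N2 mu h)%E.
  under eq_cvg do rewrite weighted_inv_fourier//.
  have /fineK <- : N2 mu h \is a fin_num.
    by move/L2P : h2 => [_ ?]; rewrite ge0_fin_numE// N2_ge0.
  rewrite -EFinM; apply: cvg_EFin; first exact: nearW.
  by apply: cvgMr; exact: cvg_inner_smooth.
exact: (cvg_unique _ cv1 cv2).
Qed.

Lemma L2_inv_fourier h : cintegrable mu h -> L2 mu h -> L2 mu (inv_fourier h).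
Proof.
move=> ih h2; have /L2P[mh hlty] := h2; apply/L2P.
split; first exact: (cmeasurable_inv_fourier fk mh).
by rewrite N2_inv_fourier// lte_mul_pinfty// lee_fin invr_ge0 ltW.
Qed.

Lemma N2_fourier f : cintegrable mu f -> L2 mu f ->
  N2 mu (fourier f) = (c%:E * N2 mu f)%E.
Proof.
move=> hf f2; have [mf _] := f2; have iJ := cintegrableJ hf; have f2J := L2J f2.
rewrite (fourier_conj fk)// N2Z.
  rewrite N2J N2_inv_fourier// N2J muleA sqnR -EFinM.
  by rewrite expr2 -mulrA divff ?mulr1 ?gt_eqF.
by apply/cmeasurableJ/(cmeasurable_inv_fourier fk); exact: cmeasurableJ.
Qed.

Lemma L2_fourier f : cintegrable mu f -> L2 mu f -> L2 mu (fourier f).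
Proof.
move=> hf f2; have /L2P[mf flty] := f2; apply/L2P.
split; first exact: (cmeasurable_fourier fk mf).
by rewrite N2_fourier// lte_mul_pinfty// lee_fin ltW.
Qed.

Lemma L2norm_fourier f : cintegrable mu f -> L2 mu f ->
  L2norm mu (fourier f) = ((Num.sqrt c)%:E * L2norm mu f)%E.
Proof.
move=> hf f2; rewrite !L2normE N2_fourier//.
rewrite poweRM; [|by rewrite lee_fin ltW|exact: N2_ge0].
by rewrite poweR_EFin powR12_sqrt// ltW.
Qed.

Lemma L2_regularized n h : cintegrable mu h -> L2 mu h -> L2 mu (regularized n h).
Proof.
move=> ih h2; apply: (L2_le _ (L2_inv_fourier ih h2)).
  exact: (cintegrable_measurable (cintegrable_regularized fk n ih)).
move=> x; rewrite sqnM sqnR -[leRHS]mul1r ler_wpM2r ?sqn_ge0//.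
by rewrite expr_le1 ?(fk_w0 fk) ?(fk_w1 fk).
Qed.

Lemma cvg_regularized h : cintegrable mu h -> L2 mu h ->
  (fun n => L2norm mu (regularized n h \- inv_fourier h)%R) @ \oo --> 0%E.
Proof.
move=> ih h2; apply/cvg_L2norm_N2.
have hi2 := L2_inv_fourier ih h2; have [mi _] := hi2.
have nE n s : sqn (regularized n h s - inv_fourier h s) =
    (w n s - 1) ^+ 2 * sqn (inv_fourier h s).
  by rewrite /regularized -[X in _ - X]mul1r -mulrBl sqnM -sqnR; congr (sqn _ * _);
     rewrite rmorphB.
rewrite -[X in _ --> X](@integral0 _ _ _ mu setT).
have [|||||_ _] := @dominated_convergence _ _ _ mu setT measurableT
  (fun n s => (sqn (regularized n h s - inv_fourier h s))%:E) (cst 0%E)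
  (fun s => (sqn (inv_fourier h s))%:E); last by [].
- move=> n; apply: emeasurable_sqn; apply: cmeasurableB => //.
  exact: (cintegrable_measurable (cintegrable_regularized fk n ih)).
- exact: measurable_cst.
- apply/aeW => s _; under eq_cvg do rewrite nE.
  apply: cvg_EFin; first exact: nearW.
  have h1 : w n s - 1 @[n --> \oo] --> (0 : R).
    by rewrite -(subrr (1 : R)); apply: cvgB; [exact: (fk_wcvg fk)|exact: cvg_cst].
  have := cvgM (cvgM h1 h1) (cvg_cst (sqn (inv_fourier h s))).
  by rewrite mulr0 mul0r => h3; exact: h3.
- exact: (L2_integrable_sqn hi2).
- apply/aeW => s n _; rewrite gee0_abs ?lee_fin ?sqn_ge0// nE.
  rewrite -[leRHS]mul1r ler_wpM2r ?sqn_ge0//.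
  have := fk_w0 fk n s; have := fk_w1 fk n s; nra.
Qed.

(** Fourier inversion. The regularised inverse transforms are the sequence that [is_fourier] asks
    for: they tend to [inv_fourier h], while their transforms [smooth n h] tend to [h]. *)
Lemma is_fourier_inv_fourier h : cintegrable mu h -> L2 mu h ->
  is_fourier mu dot (inv_fourier h) h.
Proof.
move=> ih h2; split => //; first exact: L2_inv_fourier.
exists (regularized ^~ h); split.
- by move=> n; split; [exact: (cintegrable_regularized fk)|exact: L2_regularized].
- exact: cvg_regularized.
- by under eq_fun do rewrite (fourier_regularized fk)//; exact: cvg_smooth.
Qed.

(** Plancherel along the approximating sequence, followed by continuity of the norm on both
    sides. *)
Lemma is_fourier_L2norm f F : is_fourier mu dot f F ->
  L2norm mu F = ((Num.sqrt c)%:E * L2norm mu f)%E.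
Proof.
move=> [f2 F2 [u [hu uf uF]]].
have v2 n : L2 mu (fourier (u n)) by have [? ?] := hu n; exact: L2_fourier.
have u2 n : L2 mu (u n) by have [] := hu n.
have cv1 := cvg_L2norm v2 F2 uF.
have cv2 : (fun n => L2norm mu (fourier (u n))) @ \oo --> ((Num.sqrt c)%:E * L2norm mu f)%E.
  have -> : (fun n => L2norm mu (fourier (u n))) =
      (fun n => (Num.sqrt c)%:E * L2norm mu (u n))%E.
    by apply/funext => n; have [? ?] := hu n; exact: L2norm_fourier.
  by apply: cvgeZl => //; exact: cvg_L2norm.
exact: (cvg_unique _ cv1 cv2).
Qed.

Lemma is_fourier_N2 f F : is_fourier mu dot f F -> N2 mu F = (c%:E * N2 mu f)%E.
Proof.
move=> /is_fourier_L2norm fF; rewrite -!L2norm_N2 fF muleACA -EFinM.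
by rewrite -expr2 sqr_sqrtr// ltW.
Qed.

Lemma is_fourierD (a : R[i]) f F g G : is_fourier mu dot f F ->
  is_fourier mu dot g G ->
  is_fourier mu dot (fun x => a * f x + g x) (fun x => a * F x + G x).
Proof.
move=> [f2 F2 [u [hu uf uF]]] [g2 G2 [v [hv vg vG]]].
split; [by apply: L2D => //; exact: L2Z|by apply: L2D => //; exact: L2Z|].
have cv (p q : nat -> T -> R[i]) P Q : (forall n, L2 mu (p n)) -> (forall n, L2 mu (q n)) ->
   L2 mu P -> L2 mu Q ->
   (fun n => L2norm mu (p n \- P)%R) @ \oo --> 0%E ->
   (fun n => L2norm mu (q n \- Q)%R) @ \oo --> 0%E ->
   (fun n => L2norm mu ((fun x => a * p n x + q n x) \- (fun x => a * P x + Q x))%R) @ \oo --> 0%E.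
  move=> p2 q2 P2 Q2 /cvg_L2norm_N2 pP /cvg_L2norm_N2 qQ; apply/cvg_L2norm_N2.
  have pq := ge0_ecvg0D (ge0_ecvg0Z (2 * sqn a) pP) (ge0_ecvg0Z 2 qQ).
  apply: (ge0_ecvg0_le _ _ pq) => n; first exact: N2_ge0.
  have [mp _] := L2B (p2 n) P2; have [mq _] := L2B (q2 n) Q2.
  have -> : N2 mu ((fun x => a * p n x + q n x) \- (fun x => a * P x + Q x))%R =
      N2 mu (fun x => a * (p n x - P x) + (q n x - Q x))%R.
    by congr N2; apply/funext => x /=; ring.
  apply: le_trans (N2D_le _ _ _) _ => //.
    by apply: cmeasurableM => //; exact: cmeasurable_cst.
  by rewrite N2Z// muleA -EFinM.
exists (fun n x => a * u n x + v n x); split.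
- move=> n; have [iu u2] := hu n; have [iv v2] := hv n; split.
    by apply: cintegrableD => //; exact: cintegrableZ.
  by apply: L2D => //; exact: L2Z.
- by apply: cv => // n; [have [] := hu n|have [] := hv n].
- under eq_fun => n.
    have [iu u2] := hu n; have [iv v2] := hv n.
    rewrite (fourierD fk)//; over.
  apply: cv => // n; [have [? ?] := hu n|have [? ?] := hv n]; exact: L2_fourier.
Qed.

Lemma is_fourier_ae f F g G : is_fourier mu dot f F -> L2 mu g -> L2 mu G ->
  f = g %[ae mu] -> F = G %[ae mu] -> is_fourier mu dot g G.
Proof.
move=> [f2 F2 [u [hu uf uF]]] g2 G2 fg FG; split => //; exists u.
have [[mf _] [mF _]] := (f2, F2); have [[mg _] [mG _]] := (g2, G2).
split => //.
- rewrite (_ : (fun n => L2norm mu (u n \- g)%R) = (fun n => L2norm mu (u n \- f)%R))//.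
  apply/funext => n; have [_ [mu' _]] := hu n.
  apply: L2norm_ae_eq; try exact: cmeasurableB.
  by move: fg; apply: filterS => x /(_ I) /= ->.
- rewrite (_ : (fun n => L2norm mu (fourier (u n) \- G)%R) =
    (fun n => L2norm mu (fourier (u n) \- F)%R))//.
  apply/funext => n; have [_ [mu' _]] := hu n.
  have mfu := cmeasurable_fourier fk mu'.
  apply: L2norm_ae_eq; try exact: cmeasurableB.
  by move: FG; apply: filterS => x /(_ I) /= ->.
Qed.

Lemma is_fourierB f F g G : is_fourier mu dot f F -> is_fourier mu dot g G ->
  is_fourier mu dot (fun x => f x - g x) (fun x => F x - G x).
Proof.
move=> fF gG; have := is_fourierD (-1) gG fF.
by congr is_fourier; apply/funext => x; rewrite mulN1r addrC.
Qed.

Lemma is_fourier_uniq f F g G : is_fourier mu dot f F -> is_fourier mu dot g G ->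
  f = g %[ae mu] -> F = G %[ae mu].
Proof.
move=> fF gG; have [[mf _] [mF _] _] := fF; have [[mg _] [mG _] _] := gG.
move=> /(N2B_eq0 mu mf mg) fg0; apply/(N2B_eq0 mu mF mG).
by rewrite (is_fourier_N2 (is_fourierB fF gG)) fg0 mule0.
Qed.

End plancherel.

(** * Density of simple functions in L^2 *)

Section square_integrable.
Context d (T : measurableType d) (R : realType).
Variable mu : {measure set T -> \bar R}.
Implicit Types u v : T -> R.

Definition sqint u : \bar R := (\int[mu]_x (u x ^+ 2)%:E)%E.

Lemma sqint_ge0 u : (0 <= sqint u)%E.
Proof. by apply: integral_ge0 => x _; rewrite lee_fin sqr_ge0. Qed.

Lemma cvg_sqintB (v : nat -> T -> R) u g :
  (forall n, measurable_fun setT (v n)) -> measurable_fun setT u ->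
  (forall x, v n x @[n --> \oo] --> u x) ->
  (forall n x, (v n x - u x) ^+ 2 <= g x) ->
  mu.-integrable setT (EFin \o g) ->
  (fun n => sqint (fun x => v n x - u x)) @ \oo --> 0%E.
Proof.
move=> mv mu' vu vg ig; rewrite -[X in _ --> X](@integral0 _ _ _ mu setT).
have [|||||_ _] := @dominated_convergence _ _ _ mu setT measurableT
  (fun n x => ((v n x - u x) ^+ 2)%:E) (cst 0%E) (EFin \o g); last by [].
- by move=> n; apply/measurable_EFinP/measurable_funX/measurable_funB.
- exact: measurable_cst.
- apply/aeW => x _; apply: cvg_EFin; first exact: nearW.
  have h1 : v n x - u x @[n --> \oo] --> (0 : R).
    by rewrite -(subrr (u x)); apply: cvgB; [exact: vu|exact: cvg_cst].
  by have := cvgM h1 h1; rewrite mulr0 => h; exact: h.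
- exact: ig.
- by apply/aeW => x n _; rewrite gee0_abs ?lee_fin ?sqr_ge0.
Qed.

Lemma le_sqint u v : measurable_fun setT u -> measurable_fun setT v ->
  (forall x, u x ^+ 2 <= v x ^+ 2) -> (sqint u <= sqint v)%E.
Proof.
move=> mu' mv uv; apply: ge0_le_integral => //.
- by move=> x _; rewrite lee_fin sqr_ge0.
- by apply/measurable_EFinP/measurable_funX.
- by apply/measurable_EFinP/measurable_funX.
- by move=> x _; rewrite lee_fin.
Qed.

End square_integrable.

Section indicators.
Context d (T : measurableType d) (R : realType).
Variable mu : {measure set T -> \bar R}.
Implicit Types A : set T.

Lemma sqint_indic A : measurable A -> sqint mu (\1_A : T -> R) = mu A.
Proof.
move=> mA; rewrite /sqint (_ : mu A = \int[mu]_x (\1_A x)%:E)%E; last first.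
  by rewrite integral_indic// setIT.
by apply: eq_integral => x _; rewrite indicE; case: (x \in A); rewrite ?expr1n ?expr0n.
Qed.

Lemma N2R (u : T -> R) : N2 mu (fun x => real_complex R (u x)) = sqint mu u.
Proof. by apply: eq_integral => x _; rewrite sqnR. Qed.

Lemma L2_indic A : measurable A -> (mu A < +oo)%E ->
  L2 mu (fun x => real_complex R (\1_A x)).
Proof.
move=> mA Aoo; apply/L2P; rewrite N2R sqint_indic//; split => //.
by apply: cmeasurableR; exact: measurable_indic.
Qed.

End indicators.

Section square_integrable_density.
Context d (T : measurableType d) (R : realType).
Variable mu : {measure set T -> \bar R}.
Variables (G : set (set T)) (B : nat -> set T) (V : (T -> R) -> Prop).
Hypotheses (mG : measurable = <<s G >>) (GI : setI_closed G).
Hypotheses (mB : forall n, measurable (B n)) (ndB : nondecreasing_seq B).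
Hypotheses (B_cover : \bigcup_n B n = setT) (B_fin : forall n, (mu (B n) < +oo)%E).
Hypotheses (VD : forall u v, V u -> V v -> V (fun x => u x + v x)).
Hypotheses (VZ : forall a u, V u -> V (fun x => a * u x)).
Hypotheses (V_closed : forall (v : nat -> T -> R) u, (forall n, V (v n)) ->
  measurable_fun setT u -> (sqint mu u < +oo)%E ->
  (fun n => sqint mu (fun x => v n x - u x)) @ \oo --> 0%E -> V u).
Hypotheses (V_G : forall n A, G A -> V \1_(A `&` B n)) (V_B : forall n, V \1_(B n)).

(** Dynkin's argument inside [B n]. The finite measure of [B n] lets dominated convergence turn
    increasing unions into limits in L^2, under which [V] is closed. *)
Let V_indic n A : measurable A -> V \1_(A `&` B n).
Proof.
rewrite mG; pose H := [set A | measurable A /\ V \1_(A `&` B n)].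
move=> sA; suff : H A by case.
move: A sA; apply: (@lambda_system_subset _ G GI setT H) => //.
- split => //.
  + by split => //; rewrite setTI.
  + move=> X Y YX [mX VX] [mY VY]; split; first exact: measurableD.
    have -> : (\1_((X `\` Y) `&` B n) : T -> R) =
        (fun x => \1_(X `&` B n) x + (-1) * \1_(Y `&` B n) x).
      apply/funext => x; rewrite !indicI/= !indicE in_setC.
      have YX' : x \in Y -> x \in X by rewrite !inE; exact: YX.
      by have [Yx|Yx] := boolP (x \in Y); rewrite ?(YX' Yx) /=; ring.
    by apply: VD => //; exact: VZ.
  + move=> F ndF HF; have mF i : measurable (F i) by have [] := HF i.
    split; first exact: bigcupT_measurable.
    have mFB i : measurable (F i `&` B n) by exact: measurableI.
    have mUB : measurable (\bigcup_i F i `&` B n).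
      by apply: measurableI => //; exact: bigcupT_measurable.
    apply: (V_closed (v := fun i => \1_(F i `&` B n))).
    * by move=> i; have [] := HF i.
    * exact: measurable_indic.
    * rewrite sqint_indic//; apply: le_lt_trans (B_fin n).
      by apply: le_measure; rewrite ?inE//.
    * apply: (@cvg_sqintB _ _ _ _ _ _ (\1_(B n))).
      - by move=> i; exact: measurable_indic.
      - exact: measurable_indic.
      - move=> x; have [[i _ Fx]|nFx] := pselect ((\bigcup_i F i) x).
          apply: cvg_near_cst; exists i => // j /= ij.
          rewrite !indicI/= !indicE (mem_set (_ : (\bigcup_i F i) x)); last by exists i.
          by rewrite mem_set//; move/subsetPset : (ndF _ _ ij); apply.
        apply: cvg_near_cst; apply: nearW => j.
        have /negbTE Fj : x \notin F j by rewrite notin_setE => Fx; apply: nFx; exists j.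
        have /negbTE Fo : x \notin \bigcup_i F i by rewrite notin_setE.
        by rewrite !indicI/= !indicE Fj Fo !mul0r.
      - move=> i x; rewrite !indicI/= !indicE.
        by case: (x \in F i); case: (x \in B n); case: (x \in \bigcup_i F i);
          rewrite /=; lra.
      - by apply: integrable_ge0_fin => //; rewrite integral_indic// setIT.
- by move=> X GX; split; [rewrite mG; exact: sub_sigma_algebra|exact: V_G].
Qed.

Let V0 : V (fun=> 0).
Proof.
have -> : (fun=> 0) = (fun x => 0 * (\1_(B 0%N) : T -> R) x).
  by apply/funext => x; rewrite mul0r.
exact: VZ.
Qed.

Let V_sum (I : Type) (s : seq I) (v : I -> T -> R) :
  (forall i, V (v i)) -> V (fun x => \sum_(i <- s) v i x).
Proof.
move=> Vv; elim: s => [|i s IH].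
  by have -> : (fun x => \sum_(i <- [::]) v i x) = (fun=> 0) by
    apply/funext => x; rewrite big_nil.
have -> : (fun x => \sum_(j <- i :: s) v j x) =
    (fun x => v i x + \sum_(j <- s) v j x).
  by apply/funext => x; rewrite big_cons.
exact: VD.
Qed.

Import HBNNSimple.

Let V_nnsfun n (f : {nnsfun T >-> R}) : V (fun x => f x * \1_(B n) x).
Proof.
have -> : (fun x => f x * \1_(B n) x) = (fun x =>
    \sum_(y <- finmap.enum_fset (fset_set (range f))) (y * \1_(f @^-1` [set y] `&` B n) x)).
  apply/funext => x; rewrite fimfunE fsbig_finite//= mulr_suml.
  by apply: eq_bigr => y _; rewrite indicI mulrA.
apply: V_sum => y; apply: VZ; apply: V_indic.
have mf : measurable_fun setT f by [].
by rewrite -[X in measurable X]setTI; exact: mf.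
Qed.

(** Simple functions increasing to [u] are cut off by [B n], so that only truncated indicators
    occur; [u ^+ 2] dominates the squared errors. *)
Let V_ge0 (u : T -> R) : measurable_fun setT u -> (forall x, 0 <= u x) ->
  (sqint mu u < +oo)%E -> V u.
Proof.
move=> mu' u0 ui; have meu : measurable_fun setT (EFin \o u) by exact/measurable_EFinP.
pose f := nnsfun_approx measurableT meu.
have u0' x : setT x -> (0 <= (EFin \o u) x)%E by move=> _; rewrite lee_fin.
have fu n x : f n x <= u x by have := @le_approx _ _ _ _ _ n x u0' I; rewrite /f nnsfun_approxE lee_fin.
apply: (V_closed (v := fun n x => f n x * \1_(B n) x)) => //.
apply: (@cvg_sqintB _ _ _ _ _ _ (fun x => u x ^+ 2)) => //.
- by move=> n; apply: measurable_funM => //; exact: measurable_indic.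
- move=> x.
  have fcv : f n x @[n --> \oo] --> u x.
    have := cvg_nnsfun_approx measurableT meu u0' (I : setT x).
    by move=> /fine_cvg.
  have : (\bigcup_n B n) x by rewrite B_cover.
  move=> [i _ Bx]; rewrite -[X in _ --> X]mulr1; apply: cvgM => //.
  apply: cvg_near_cst; exists i => // j /= ij.
  by rewrite indicE mem_set//; move/subsetPset : (ndB ij); apply.
- move=> n x; have := fu n x; have f0 : 0 <= f n x by [].
  rewrite indicE; case: (x \in B n) => /=; rewrite ?mulr1 ?mulr0; first nra.
  by rewrite sub0r sqrrN.
- apply: integrable_ge0_fin => //; first exact: measurable_funX.
  by move=> x; rewrite sqr_ge0.
Qed.

(** An induction principle for closed subspaces of real L^2. It serves twice: for the functions
    whose oscillation tends to 0, and for those approximable by tensor sums. *)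
Lemma square_integrable_density (u : T -> R) : measurable_fun setT u ->
  (sqint mu u < +oo)%E -> V u.
Proof.
move=> mu' ui.
have -> : u = (fun x => u^\+ x + (-1) * u^\- x).
  by apply/funext => x; rewrite -[in LHS](funrposBneg u) mulN1r.
have mp : measurable_fun setT u^\+ by exact: measurable_funrpos.
have mn : measurable_fun setT u^\- by exact: measurable_funrneg.
have pn x : `|u x| = u^\+ x + u^\- x by rewrite -[RHS]/((u^\+ + u^\-) x) funrposDneg.
have p0 x := funrpos_ge0 u x; have n0 x := funrneg_ge0 u x.
apply: VD; last apply: VZ.
- apply: V_ge0 => //; apply: le_lt_trans ui; apply: le_sqint => // x.
  rewrite -(real_normK (num_real (u x))) pn; have := p0 x; have := n0 x; nra.
- apply: V_ge0 => //; apply: le_lt_trans ui; apply: le_sqint => // x.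
  rewrite -(real_normK (num_real (u x))) pn; have := p0 x; have := n0 x; nra.
Qed.

End square_integrable_density.

Section cutoff.
Context d (T : measurableType d) (R : realType).
Variable mu : {measure set T -> \bar R}.
Implicit Types f t : T -> R[i].

(** It replaces a function vanishing almost everywhere off [A] by a representative vanishing
    everywhere off [A], and it projects approximations onto the band. *)
Definition cut (A : set T) f : T -> R[i] := fun x => real_complex R (\1_A x) * f x.

Lemma cut_in A f x : A x -> cut A f x = f x.
Proof. by move=> Ax; rewrite /cut indicE mem_set// mul1r. Qed.

Lemma cut_out A f x : ~ A x -> cut A f x = 0.
Proof. by move=> Ax; rewrite /cut indicE memNset// mul0r. Qed.

Lemma cmeasurable_cut A f : measurable A -> cmeasurable f -> cmeasurable (cut A f).
Proof.
by move=> mA mf; apply: cmeasurableM => //; apply: cmeasurableR; exact: measurable_indic.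
Qed.

Lemma L2_cut A f : measurable A -> L2 mu f -> L2 mu (cut A f).
Proof.
move=> mA f2; have [mf _] := f2; apply: (L2_le _ f2); first exact: cmeasurable_cut.
move=> x; have [Ax|nAx] := pselect (A x); first by rewrite cut_in.
by rewrite cut_out// sqn0 sqn_ge0.
Qed.

(** The cut is an orthogonal projection that fixes [t], so it does not increase the distance to
    [t]. *)
Lemma N2_cutB A f t : measurable A -> cmeasurable f -> cmeasurable t ->
  (forall x, ~ A x -> t x = 0) ->
  (N2 mu (fun x => t x - cut A f x)%R <= N2 mu (fun x => t x - f x)%R)%E.
Proof.
move=> mA mf mt t0; apply: ge0_le_integral => //.
- by move=> x _; rewrite lee_fin sqn_ge0.
- by apply: emeasurable_sqn; apply: cmeasurableB => //; exact: cmeasurable_cut.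
- by apply: emeasurable_sqn; exact: cmeasurableB.
- move=> x _; rewrite lee_fin; have [Ax|nAx] := pselect (A x); first by rewrite cut_in.
  by rewrite cut_out// t0// subrr sqn0 sqn_ge0.
Qed.

(** [f] is its own product with the indicator of [A], which is square integrable. This makes
    bandpass spectra integrable. *)
Lemma cintegrable_support A f : measurable A -> (mu A < +oo)%E -> L2 mu f ->
  (forall x, ~ A x -> f x = 0) -> cintegrable mu f.
Proof.
move=> mA Aoo f2 f0.
have <- : (fun x => f x * real_complex R (\1_A x)) = f.
  apply/funext => x; rewrite mulrC -/(cut A f x).
  by have [Ax|nAx] := pselect (A x); [rewrite cut_in|rewrite cut_out// f0].
by apply: cintegrable_L2M => //; exact: L2_indic.
Qed.

End cutoff.

(** * Rectangles in products of sigma-finite spaces *)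

Section rectangles.
Context d d' (T : measurableType d) (U : measurableType d') (R : realType).
Variable mu : {sigma_finite_measure set T -> \bar R}.
Variable nu : {sigma_finite_measure set U -> \bar R}.
Implicit Types (A : set T) (B : set U).

Lemma product_measure_fin A B : measurable A -> measurable B ->
  (mu A < +oo)%E -> (nu B < +oo)%E -> ((mu \x nu)%E (A `*` B) < +oo)%E.
Proof.
by move=> mA mB Aoo Boo; rewrite product_measure1E// lte_mul_pinfty// ge0_fin_numE.
Qed.

Lemma setI_closed_rectangle :
  setI_closed [set A `*` B | A in @measurable _ T & B in @measurable _ U].
Proof.
move=> _ _ [A mA [B mB <-]] [A' mA' [B' mB' <-]].
exists (A `&` A'); first exact: measurableI.
by exists (B `&` B'); [exact: measurableI|rewrite setXI].
Qed.

Lemma rectangle_exhaustion : exists (F : nat -> set T) (G : nat -> set U),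
  [/\ forall n, [/\ measurable (F n), measurable (G n), (mu (F n) < +oo)%E &
         (nu (G n) < +oo)%E],
      nondecreasing_seq (fun n => F n `*` G n) & \bigcup_n (F n `*` G n) = setT].
Proof.
have /sigma_finiteP[F [FT ndF Foo]] := sigma_finiteT mu.
have /sigma_finiteP[G [GT ndG Goo]] := sigma_finiteT nu.
exists F, G; split.
- by move=> n; have [? ?] := Foo n; have [? ?] := Goo n.
- move=> m n mn; apply/subsetPset => z [z1 z2].
  by split; [move/subsetPset : (ndF _ _ mn)|move/subsetPset : (ndG _ _ mn)]; apply.
- apply/seteqP; split => // z _.
  have : (\bigcup_i F i) z.1 by rewrite -FT.
  have : (\bigcup_i G i) z.2 by rewrite -GT.
  move=> [i _ Gz] [j _ Fz]; exists (maxn i j) => //; split.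
    by move/subsetPset : (ndF _ _ (leq_maxr i j)); apply.
  by move/subsetPset : (ndG _ _ (leq_maxl i j)); apply.
Qed.

End rectangles.

Definition image_measure d d' (T : measurableType d) (U : measurableType d')
    (R : realType) (mu : {measure set T -> \bar R}) (f : T -> U)
    (mf : measurable_fun setT f) : {measure set U -> \bar R} :=
  measure_function_pushforward__canonical__measure_function_Measure mu mf.

(** * Affine changes of variable on the line *)

Section lebesgue_affine.
Variable R : realType.
Local Notation mu := (@lebesgue_measure R).
Local Open Scope ereal_scope.

Let affine (a b : R) : measurableTypeR R -> measurableTypeR R :=
  fun x => (a * x + b)%R.

Let measurable_affine a b : measurable_fun setT (affine a b).
Proof. by apply: measurable_funD => //; exact: measurable_funM. Qed.

(** Uniqueness of the Lebesgue measure: the rescaled image measure agrees with it on the intervals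
    []x, y]]. *)
Let lebesgue_affine (a b : R) (A : set (measurableTypeR R)) : (0 < a)%R ->
  measurable A -> mu A = a%:E * pushforward mu (affine a b) A.
Proof.
move=> a0 mA.
pose im := image_measure mu (measurable_affine a b).
pose nu : {measure set _ -> \bar R} := mscale (NngNum (ltW a0)) im.
have -> : a%:E * pushforward mu (affine a b) A = nu A by [].
apply: lebesgue_measure_unique => // _ [[x y]] _ <-.
rewrite /nu /= /mscale /= /pushforward.
rewrite (_ : _ @^-1` _ = `](x - b) / a, (y - b) / a]%classic)%R; last first.
  apply/seteqP; split => z /=; rewrite !in_itv/= /affine
    ltr_pdivrMr// ler_pdivlMr// ltrBlDr lerBrDr (mulrC z) //.
rewrite !lebesgue_measure_itv/= !lte_fin ltr_pM2r ?invr_gt0// ltrD2r.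
case: ifP => _; last by rewrite mule0.
rewrite -!EFinB -EFinM; congr _%:E; field; exact: lt0r_neq0.
Qed.

Lemma ge0_integral_affine (a b : R) (f : R -> \bar R) : (0 < a)%R ->
  measurable_fun setT f -> (forall x, 0 <= f x) ->
  \int[mu]_x f x = a%:E * \int[mu]_x f (a * x + b)%R.
Proof.
move=> a0 mf f0.
pose im := image_measure mu (measurable_affine a b).
have -> : \int[mu]_x f (a * x + b)%R = \int[im]_x f x.
  by rewrite ge0_integral_pushforward//; exact: measurable_affine.
pose nu : {measure set _ -> \bar R} := mscale (NngNum (ltW a0)) im.
have -> : a%:E * \int[im]_x f x = \int[nu]_x f x.
  by rewrite ge0_integral_mscale.
by apply: eq_measure_integral => A mA _; exact: lebesgue_affine.
Qed.

Lemma ge0_integral_opp (f : R -> \bar R) :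
  measurable_fun setT f -> (forall x, 0 <= f x) ->
  \int[mu]_x f x = \int[mu]_x f (- x)%R.
Proof.
move=> mf f0.
transitivity (\int[pushforward mu (-%R : _ -> measurableTypeR R)]_x f x).
  by apply: eq_measure_integral => //= A mA _; exact/esym/lebesgue_measureN.
by rewrite ge0_integral_pushforward.
Qed.

Lemma integral_opp (f : R -> \bar R) : measurable_fun setT f ->
  \int[mu]_x f x = \int[mu]_x f (- x)%R.
Proof.
move=> mf; rewrite integralE [RHS]integralE; congr (_ - _).
- rewrite ge0_integral_opp//; last exact: measurable_funepos.
  by apply: eq_integral => x _; rewrite unlock.
- rewrite ge0_integral_opp//; last exact: measurable_funeneg.
  by apply: eq_integral => x _; rewrite unlock.
Qed.

Lemma cintegral_opp (f : R -> R[i]) : cmeasurable (T := measurableTypeR R) f ->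
  cintegral mu f = cintegral mu (fun x => f (- x)%R).
Proof.
move=> [m1 m2]; rewrite /cintegral /Rintegral; congr (fine _ +i* fine _)%C.
- exact: (integral_opp (measurableT_comp (@EFin_measurable R setT) m1)).
- exact: (integral_opp (measurableT_comp (@EFin_measurable R setT) m2)).
Qed.

End lebesgue_affine.

(** * The Poisson kernel *)

Section oscillation.
Context d (T : measurableType d) (R : realType).
Variable mu : {sigma_finite_measure set T -> \bar R}.

(** The transition density of a reversible Markov kernel: the properties of a Fourier kernel on
    which the estimates of [oscillation] rest, on the line and on products alike. *)
Record symmetric_markov (k : T -> T -> R) : Prop := SymmetricMarkov {
  sm_k0 : forall x y, 0 <= k x y;
  sm_kC : forall x y, k x y = k y x;
  sm_mk : measurable_fun setT (fun z : T * T => k z.1 z.2);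
  sm_kint : forall x, (\int[mu]_y (k x y)%:E = 1)%E }.

Section one_kernel.
Variable k : T -> T -> R.
Hypothesis sm : symmetric_markov k.
Local Open Scope ereal_scope.
Implicit Types u v : T -> R.

Lemma measurable_inner (F : T * T -> R) : measurable_fun setT F ->
  (forall z, 0 <= F z)%R ->
  measurable_fun setT (fun x => \int[mu]_y (F (x, y))%:E).
Proof.
move=> mF F0.
apply: (@measurable_fun_fubini_tonelli_F _ _ _ _ _ mu (EFin \o F)) => [|z].
  exact/measurable_EFinP.
by rewrite lee_fin.
Qed.

Let mk1 x : measurable_fun setT (k x).
Proof. exact: (measurableT_comp (sm_mk sm) (measurable_pair1 x)). Qed.

Lemma tonelli_kernel (F : T * T -> R) : measurable_fun setT F ->
  (forall z, 0 <= F z)%R ->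
  \int[mu]_x \int[mu]_y (k x y * F (x, y))%:E =
  \int[mu]_x \int[mu]_y (k x y * F (y, x))%:E.
Proof.
move=> mF F0.
have mkF : measurable_fun setT (fun z : T * T => (k z.1 z.2 * F z)%:E).
  by apply/measurable_EFinP/measurable_funM => //; exact: (sm_mk sm).
have kF0 z : 0 <= (k z.1 z.2 * F z)%:E by rewrite lee_fin mulr_ge0// (sm_k0 sm).
have /= -> := @fubini_tonelli _ _ _ _ _ mu mu _ mkF kF0.
by apply: eq_integral => x _; apply: eq_integral => y _; rewrite (sm_kC sm).
Qed.

Lemma kernel_outer u : measurable_fun setT u -> (forall x, 0 <= u x)%R ->
  \int[mu]_x \int[mu]_y (k x y * u x)%:E = \int[mu]_x (u x)%:E.
Proof.
move=> mu' u0; apply: eq_integral => x _.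
under eq_integral do rewrite EFinM.
rewrite ge0_integralZr//; first by rewrite (sm_kint sm) mul1e.
- exact/measurable_EFinP.
- by move=> y _; rewrite lee_fin (sm_k0 sm).
- by rewrite lee_fin.
Qed.

(** By symmetry, [mu] is invariant under the kernel. *)
Lemma kernel_inner u : measurable_fun setT u -> (forall x, 0 <= u x)%R ->
  \int[mu]_x \int[mu]_y (k x y * u y)%:E = \int[mu]_x (u x)%:E.
Proof.
move=> mu' u0; rewrite -(kernel_outer mu' u0).
rewrite (@tonelli_kernel (fun z => u z.2))//.
exact: (measurableT_comp mu' measurable_snd).
Qed.

Let mosc u : measurable_fun setT u ->
  measurable_fun setT (fun z : T * T => k z.1 z.2 * (u z.1 - u z.2) ^+ 2)%R.
Proof.
move=> mu'; apply: measurable_funM; first exact: (sm_mk sm).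
apply: measurable_funX; apply: measurable_funB.
  exact: (measurableT_comp mu' measurable_fst).
exact: (measurableT_comp mu' measurable_snd).
Qed.

Let osc0 u z : (0 <= k z.1 z.2 * (u z.1 - u z.2) ^+ 2)%R.
Proof. by rewrite mulr_ge0 ?sqr_ge0// (sm_k0 sm). Qed.

Lemma oscillation_ge0 u : 0 <= oscillation mu k u.
Proof.
apply: integral_ge0 => x _; apply: integral_ge0 => y _.
by rewrite lee_fin (osc0 u (x, y)).
Qed.

Lemma le_integral2 (F G : T * T -> R) : measurable_fun setT F ->
  measurable_fun setT G -> (forall z, 0 <= F z)%R -> (forall z, F z <= G z)%R ->
  \int[mu]_x \int[mu]_y (F (x, y))%:E <= \int[mu]_x \int[mu]_y (G (x, y))%:E.
Proof.
move=> mF mG F0 FG; have G0 z : (0 <= G z)%R by exact: le_trans (F0 z) (FG z).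
have m1 (H : T * T -> R) x : measurable_fun setT H ->
    measurable_fun setT (fun y => (H (x, y))%:E).
  move=> mH; apply/measurable_EFinP.
  exact: (measurableT_comp mH (measurable_pair1 x)).
apply: ge0_le_integral => //.
- by move=> x _; apply: integral_ge0 => y _; rewrite lee_fin.
- exact: measurable_inner.
- exact: measurable_inner.
- move=> x _; apply: ge0_le_integral => //; try exact: m1.
  + by move=> y _; rewrite lee_fin.
  + by move=> y _; rewrite lee_fin.
Qed.

Lemma integral2D (F G : T * T -> R) : measurable_fun setT F ->
  measurable_fun setT G -> (forall z, 0 <= F z)%R -> (forall z, 0 <= G z)%R ->
  \int[mu]_x \int[mu]_y (F (x, y) + G (x, y))%:E =
  \int[mu]_x \int[mu]_y (F (x, y))%:E + \int[mu]_x \int[mu]_y (G (x, y))%:E.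
Proof.
move=> mF mG F0 G0.
have m1 (H : T * T -> R) x : measurable_fun setT H ->
    measurable_fun setT (fun y => (H (x, y))%:E).
  move=> mH; apply/measurable_EFinP.
  exact: (measurableT_comp mH (measurable_pair1 x)).
rewrite -ge0_integralD//.
- apply: eq_integral => x _; under eq_integral do rewrite EFinD.
  rewrite ge0_integralD//; try exact: m1.
  + by move=> y _; rewrite lee_fin.
  + by move=> y _; rewrite lee_fin.
- by move=> x _; apply: integral_ge0 => y _; rewrite lee_fin.
- exact: measurable_inner.
- by move=> x _; apply: integral_ge0 => y _; rewrite lee_fin.
- exact: measurable_inner.
Qed.

Lemma integral2Z (a : R) (F : T * T -> R) : measurable_fun setT F ->
  (0 <= a)%R -> (forall z, 0 <= F z)%R ->
  \int[mu]_x \int[mu]_y (a * F (x, y))%:E =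
  a%:E * \int[mu]_x \int[mu]_y (F (x, y))%:E.
Proof.
move=> mF a0 F0; rewrite -ge0_integralZl//.
- apply: eq_integral => x _; under eq_integral do rewrite EFinM.
  rewrite ge0_integralZl//.
  + apply/measurable_EFinP; exact: (measurableT_comp mF (measurable_pair1 x)).
  + by move=> y _; rewrite lee_fin.
- exact: measurable_inner.
- by move=> x _; apply: integral_ge0 => y _; rewrite lee_fin.
Qed.

Lemma oscillationD_le u v : measurable_fun setT u -> measurable_fun setT v ->
  oscillation mu k (fun x => u x + v x)%R <=
  2%:E * oscillation mu k u + 2%:E * oscillation mu k v.
Proof.
move=> mu' mv; rewrite /oscillation.
pose F u := (fun z : T * T => k z.1 z.2 * (u z.1 - u z.2) ^+ 2)%R.
rewrite -(integral2Z (mosc mu') _ (osc0 u))// -(integral2Z (mosc mv) _ (osc0 v))//.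
rewrite -(@integral2D (fun z => 2 * F u z)%R (fun z => 2 * F v z)%R); last 4 first.
- by apply: measurable_funM => //; exact: mosc.
- by apply: measurable_funM => //; exact: mosc.
- by move=> z; rewrite mulr_ge0//; exact: osc0.
- by move=> z; rewrite mulr_ge0//; exact: osc0.
apply: (@le_integral2 (F (fun x => u x + v x)%R) (fun z => 2 * F u z + 2 * F v z)%R).
- by apply: mosc; exact: measurable_funD.
- by apply: measurable_funD; apply: measurable_funM => //; exact: mosc.
- exact: osc0.
- move=> z; rewrite /F -subr_ge0.
  rewrite [leRHS](_ : _ = k z.1 z.2 * ((u z.1 - u z.2) - (v z.1 - v z.2)) ^+ 2)%R.
    by rewrite mulr_ge0 ?sqr_ge0// (sm_k0 sm).
  ring.
Qed.

Lemma oscillationZ (a : R) u : measurable_fun setT u ->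
  oscillation mu k (fun x => a * u x)%R = (a ^+ 2)%:E * oscillation mu k u.
Proof.
move=> mu'; rewrite /oscillation -(integral2Z (mosc mu') _ (osc0 u)) ?sqr_ge0//.
apply: eq_integral => x _; apply: eq_integral => y _ /=; congr _%:E; ring.
Qed.

(** From [(a - b)^2 <= 2 a^2 + 2 b^2]: each square integrates to the squared norm of [u] by one of
    the two marginals of the kernel, so the factor is [2 + 2]. *)
Lemma oscillation_le u : measurable_fun setT u ->
  oscillation mu k u <= 4%:E * sqint mu u.
Proof.
move=> mu'; have mu2 : measurable_fun setT (fun x => 2 * u x ^+ 2)%R.
  by apply: measurable_funM => //; exact: measurable_funX.
have u20 x : (0 <= 2 * u x ^+ 2)%R by rewrite mulr_ge0// sqr_ge0.
have mF1 : measurable_fun setT (fun z : T * T => k z.1 z.2 * (2 * u z.1 ^+ 2))%R.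
  apply: measurable_funM; first exact: (sm_mk sm).
  exact: (measurableT_comp mu2 measurable_fst).
have mF2 : measurable_fun setT (fun z : T * T => k z.1 z.2 * (2 * u z.2 ^+ 2))%R.
  apply: measurable_funM; first exact: (sm_mk sm).
  exact: (measurableT_comp mu2 measurable_snd).
apply: (@le_trans _ _ (\int[mu]_x \int[mu]_y
    (k x y * (2 * u x ^+ 2) + k x y * (2 * u y ^+ 2))%:E)).
  apply: (@le_integral2 (fun z : T * T => k z.1 z.2 * (u z.1 - u z.2) ^+ 2)%R
    (fun z => k z.1 z.2 * (2 * u z.1 ^+ 2) + k z.1 z.2 * (2 * u z.2 ^+ 2))%R).
  - exact: mosc.
  - exact: measurable_funD.
  - exact: osc0.
  - move=> z; rewrite -mulrDr ler_wpM2l ?(sm_k0 sm)//.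
    have := sqr_ge0 (u z.1 + u z.2); nra.
rewrite (@integral2D (fun z => k z.1 z.2 * (2 * u z.1 ^+ 2))%R
   (fun z => k z.1 z.2 * (2 * u z.2 ^+ 2))%R)//; last 2 first.
- by move=> z; rewrite mulr_ge0// (sm_k0 sm).
- by move=> z; rewrite mulr_ge0// (sm_k0 sm).
rewrite (kernel_outer mu2 u20) (kernel_inner mu2 u20).
under eq_integral do rewrite EFinM.
rewrite ge0_integralZl//; last 2 first.
- by apply/measurable_EFinP; exact: measurable_funX.
- by move=> x _; rewrite lee_fin sqr_ge0.
by rewrite -/(sqint mu u) -ge0_muleDl ?lee_fin// -EFinD -natrD.
Qed.

(** The squared difference is 1 exactly when one of the two points lies in [A] and the other does
    not; symmetry makes both cases equal. What remains is twice the mass that the kernel carries out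
    of [A]. *)
Lemma oscillation_indic (A : set T) : measurable A ->
  oscillation mu k \1_A =
  2%:E * \int[mu]_x (\1_A x * (\int[mu]_y (k x y * (1 - \1_A y))))%:E.
Proof.
move=> mA; have i0 z : (0 <= (\1_A z : R))%R by [].
have i1 z : (0 <= 1 - (\1_A z : R))%R by rewrite subr_ge0 indicE; case: (_ \in _).
have mi : measurable_fun setT (\1_A : T -> R) by exact: measurable_indic.
have mi1 : measurable_fun setT (fun x => 1 - (\1_A x : R))%R by exact: measurable_funB.
have m12 : measurable_fun setT (fun z : T * T => (\1_A z.1 : R) * (1 - \1_A z.2))%R.
  apply: measurable_funM; first exact: (measurableT_comp mi measurable_fst).
  exact: (measurableT_comp mi1 measurable_snd).
have m21 : measurable_fun setT (fun z : T * T => (\1_A z.2 : R) * (1 - \1_A z.1))%R.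
  apply: measurable_funM; first exact: (measurableT_comp mi measurable_snd).
  exact: (measurableT_comp mi1 measurable_fst).
transitivity (\int[mu]_x \int[mu]_y (k x y * ((\1_A x : R) * (1 - \1_A y)) +
    k x y * ((\1_A y : R) * (1 - \1_A x)))%:E).
  apply: eq_integral => x _; apply: eq_integral => y _.
  rewrite -mulrDr; congr (_ * _)%:E; rewrite !indicE.
  by case: (x \in A); case: (y \in A); rewrite /=; ring.
rewrite (@integral2D (fun z => k z.1 z.2 * ((\1_A z.1 : R) * (1 - \1_A z.2)))%R
   (fun z => k z.1 z.2 * ((\1_A z.2 : R) * (1 - \1_A z.1)))%R); last 4 first.
- by apply: measurable_funM => //; exact: (sm_mk sm).
- by apply: measurable_funM => //; exact: (sm_mk sm).
- by move=> z; rewrite !mulr_ge0// (sm_k0 sm).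
- by move=> z; rewrite !mulr_ge0// (sm_k0 sm).
have i21 z : (0 <= (\1_A z.2 : R) * (1 - \1_A z.1))%R by rewrite mulr_ge0.
rewrite (tonelli_kernel m21 i21).
rewrite /= -[X in X + _]mul1e -[X in _ + X]mul1e -ge0_muleDl ?lee_fin//.
rewrite -EFinD (_ : (1 + 1 = 2 :> R)%R)//; congr (_ * _); apply: eq_integral => x _.
rewrite (_ : (\1_A x * _)%:E = (\1_A x)%:E * (\int[mu]_y (k x y * (1 - \1_A y)))%:E)//.
rewrite /Rintegral fineK; last first.
  rewrite ge0_fin_numE; last first.
    by apply: integral_ge0 => y _; rewrite lee_fin mulr_ge0// (sm_k0 sm).
  apply: (@le_lt_trans _ _ (\int[mu]_y (k x y)%:E)); last by rewrite (sm_kint sm) ltry.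
  apply: ge0_le_integral => //.
  - by move=> y _; rewrite lee_fin mulr_ge0// (sm_k0 sm).
  - by apply/measurable_EFinP/measurable_funM.
  - exact/measurable_EFinP.
  - by move=> y _; rewrite lee_fin ler_piMr ?(sm_k0 sm)// gerBl.
rewrite -ge0_integralZl//.
- by apply: eq_integral => y _; rewrite -EFinM mulrCA.
- by apply/measurable_EFinP/measurable_funM.
- by move=> y _; rewrite lee_fin mulr_ge0// (sm_k0 sm).
Qed.

End one_kernel.

Variable k : nat -> T -> T -> R.
Hypothesis sm : forall n, symmetric_markov (k n).
Variables (G : set (set T)) (B : nat -> set T).
Hypotheses (mG : measurable = <<s G >>) (GI : setI_closed G).
Hypotheses (mB : forall n, measurable (B n)) (ndB : nondecreasing_seq B).
Hypotheses (B_cover : \bigcup_n B n = setT) (B_fin : forall n, (mu (B n) < +oo)%E).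
Hypothesis osc_G : forall m A, G A ->
  (fun n => oscillation mu (k n) \1_(A `&` B m)) @ \oo --> 0%E.
Hypothesis osc_B : forall m, (fun n => oscillation mu (k n) \1_(B m)) @ \oo --> 0%E.

(** The functions whose oscillation tends to 0 form a subspace, closed in L^2 because
    [oscillation_le] is uniform in [n]; density reduces the claim to indicators. *)
Lemma cvg_oscillation (h : T -> R) : measurable_fun setT h ->
  (sqint mu h < +oo)%E -> (fun n => oscillation mu (k n) h) @ \oo --> 0%E.
Proof.
pose V (u : T -> R) := measurable_fun setT u /\
  (fun n => oscillation mu (k n) u) @ \oo --> 0%E.
move=> mh h2; suff : V h by case.
have GM A : G A -> measurable A by move=> GA; rewrite mG; exact: sub_sigma_algebra.
refine (square_integrable_density (V := V) mG GI mB ndB B_cover B_fin _ _ _ _ _ mh h2).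
- move=> u v [mu' u0] [mv v0]; split; first exact: measurable_funD.
  apply: (ge0_ecvg0_le _ (fun n => oscillationD_le (sm n) mu' mv)).
    by move=> n; exact: oscillation_ge0.
  by apply: ge0_ecvg0D; exact: ge0_ecvg0Z.
- move=> a u [mu' u0]; split; first exact: measurable_funM.
  apply: (@ge0_ecvg0_le _ _ (fun n => (a ^+ 2)%:E * oscillation mu (k n) u)%E).
  + by move=> n; exact: oscillation_ge0.
  + by move=> n; rewrite (oscillationZ (sm n)).
  + exact: ge0_ecvg0Z.
- move=> v u Vv mu' u2 vu; split => //.
  have mv m : measurable_fun setT (v m) by have [] := Vv m.
  (* The factor 8 is [2 * 4], from [oscillationD_le] and [oscillation_le]. The last term does not
     depend on [n], so [m] can be fixed before [n] grows. *)
  have bnd m n : (oscillation mu (k n) u <=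
      2%:E * oscillation mu (k n) (v m) + 8%:E * sqint mu (fun x => v m x - u x)%R)%E.
    have {1}-> : u = (fun x => v m x + (-1) * (v m x - u x)).
      by apply/funext => x; ring.
    apply: le_trans (oscillationD_le (sm n) _ _) _ => //.
      by apply: measurable_funM => //; exact: measurable_funB.
    apply: leeD => //; rewrite (oscillationZ (sm n)); last exact: measurable_funB.
    rewrite sqrrN expr1n mul1e.
    apply: (@le_trans _ _ (2%:E * (4%:E * sqint mu (fun x => v m x - u x)%R)))%E.
      by apply: lee_wpmul2l; rewrite ?lee_fin//; apply: oscillation_le => //; exact: measurable_funB.
    by rewrite muleA -EFinM -natrM.
  apply/ge0_ecvg0P => [n|e e0]; first exact: oscillation_ge0.
  have /ge0_ecvg0P/(_ (e / 16)) := vu.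
  move=> /(_ (fun n => sqint_ge0 _ _)) []; first by rewrite divr_gt0.
  move=> m _ /(_ _ (leqnn m)) /= vm.
  have [_ /ge0_ecvg0P/(_ (e / 4))] := Vv m.
  move=> /(_ (fun n => oscillation_ge0 (sm n) _)) []; first by rewrite divr_gt0.
  move=> N _ hN; exists N => // n /= Nn; apply: le_lt_trans (bnd m n) _.
  have -> : e%:E = (2%:E * (e / 4)%:E + 8%:E * (e / 16)%:E)%E.
    by rewrite -!EFinM -EFinD; congr _%:E; field.
  by apply: lteD; rewrite lte_pmul2l//; exact: hN.
- move=> m A GA; split; last exact: osc_G.
  by apply: measurable_indic; apply: measurableI => //; exact: GM.
- by move=> m; split; [exact: measurable_indic|exact: osc_B].
Qed.

End oscillation.

(** * The Fourier transform of the exponential weight *)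

Section poisson_integrals.
Variable R : realType.
Local Notation mu := (@lebesgue_measure R).

Lemma ge0_FTC2y (f F : R -> R) (a l : R) : (forall x, 0 <= f x) ->
  continuous f -> (forall x, derivable F x 1 /\ 'D_1 F x = f x) ->
  F x @[x --> +oo] --> l ->
  (\int[mu]_(x in `[a, +oo[) (f x)%:E = (l - F a)%:E)%E.
Proof.
move=> f0 cf dF Fl.
rewrite (@ge0_continuous_FTC2y _ f F a l) ?EFinB//.
- exact: continuous_subspaceT.
- by move=> x _; have [] := dF x.
- apply: cvg_at_right_filter; apply: differentiable_continuous.
  by apply/derivable1_diffP; have [] := dF a.
- by move=> x _; rewrite derive1E; have [_ ->] := dF x.
Qed.

Lemma ge0_even_integral (f : R -> R) : (forall x, 0 <= f x) -> continuous f ->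
  (forall x, f (- x) = f x) ->
  (\int[mu]_x (f x)%:E = 2%:E * \int[mu]_(x in `[0%R, +oo[) (f x)%:E)%E.
Proof.
move=> f0 cf fN; rewrite ge0_symfun_integralT//; last by move=> x /=; rewrite fN.
by rewrite -set_itvcy.
Qed.

Variable e : R.
Hypothesis e0 : 0 < e.

Let cvg_exp : expR (- (e * s)) @[s --> +oo] --> (0 : R).
Proof.
apply: (@cvg_comp _ _ _ (fun s : R => e * s) (fun s : R => expR (- s)) _ (+oo)).
  exact: (@gt0_cvgMry _ _ _ e id).
exact: cvgr_expR.
Qed.

Let der_exp (s : R) : is_derive s (1 : R) (fun s : R => expR (- (e * s))) (- e * expR (- (e * s))).
Proof.
have h : is_derive s (1 : R) (fun s : R => - (e * s)) (- e).
  by apply: is_derive_eq; rewrite /GRing.scale /= ?mulr1.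
by apply: is_derive_eq; rewrite /GRing.scale /= mulrC.
Qed.

Let cont_exp : continuous (fun s : R => expR (- (e * s))).
Proof.
by move=> s; apply: differentiable_continuous; apply/derivable1_diffP; have [] := der_exp s.
Qed.

Let cont_exp_norm : continuous (fun s : R => expR (- (e * `|s|))).
Proof.
move=> s; apply: (@continuous_comp _ _ _ (fun s : R => `|s|)
  (fun s : R => expR (- (e * s)))); [exact: norm_continuous|exact: cont_exp].
Qed.

Lemma integral_exp_norm : (\int[mu]_s (expR (- (e * `|s|)))%:E = (2 / e)%:E)%E.
Proof.
rewrite ge0_even_integral => [|s|//|s]; last 2 first.
- exact: expR_ge0.
- by rewrite normrN.
rewrite (_ : (\int[mu]_(s in _) _ = \int[mu]_(s in `[0%R, +oo[) (expR (- (e * s)))%:E)%E); last first.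
  by apply: eq_integral => s; rewrite inE /= in_itv /= andbT => s0; rewrite ger0_norm.
rewrite (@ge0_FTC2y _ (fun s => - e^-1 * expR (- (e * s))) 0 0).
- by rewrite mulr0 oppr0 expR0 mulr1 sub0r opprK.
- by move=> s; exact: expR_ge0.
- exact: cont_exp.
- move=> s; suff : is_derive s (1 : R) (fun s => - e^-1 * expR (- (e * s))) (expR (- (e * s))).
    by case.
  apply: is_derive_eq; rewrite /GRing.scale /=.
  by field; rewrite gt_eqF.
- by rewrite -[X in _ --> X](mulr0 (- e^-1)); apply: cvgM; [exact: cvg_cst|exact: cvg_exp].
Qed.

Variable t : R.

Let D := e ^+ 2 + t ^+ 2.
Let D0 : 0 < D. Proof. by rewrite ltr_pwDl ?exprn_gt0// sqr_ge0. Qed.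

Let cont_cos : continuous (fun s : R => cos (t * s)).
Proof.
move=> s; apply: (@continuous_comp _ _ _ (fun s : R => t * s) cos).
  exact: mulrl_continuous.
exact: continuous_cos.
Qed.

Let cont_sin : continuous (fun s : R => sin (t * s)).
Proof.
move=> s; apply: (@continuous_comp _ _ _ (fun s : R => t * s) sin).
  exact: mulrl_continuous.
exact: continuous_sin.
Qed.

Let der_cos (s : R) : is_derive s (1 : R) (fun s : R => cos (t * s)) (- t * sin (t * s)).
Proof.
have h : is_derive s (1 : R) (fun s : R => t * s) t.
  by apply: is_derive_eq; rewrite /GRing.scale /= ?mulr1.
by apply: is_derive_eq; rewrite /GRing.scale /=; ring.
Qed.

Let der_sin (s : R) : is_derive s (1 : R) (fun s : R => sin (t * s)) (t * cos (t * s)).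
Proof.
have h : is_derive s (1 : R) (fun s : R => t * s) t.
  by apply: is_derive_eq; rewrite /GRing.scale /= ?mulr1.
by apply: is_derive_eq; rewrite /GRing.scale /=; ring.
Qed.

(** The factor [1 - cos] keeps the integrand nonnegative, as integration by a primitive up to
    infinity requires here; the cosine integral follows by subtraction. *)
Lemma integral_exp_norm_cosB :
  (\int[mu]_s (expR (- (e * `|s|)) * (1 - cos (t * s)))%:E =
   (2 / e - 2 * e / D)%:E)%E.
Proof.
have c1 s : 0 <= 1 - cos (t * s) by rewrite subr_ge0 cos_le1.
rewrite ge0_even_integral => [|s||s]; last 3 first.
- by rewrite mulr_ge0// expR_ge0.
- move=> x; apply: cvgM; first exact: cont_exp_norm.
  by apply: cvgB; [exact: cvg_cst|exact: cont_cos].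
- by rewrite normrN mulrN cosN.
rewrite (_ : (\int[mu]_(s in _) _ = \int[mu]_(s in `[0%R, +oo[)
    (expR (- (e * s)) * (1 - cos (t * s)))%:E)%E); last first.
  by apply: eq_integral => s; rewrite inE /= in_itv /= andbT => s0; rewrite ger0_norm.
(* [expR (- (e * s)) * g s] is the primitive: [- e^-1] accounts for the 1 in [1 - cos], the other
   term for the cosine. *)
pose g s := - e^-1 + D^-1 * (e * cos (t * s) - t * sin (t * s)).
rewrite (@ge0_FTC2y _ (fun s => expR (- (e * s)) * g s) 0 0).
- rewrite /g !mulr0 oppr0 expR0 mul1r cos0 sin0 mulr0 subr0 mulr1 -EFinM.
  by congr _%:E; field; rewrite !gt_eqF//.
- by move=> s; rewrite mulr_ge0// expR_ge0.
- move=> s; apply: cvgM; first exact: cont_exp.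
  by apply: cvgB; [exact: cvg_cst|exact: cont_cos].
- move=> s; suff : is_derive s (1 : R) (fun s => expR (- (e * s)) * g s)
    (expR (- (e * s)) * (1 - cos (t * s))) by case.
  rewrite /g; apply: is_derive_eq; rewrite /GRing.scale /=.
  rewrite /D; field; rewrite gt_eqF//= gt_eqF//.
- have gM s : `|g s| <= e^-1 + D^-1 * (e + `|t|).
    have De : 0 <= D^-1 by rewrite invr_ge0 ltW.
    apply: le_trans (ler_normD _ _) _; rewrite normrN normrM (ger0_norm De).
    rewrite (ger0_norm (_ : 0 <= e^-1)) ?invr_ge0 ?(ltW e0)// lerD2l.
    apply: ler_wpM2l => //; apply: le_trans (ler_normB _ _) _.
    rewrite !normrM (gtr0_norm e0); apply: lerD.
      by apply: ler_piMr; [exact: ltW|rewrite ler_norml cos_geN1 cos_le1].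
    by apply: ler_piMr => //; rewrite ler_norml sin_geN1 sin_le1.
  have cv : expR (- (e * s)) * (e^-1 + D^-1 * (e + `|t|)) @[s --> +oo] --> (0 : R).
    rewrite -[X in _ --> X](mul0r (e^-1 + D^-1 * (e + `|t|))).
    by apply: cvgM; [exact: cvg_exp|exact: cvg_cst].
  apply: norm_cvg0; apply: (squeeze_cvgr _ (@cvg_cst _ (0 : R) _ _ _) cv).
  apply: nearW => s; rewrite normr_ge0 normrM ger0_norm ?expR_ge0//=.
  by rewrite ler_wpM2l ?expR_ge0.
Qed.

Lemma integrable_exp_norm : mu.-integrable setT (EFin \o (fun s => expR (- (e * `|s|)))).
Proof.
apply: integrable_ge0_fin => //.
- by apply: continuous_measurable_fun; exact: cont_exp_norm.
- by rewrite integral_exp_norm ltry.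
Qed.

Lemma Rintegral_exp_norm_cos :
  \int[mu]_s (expR (- (e * `|s|)) * cos (t * s)) = 2 * e / D.
Proof.
have iB : mu.-integrable setT (EFin \o (fun s => expR (- (e * `|s|)) * (1 - cos (t * s)))).
  apply: integrable_ge0_fin => //.
  - apply: continuous_measurable_fun => s; apply: cvgM; first exact: cont_exp_norm.
    by apply: cvgB; [exact: cvg_cst|exact: cont_cos].
  - by rewrite integral_exp_norm_cosB ltry.
transitivity (\int[mu]_s (expR (- (e * `|s|)) - expR (- (e * `|s|)) * (1 - cos (t * s)))).
  by apply: eq_Rintegral => s _; ring.
rewrite RintegralB//; last exact: integrable_exp_norm.
rewrite /Rintegral integral_exp_norm integral_exp_norm_cosB /=; ring.
Qed.

Lemma Rintegral_exp_norm_sin :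
  \int[mu]_s (expR (- (e * `|s|)) * sin (t * s)) = 0.
Proof.
have ms : measurable_fun setT (fun s : R => expR (- (e * `|s|)) * sin (t * s)).
  apply: continuous_measurable_fun => s; apply: cvgM; first exact: cont_exp_norm.
  exact: cont_sin.
have is_ : mu.-integrable setT (EFin \o (fun s => expR (- (e * `|s|)) * sin (t * s))).
  apply: le_integrable integrable_exp_norm => //; first exact/measurable_EFinP.
  move=> s _ /=; rewrite lee_fin normrM ler_piMr// ler_norml sin_geN1 sin_le1//.
set I := Rintegral _ _ _.
have : I = - I.
  rewrite -[RHS]mulN1r /I -RintegralZl// /Rintegral; congr fine.
  rewrite integral_opp; last exact/measurable_EFinP.
  by apply: eq_integral => s _; rewrite normrN mulrN sinN; congr _%:E; ring.
move=> h; apply/eqP; have : I *+ 2 == 0 by rewrite mulr2n {1}h addNr.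
by rewrite mulrn_eq0.
Qed.

End poisson_integrals.

(** * The Poisson kernel is a Fourier kernel on the line *)

Section poisson_kernel.
Variable R : realType.
Local Notation mu := (@lebesgue_measure R).

Definition poisson_weight (e x : R) : R := expR (- (e * `|x|)).

(** The Poisson kernel of the half-plane at height [e], or Cauchy density of scale [e] centred at
    [x]. Its primitive is an arctangent, which makes the integrals over intervals explicit. *)
Definition poisson_kernel (e x y : R) : R := e / (pi * (e ^+ 2 + (x - y) ^+ 2)).

Lemma poisson_kernelC (e x y : R) : poisson_kernel e x y = poisson_kernel e y x.
Proof. by rewrite /poisson_kernel -[(x - y) ^+ 2]sqrrN opprB. Qed.

Section fixed_scale.
Variable e : R.
Hypothesis e0 : 0 < e.

Let D0 (x y : R) : 0 < e ^+ 2 + (x - y) ^+ 2.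
Proof. by rewrite ltr_pwDl ?exprn_gt0// sqr_ge0. Qed.

Lemma poisson_kernel_ge0 x y : 0 <= poisson_kernel e x y.
Proof. by rewrite divr_ge0 ?ltW// mulr_gt0 ?pi_gt0. Qed.

Lemma poisson_kernel_le x y : poisson_kernel e x y <= e / (pi * e ^+ 2).
Proof.
rewrite /poisson_kernel ler_pM2l// lef_pV2 ?posrE ?mulr_gt0 ?pi_gt0 ?exprn_gt0//.
by rewrite ler_pM2l ?pi_gt0// lerDl sqr_ge0.
Qed.

Let cont_diff (x : R) : continuous (fun y => x - y).
Proof. by move=> y; apply: cvgB; [exact: cvg_cst|exact: cvg_id]. Qed.

Lemma continuous_poisson_kernel x : continuous (poisson_kernel e x).
Proof.
move=> y; apply: cvgM; first exact: cvg_cst.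
apply: cvgV; first by rewrite gt_eqF// mulr_gt0 ?pi_gt0.
apply: cvgM; first exact: cvg_cst.
apply: cvgD; first exact: cvg_cst.
by under eq_fun do rewrite expr2; apply: cvgM; exact: cont_diff.
Qed.

Lemma measurable_poisson_kernel :
  measurable_fun setT (fun z : measurableTypeR R * measurableTypeR R => poisson_kernel e z.1 z.2).
Proof.
have -> : (fun z : R * R => poisson_kernel e z.1 z.2) =
  (poisson_kernel e 0 \o (fun z : R * R => z.1 - z.2)).
  by apply/funext => z /=; rewrite /poisson_kernel sub0r sqrrN.
apply: measurableT_comp.
  apply: continuous_measurable_fun; exact: continuous_poisson_kernel.
by apply: measurable_funB; [exact: measurable_fst|exact: measurable_snd].
Qed.

Definition poisson_primitive (x y : R) : R := pi^-1 * atan ((y - x) * e^-1).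

Lemma is_derive_poisson (x y : R) :
  is_derive y (1 : R) (poisson_primitive x) (poisson_kernel e x y).
Proof.
have h : is_derive y (1 : R) (fun y => (y - x) * e^-1) e^-1.
  by apply: is_derive_eq; rewrite /GRing.scale /=; ring.
rewrite /poisson_primitive; apply: is_derive_eq; rewrite /GRing.scale /= /poisson_kernel.
move: (@pi R) (pi_gt0 R) => p p0; field.
by rewrite !gt_eqF// D0.
Qed.

Lemma integral_poisson_kernel x : (\int[mu]_y (poisson_kernel e x y)%:E = 1)%E.
Proof.
rewrite (@ge0_integral_affine _ 1 x) => [|//| |y]; last 2 first.
- apply/measurable_EFinP; apply: continuous_measurable_fun.
  exact: continuous_poisson_kernel.
- by rewrite lee_fin poisson_kernel_ge0.
rewrite mul1e (_ : (\int[mu]_y _ = \int[mu]_y (poisson_kernel e 0 y)%:E)%E); last first.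
  by apply: eq_integral => y _; rewrite /poisson_kernel (_ : x - (1 * y + x) = 0 - y)//; ring.
rewrite ge0_even_integral => [|y|y|y]; last 3 first.
- exact: poisson_kernel_ge0.
- exact: continuous_poisson_kernel.
- by rewrite /poisson_kernel !sub0r !sqrrN.
rewrite (@ge0_FTC2y _ _ (poisson_primitive 0) 0 2^-1).
- rewrite /poisson_primitive subrr mul0r atan0 mulr0 subr0 -EFinM divff//.
- by move=> y; exact: poisson_kernel_ge0.
- exact: continuous_poisson_kernel.
- by move=> y; have [] := is_derive_poisson 0 y.
- have -> : 2^-1 = pi^-1 * (pi / 2) :> R by rewrite mulrA mulVf ?mul1r ?gt_eqF ?pi_gt0.
  apply: cvgM; first exact: cvg_cst.
  under eq_cvg do rewrite subr0.
  apply: (@cvg_comp _ _ _ (fun y : R => y * e^-1) (@atan R) _ (+oo)); last exact: cvgy_atan.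
  by apply: (@gt0_cvgMly _ _ _ e^-1 id) => //; rewrite invr_gt0.
Qed.

Lemma symmetric_markov_poisson : symmetric_markov mu (poisson_kernel e).
Proof.
split.
- exact: poisson_kernel_ge0.
- by move=> x y; exact: poisson_kernelC.
- exact: measurable_poisson_kernel.
- exact: integral_poisson_kernel.
Qed.

(** The inner integral of [oscillation_indic] for an interval, in closed form. *)
Lemma Rintegral_poisson_itv (a b x : R) : a < b ->
  \int[mu]_y (poisson_kernel e x y * (1 - \1_(`]a, b]%classic) y)) =
  1 - (poisson_primitive x b - poisson_primitive x a).
Proof.
move=> ab.
have mk : measurable_fun setT (poisson_kernel e x).
  by apply: continuous_measurable_fun; exact: continuous_poisson_kernel.
have ik : mu.-integrable setT (EFin \o poisson_kernel e x).
  apply: integrable_ge0_fin => //; first exact: poisson_kernel_ge0.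
  by rewrite integral_poisson_kernel ltry.
have mA : measurable (`]a, b]%classic : set R) by [].
have mi : measurable_fun setT (\1_(`]a, b]%classic) : R -> R) by exact: measurable_indic.
have ikA : mu.-integrable setT (EFin \o (fun y => poisson_kernel e x y * \1_(`]a, b]%classic) y)).
  apply: le_integrable ik => //; first by apply/measurable_EFinP/measurable_funM.
  move=> y _ /=; rewrite lee_fin normrM ler_piMr// indicE.
  by case: (_ \in _); rewrite ?normr1 ?normr0.
transitivity (\int[mu]_y (poisson_kernel e x y - poisson_kernel e x y * \1_(`]a, b]%classic) y)).
  by apply: eq_Rintegral => y _; rewrite mulrBr mulr1.
rewrite RintegralB//; congr (_ - _).
  by rewrite /Rintegral integral_poisson_kernel.
rewrite /Rintegral.
have -> : (\int[mu]_y (poisson_kernel e x y * \1_(`]a, b]%classic) y)%:E =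
    \int[mu]_(y in `]a, b]%classic) (poisson_kernel e x y)%:E)%E.
  rewrite [RHS]integral_mkcond; apply: eq_integral => y _.
  by rewrite patchE indicE; case: (_ \in _); rewrite ?mulr1 ?mulr0.
rewrite integral_itv_obnd_cbnd; last exact/measurable_EFinP/measurable_funTS.
have D y := is_derive_poisson x y.
have cF y : {for y, continuous (poisson_primitive x)}.
  by apply: differentiable_continuous; apply/derivable1_diffP; have [] := D y.
rewrite (@continuous_FTC2 _ _ (poisson_primitive x))//.
- by apply: continuous_subspaceT; exact: continuous_poisson_kernel.
- split.
  + by move=> y _; have [] := D y.
  + by apply: cvg_at_right_filter; exact: cF.
  + by apply: cvg_at_left_filter; exact: cF.
- by move=> y _; rewrite derive1E; have [_ ->] := D y.
Qed.

End fixed_scale.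

Local Notation eps n := (n.+1%:R^-1 : R).

Let eps0 n : 0 < eps n. Proof. by rewrite invr_gt0. Qed.

Let cvg_scale (t : R) : 0 < t -> t * n.+1%:R @[n --> \oo] --> +oo.
Proof.
move=> t0; apply: (@cvg_comp _ _ _ (fun n : nat => n.+1%:R : R) (fun s : R => t * s) _ (+oo)).
  by have := @cvgr_idn R; rewrite -cvg_shiftS.
exact: (@gt0_cvgMry _ _ _ t id).
Qed.

Let cvg_atan_scale (t : R) : 0 < t ->
  atan (t * (eps n)^-1) @[n --> \oo] --> (pi / 2 : R).
Proof.
move=> t0; have -> : (fun n => atan (t * (eps n)^-1)) = @atan R \o (fun n : nat => t * n.+1%:R).
  by apply/funext => n /=; rewrite invrK.
by apply: cvg_comp; [exact: cvg_scale|exact: cvgy_atan].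
Qed.

(** With [x] strictly between the end points, the two arctangents tend to [pi / 2] and [- (pi / 2)]:
    the mass concentrates at [x]. *)
Lemma cvg_poisson_primitive (a b x : R) : a < x < b ->
  poisson_primitive (eps n) x b - poisson_primitive (eps n) x a @[n --> \oo] --> (1 : R).
Proof.
move=> /andP[ax xb].
have E1 : 1 = pi^-1 * (pi / 2) - pi^-1 * (- (pi / 2)) :> R.
  by rewrite mulrN opprK -mulrDr -splitr mulVf// gt_eqF// pi_gt0.
rewrite [X in _ --> X]E1; apply: cvgB; rewrite /poisson_primitive; apply: cvgM; try exact: cvg_cst.
- by apply: cvg_atan_scale; rewrite subr_gt0.
- have -> : (fun n => atan ((a - x) * (eps n)^-1)) = (fun n => - atan ((x - a) * (eps n)^-1)).
    by apply/funext => n; rewrite -atanN -mulNr opprB.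
  by apply: cvgN; apply: cvg_atan_scale; rewrite subr_gt0.
Qed.

(** From an interior point the mass leaving the interval tends to 0; the indicator of the interval
    dominates, so the integral of this mass over the interval tends to 0 as well. *)
Lemma cvg_oscillation_itv (a b : R) :
  (fun n => oscillation mu (poisson_kernel (eps n)) \1_(`]a, b]%classic)) @ \oo --> 0%E.
Proof.
have mA : measurable (`]a, b]%classic : set R) by [].
have [ba|ab] := leP b a.
  have -> : (fun n => oscillation mu (poisson_kernel (eps n)) \1_(`]a, b]%classic)) = cst 0%E.
    apply/funext => n; rewrite (oscillation_indic (symmetric_markov_poisson (eps0 n)))//.
    rewrite set_itv_ge ?bnd_simp -?leNgt// (@eq_integral _ _ _ mu _ (cst 0%E)).
      by rewrite integral0 mule0.
    by move=> x _; rewrite indic0 mul0r.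
  exact: cvg_cst.
have sm n := symmetric_markov_poisson (eps0 n).
under eq_fun do rewrite (oscillation_indic (sm _))//.
apply: ge0_ecvg0Z; rewrite -[X in _ --> X](@integral0 _ _ _ mu setT).
have q01 n x : 0 <= \int[mu]_y (poisson_kernel (eps n) x y * (1 - \1_(`]a, b]%classic) y)) <= 1.
  apply/andP; split.
    apply: Rintegral_ge0 => y _; apply: mulr_ge0; first exact: poisson_kernel_ge0.
    by rewrite subr_ge0 indicE; case: (_ \in _).
  rewrite Rintegral_poisson_itv// gerBl subr_ge0 /poisson_primitive.
  rewrite ler_pM2l ?invr_gt0 ?pi_gt0//; apply: le_atan.
  by rewrite ler_pM2r ?invr_gt0// lerD2r ltW.
have [|||||_ _] := @dominated_convergence _ _ _ mu setT measurableT
  (fun n x => (\1_(`]a, b]%classic) x * (\int[mu]_y (poisson_kernel (eps n) x y *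
     (1 - \1_(`]a, b]%classic) y))))%:E) (cst 0%E) (EFin \o \1_(`]a, b]%classic)); last by [].
- move=> n; apply/measurable_EFinP; apply: measurable_funM; first exact: measurable_indic.
  apply: (@measurable_Rintegral _ _ _ _ _ mu (fun z => poisson_kernel (eps n) z.1 z.2 *
     (1 - \1_(`]a, b]%classic) z.2))).
  apply: measurable_funM; first exact: measurable_poisson_kernel.
  apply: measurable_funB => //; apply: (measurableT_comp _ measurable_snd).
  exact: measurable_indic.
- exact: measurable_cst.
(* At the end point [b], half of the mass stays outside in the limit, hence this exceptional null
   set. *)
- exists [set b]; split => //; first exact: lebesgue_measure_set1.
  move=> x /=; apply: contra_notP => xb _.
  apply: cvg_EFin; first exact: nearW.
  have [xab|/negbTE xab] := boolP (x \in (`]a, b]%classic : set R)); last first.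
    under eq_cvg do rewrite /= indicE xab mul0r.
    exact: cvg_cst.
  have axb : a < x < b.
    move: xab; rewrite inE /= in_itv /= => /andP[-> ]; rewrite le_eqVlt => /orP[/eqP//|-> //].
  rewrite (_ : (fine \o _) = (fun n => 1 - (poisson_primitive (eps n) x b - poisson_primitive (eps n) x a))).
    by rewrite /= -(subrr (1 : R)); apply: cvgB; [exact: cvg_cst|exact: cvg_poisson_primitive].
  by apply/funext => n /=; rewrite indicE xab mul1r Rintegral_poisson_itv.
- apply: integrable_ge0_fin => //.
  rewrite integral_indic// setIT.
  suff : (lebesgue_measure (`]a, b]%classic : set R) < +oo)%E by [].
  by rewrite lebesgue_measure_itv/= lte_fin ab -EFinB ltry.
- apply/aeW => x n _; rewrite gee0_abs lee_fin.
    by rewrite ler_piMr//; have /andP[] := q01 n x.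
  by rewrite mulr_ge0//; have /andP[] := q01 n x.
Qed.

(** The cosine integral [2 e / (e^2 + t^2)] is [2 pi] times the kernel at distance [t]: this fixes
    the constant. *)
Lemma fourier_kernel_poisson :
  fourier_kernel mu (@dot1 R) (pi *+ 2) (fun n => poisson_weight (eps n))
    (fun n => poisson_kernel (eps n)).
Proof.
have sm n := symmetric_markov_poisson (eps0 n).
have mw n : measurable_fun setT (poisson_weight (eps n)).
  apply: (@measurableT_comp _ _ _ _ _ _ (@expR R)) => //.
  by apply: measurable_funN; apply: measurable_funM => //; exact: measurableT_comp.
split.
- by move=> x y; rewrite /dot1 mulrC.
- by apply: measurable_funM; [exact: measurable_fst|exact: measurable_snd].
- by rewrite mulrn_wgt0// pi_gt0.
- exact: mw.
- by move=> n x; exact: expR_ge0.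
- by move=> n x; rewrite expR_le1 oppr_le0 mulr_ge0.
- move=> x m n mn; rewrite ler_expR lerN2 ler_wpM2r// lef_pV2 ?posrE//.
  by rewrite ler_nat ltnS.
- move=> x; have h : - (eps n * `|x|) @[n --> \oo] --> (0 : R).
    rewrite -[X in _ --> X]oppr0 -[X in - X](mul0r `|x|).
    by apply: cvgN; apply: cvgM; [exact: cvg_harmonic|exact: cvg_cst].
  rewrite -[X in _ --> X]expR0.
  apply: (@cvg_comp _ _ _ (fun n : nat => - (eps n * `|x|)) (@expR R) _ _ _ h).
  exact: continuous_expR.
- by move=> n; exact: integrable_exp_norm.
- by move=> n x y; exact: (sm_k0 (sm n)).
- by move=> n x y; exact: (sm_kC (sm n)).
- by move=> n; exact: (sm_mk (sm n)).
- by move=> n; exact: (sm_kint (sm n)).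
- by move=> n; exists (eps n / (pi * eps n ^+ 2)) => x y; exact: poisson_kernel_le.
- move=> n x y.
  have E s : real_complex R (poisson_weight (eps n) s) * (expi (dot1 s x) * expi (- dot1 s y)) =
      Complex (poisson_weight (eps n) s * cos ((x - y) * s))
        (poisson_weight (eps n) s * sin ((x - y) * s)).
    rewrite -expiD /dot1 -mulrBr mulrC [(x - y) * s]mulrC.
    by apply: complex_ext; rewrite ReImE /=; ring.
  rewrite (_ : (fun s => _ * (_ * _)) = (fun s => Complex
    (poisson_weight (eps n) s * cos ((x - y) * s))
    (poisson_weight (eps n) s * sin ((x - y) * s)))); last first.
    by apply/funext => s; exact: E.
  apply: complex_ext => /=.
  + rewrite /poisson_weight Rintegral_exp_norm_cos// /poisson_kernel.
    move: (@pi R) (pi_gt0 R) => p p0; move: (eps n) (eps0 n) => e e0; field.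
    by rewrite !gt_eqF// ltr_pwDl ?sqr_ge0// exprn_gt0.
  + by rewrite /poisson_weight Rintegral_exp_norm_sin.
- move=> h mh h2.
  (* Half-open, so that intersections with the generating intervals [ocitv] are again of this
     kind. *)
  pose B n : set (measurableTypeR R) := `](- n%:R), n%:R]%classic.
  apply: (@cvg_oscillation _ _ _ mu (fun n => poisson_kernel (eps n)) sm (@ocitv R) B) => //.
  + exact: ocitvI.
  + by move=> n; exact: measurable_itv.
  + move=> m n mn; apply/subsetPset => x; rewrite /B /= !in_itv /= => /andP[x1 x2].
    have mn' : (m%:R <= n%:R :> R) by rewrite ler_nat.
    by rewrite (le_lt_trans _ x1) ?lerN2// (le_trans x2).
  + apply/seteqP; split => // x _; exists (Num.truncn `|x|).+1 => //=.
    rewrite /B /= in_itv /=; have := truncnS_gt `|x|; rewrite ltr_norml => /andP[-> /ltW ->//].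
  + move=> n; suff : (lebesgue_measure (`](- n%:R)%R, n%:R%R]%classic : set R) < +oo)%E by [].
    by rewrite lebesgue_measure_itv /=; case: ifP; rewrite -?EFinB ltry.
  + move=> m A oA; have := ocitvI oA (is_ocitv (- m%:R) m%:R).
    by move=> [[a b] _ <-]; exact: cvg_oscillation_itv.
  + by move=> m; exact: cvg_oscillation_itv.
Qed.

End poisson_kernel.

(* The library's own instance is shadowed by the one on products of
   subprobabilities, so the product is repackaged explicitly. *)
Section product_sigma_finite.
Context d d' (T : measurableType d) (U : measurableType d') (R : realType).
Variable mu : {sigma_finite_measure set T -> \bar R}.
Variable nu : {sigma_finite_measure set U -> \bar R}.

Let sigma_finite_product : sigma_finite setT (mu \x nu)%E.
Proof.
have [F [G [FG _ FGT]]] := rectangle_exhaustion mu nu.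
exists (fun n => F n `*` G n); first by rewrite FGT.
move=> n; have [mF mG Foo Goo] := FG n.
by split; [exact: measurableX|exact: product_measure_fin].
Qed.

Let mixin := Measure_isSigmaFinite.Build _ _ _ (mu \x nu)%E sigma_finite_product.

Definition product_sigma_finite :
    {sigma_finite_measure set (T * U)%type -> \bar R} :=
  HB.pack (mu \x nu)%E mixin.

End product_sigma_finite.

(** * Fourier kernels on product spaces *)

Section product_integrals.
Context d d' (T : measurableType d) (U : measurableType d') (R : realType).
Variable mu : {sigma_finite_measure set T -> \bar R}.
Variable nu : {sigma_finite_measure set U -> \bar R}.

Lemma ge0_integral_prod (u : T -> \bar R) (v : U -> \bar R) :
  measurable_fun setT u -> measurable_fun setT v ->
  (forall x, 0 <= u x)%E -> (forall y, 0 <= v y)%E ->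
  (\int[mu \x nu]_z (u z.1 * v z.2) = (\int[mu]_x u x) * (\int[nu]_y v y))%E.
Proof.
move=> mu' mv u0 v0; rewrite fubini_tonelli1 /fubini_F /=; last 2 first.
- apply: emeasurable_funM; first exact: (measurableT_comp mu' measurable_fst).
  exact: (measurableT_comp mv measurable_snd).
- by move=> z; rewrite mule_ge0.
under eq_integral do rewrite ge0_integralZl//.
rewrite ge0_integralZr//.
by apply: integral_ge0.
Qed.

Lemma cintegral_prod12 (F : T * U -> R[i]) : cintegrable (mu \x nu)%E F ->
  cintegral (mu \x nu)%E F =
  cintegral mu (fun x => cintegral nu (fun y => F (x, y))).
Proof.
move=> [F1 F2]; apply: complex_ext; rewrite /=.
- by rewrite (Rintegral12 F1).
- by rewrite (Rintegral12 F2).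
Qed.

Lemma cintegral_prod (a : T -> R[i]) (b : U -> R[i]) :
  cintegrable mu a -> cintegrable nu b ->
  cintegral (mu \x nu)%E (fun z => a z.1 * b z.2) = cintegral mu a * cintegral nu b.
Proof.
move=> ia ib; rewrite cintegral_prod12 /=; last exact: cintegrable_prod.
under [X in cintegral mu X]eq_fun do rewrite cintegralZ// mulrC.
by rewrite cintegralZ// mulrC.
Qed.

End product_integrals.

Section product_kernel.
Context d d' (T : measurableType d) (U : measurableType d') (R : realType).
Variable mu : {sigma_finite_measure set T -> \bar R}.
Variable nu : {sigma_finite_measure set U -> \bar R}.
Variables (dT : T -> T -> R) (cT : R) (wT : nat -> T -> R) (kT : nat -> T -> T -> R).
Variables (dU : U -> U -> R) (cU : R) (wU : nat -> U -> R) (kU : nat -> U -> U -> R).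
Hypothesis fT : fourier_kernel mu dT cT wT kT.
Hypothesis fU : fourier_kernel nu dU cU wU kU.

Local Notation munu := (product_sigma_finite mu nu).

Let dot (x y : T * U) := dT x.1 y.1 + dU x.2 y.2.
Let w n (x : T * U) := wT n x.1 * wU n x.2.
Let k n (x y : T * U) := kT n x.1 y.1 * kU n x.2 y.2.

Let mTT (p : T -> T -> R) : measurable_fun setT (fun z : T * T => p z.1 z.2) ->
  measurable_fun setT (fun z : (T * U) * (T * U) => p z.1.1 z.2.1).
Proof.
move=> mp; apply: (measurableT_comp mp (g := fun z : (T * U) * (T * U) => (z.1.1, z.2.1))).
apply/measurable_fun_pair.
- exact: (measurableT_comp measurable_fst measurable_fst).
- exact: (measurableT_comp measurable_fst measurable_snd).
Qed.

Let mUU (p : U -> U -> R) : measurable_fun setT (fun z : U * U => p z.1 z.2) ->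
  measurable_fun setT (fun z : (T * U) * (T * U) => p z.1.2 z.2.2).
Proof.
move=> mp; apply: (measurableT_comp mp (g := fun z : (T * U) * (T * U) => (z.1.2, z.2.2))).
apply/measurable_fun_pair.
- exact: (measurableT_comp measurable_snd measurable_fst).
- exact: (measurableT_comp measurable_snd measurable_snd).
Qed.

Let smT n : symmetric_markov mu (kT n).
Proof. by split; [exact: (fk_k0 fT)|exact: (fk_kC fT)|exact: (fk_mk fT)|exact: (fk_kint fT)]. Qed.

Let smU n : symmetric_markov nu (kU n).
Proof. by split; [exact: (fk_k0 fU)|exact: (fk_kC fU)|exact: (fk_mk fU)|exact: (fk_kint fU)]. Qed.

Let sm n : symmetric_markov munu (k n).
Proof.
split.
- by move=> x y; rewrite mulr_ge0// ?(fk_k0 fT) ?(fk_k0 fU).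
- by move=> x y; rewrite /k (fk_kC fT) (fk_kC fU).
- by apply: measurable_funM; [exact: (mTT (fk_mk fT n))|exact: (mUU (fk_mk fU n))].
- move=> x; rewrite /k.
  transitivity (\int[(mu \x nu)%E]_y ((kT n x.1 y.1)%:E * (kU n x.2 y.2)%:E))%E.
    by apply: eq_integral => y _; rewrite EFinM.
  rewrite (ge0_integral_prod mu nu (u := EFin \o kT n x.1) (v := EFin \o kU n x.2)) /=.
  + by rewrite (fk_kint fT) (fk_kint fU) mule1.
  + by apply/measurable_EFinP; exact: (measurableT_comp (fk_mk fT n) (measurable_pair1 _)).
  + by apply/measurable_EFinP; exact: (measurableT_comp (fk_mk fU n) (measurable_pair1 _)).
  + by move=> y; rewrite lee_fin (fk_k0 fT).
  + by move=> y; rewrite lee_fin (fk_k0 fU).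
Qed.

Let ge0_integral4 (p : T * T -> R) (q : U * U -> R) :
  measurable_fun setT p -> measurable_fun setT q ->
  (forall z, 0 <= p z) -> (forall z, 0 <= q z) ->
  (\int[mu \x nu]_x \int[mu \x nu]_y (p (x.1, y.1) * q (x.2, y.2))%:E =
   (\int[mu]_x \int[mu]_y (p (x, y))%:E) * (\int[nu]_x \int[nu]_y (q (x, y))%:E))%E.
Proof.
move=> mp mq p0 q0.
have p1 x : (0 <= \int[mu]_y (p (x, y))%:E)%E.
  by apply: integral_ge0 => y _; rewrite lee_fin.
have q1 x : (0 <= \int[nu]_y (q (x, y))%:E)%E.
  by apply: integral_ge0 => y _; rewrite lee_fin.
rewrite -(ge0_integral_prod mu nu); [|exact: measurable_inner|exact: measurable_inner|by []|by []].
apply: eq_integral => x _; under eq_integral do rewrite EFinM.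
rewrite (ge0_integral_prod mu nu (u := fun y => (p (x.1, y))%:E) (v := fun y => (q (x.2, y))%:E))//.
- by apply/measurable_EFinP; exact: (measurableT_comp mp (measurable_pair1 _)).
- by apply/measurable_EFinP; exact: (measurableT_comp mq (measurable_pair1 _)).
- by move=> y; rewrite lee_fin.
- by move=> y; rewrite lee_fin.
Qed.

Let mdiff d0 (S : measurableType d0) (kk : S -> S -> R) (A : set S) :
  measurable A -> measurable_fun setT (fun z : S * S => kk z.1 z.2) ->
  measurable_fun setT (fun z : S * S => kk z.1 z.2 * (\1_A z.1 - \1_A z.2) ^+ 2).
Proof.
move=> mA mk; apply: measurable_funM => //; apply: measurable_funX.
have mi : measurable_fun setT (\1_A : S -> R) by exact: measurable_indic.
apply: measurable_funB; first exact: (measurableT_comp mi measurable_fst).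
exact: (measurableT_comp mi measurable_snd).
Qed.

(** One coordinate changes at a time: the difference of the two indicators is [(1_A x1 - 1_A y1) 1_B
    x2 + 1_A y1 (1_B x2 - 1_B y2)]. Squaring costs a factor 2 for each term, the integrals factor,
    and the undifferenced indicator integrates to the measure of its set. *)
Lemma oscillation_rectangle n (A : set T) (B : set U) : measurable A -> measurable B ->
  (oscillation munu (k n) \1_(A `*` B) <=
   2%:E * (oscillation mu (kT n) \1_A * nu B) +
   2%:E * (mu A * oscillation nu (kU n) \1_B))%E.
Proof.
move=> mA mB.
have mi1 : measurable_fun setT (\1_A : T -> R) by exact: measurable_indic.
have mi2 : measurable_fun setT (\1_B : U -> R) by exact: measurable_indic.
have E1 : (mu A = \int[mu]_x \int[mu]_y (kT n x y * \1_A y)%:E)%E.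
  by rewrite (kernel_inner (smT n))// integral_indic// setIT.
have E2 : (nu B = \int[nu]_x \int[nu]_y (kU n x y * \1_B x)%:E)%E.
  by rewrite (kernel_outer (smU n))// integral_indic// setIT.
have p10 (z : T * T) : 0 <= kT n z.1 z.2 * (\1_A z.1 - \1_A z.2) ^+ 2.
  by rewrite mulr_ge0 ?sqr_ge0// (fk_k0 fT).
have p20 (z : U * U) : 0 <= kU n z.1 z.2 * (\1_B z.1 - \1_B z.2) ^+ 2.
  by rewrite mulr_ge0 ?sqr_ge0// (fk_k0 fU).
have q10 (z : U * U) : 0 <= kU n z.1 z.2 * \1_B z.1.
  by rewrite mulr_ge0// (fk_k0 fU).
have q20 (z : T * T) : 0 <= kT n z.1 z.2 * \1_A z.2.
  by rewrite mulr_ge0// (fk_k0 fT).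
have mp1 := mdiff mA (fk_mk fT n).
have mp2 := mdiff mB (fk_mk fU n).
have mq1 : measurable_fun setT (fun z : U * U => kU n z.1 z.2 * \1_B z.1).
  apply: measurable_funM; first exact: (fk_mk fU).
  exact: (measurableT_comp mi2 measurable_fst).
have mq2 : measurable_fun setT (fun z : T * T => kT n z.1 z.2 * \1_A z.2).
  apply: measurable_funM; first exact: (fk_mk fT).
  exact: (measurableT_comp mi1 measurable_snd).
have -> : (oscillation mu (kT n) \1_A * nu B)%E = (\int[mu \x nu]_x \int[mu \x nu]_y
   ((kT n x.1 y.1 * (\1_A x.1 - \1_A y.1) ^+ 2) * (kU n x.2 y.2 * \1_B x.2))%:E)%E.
  by rewrite (ge0_integral4 mp1 mq1)//= -E2.
have -> : (mu A * oscillation nu (kU n) \1_B)%E = (\int[mu \x nu]_x \int[mu \x nu]_y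
   ((kT n x.1 y.1 * \1_A y.1) * (kU n x.2 y.2 * (\1_B x.2 - \1_B y.2) ^+ 2))%:E)%E.
  by rewrite (ge0_integral4 mq2 mp2)//= -E1.
pose F (z : (T * U) * (T * U)) := (kT n z.1.1 z.2.1 * (\1_A z.1.1 - \1_A z.2.1) ^+ 2) *
  (kU n z.1.2 z.2.2 * \1_B z.1.2).
pose H (z : (T * U) * (T * U)) := (kT n z.1.1 z.2.1 * \1_A z.2.1) *
  (kU n z.1.2 z.2.2 * (\1_B z.1.2 - \1_B z.2.2) ^+ 2).
have mF : measurable_fun setT F.
  apply: measurable_funM; first exact: (@mTT (fun x y => kT n x y * (\1_A x - \1_A y) ^+ 2) mp1).
  exact: (@mUU (fun x y => kU n x y * \1_B x) mq1).
have mH : measurable_fun setT H.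
  apply: measurable_funM; first exact: (@mTT (fun x y => kT n x y * \1_A y) mq2).
  exact: (@mUU (fun x y => kU n x y * (\1_B x - \1_B y) ^+ 2) mp2).
have F0 z : 0 <= F z.
  by apply: mulr_ge0; [exact: (p10 (z.1.1, z.2.1))|exact: (q10 (z.1.2, z.2.2))].
have H0 z : 0 <= H z.
  by apply: mulr_ge0; [exact: (q20 (z.1.1, z.2.1))|exact: (p20 (z.1.2, z.2.2))].
rewrite -(integral2Z munu mF)// -(integral2Z munu mH)//.
rewrite -(@integral2D _ _ _ munu (fun z => 2 * F z) (fun z => 2 * H z)); last 4 first.
- exact: measurable_funM.
- exact: measurable_funM.
- by move=> z; rewrite mulr_ge0.
- by move=> z; rewrite mulr_ge0.
apply: (@le_integral2 _ _ _ munu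
  (fun z => k n z.1 z.2 * (\1_(A `*` B) z.1 - \1_(A `*` B) z.2) ^+ 2)
  (fun z => 2 * F z + 2 * H z)).
- by apply: mdiff; [exact: measurableX|exact: (sm_mk (sm n))].
- by apply: measurable_funD; exact: measurable_funM.
- by move=> z; rewrite mulr_ge0 ?sqr_ge0// (sm_k0 (sm n)).
- move=> z; rewrite /F /H /k.
  have iX (s : T * U) : \1_(A `*` B) s = \1_A s.1 * \1_B s.2 :> R.
    by rewrite !indicE in_setX -natrM mulnb.
  rewrite !iX; have kk0 : 0 <= kT n z.1.1 z.2.1 * kU n z.1.2 z.2.2.
    by rewrite mulr_ge0 ?(fk_k0 fT) ?(fk_k0 fU).
  rewrite [leRHS](_ : _ = kT n z.1.1 z.2.1 * kU n z.1.2 z.2.2 *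
    (2 * (\1_A z.1.1 - \1_A z.2.1) ^+ 2 * \1_B z.1.2 +
     2 * \1_A z.2.1 * (\1_B z.1.2 - \1_B z.2.2) ^+ 2)); last by ring.
  rewrite ler_wpM2l// !indicE.
  by case: (z.1.1 \in A); case: (z.2.1 \in A); case: (z.1.2 \in B);
    case: (z.2.2 \in B) => /=; lra.
Qed.

Lemma cvg_oscillation_rectangle (A : set T) (B : set U) : measurable A -> measurable B ->
  (mu A < +oo)%E -> (nu B < +oo)%E ->
  (fun n => oscillation munu (k n) \1_(A `*` B)) @ \oo --> 0%E.
Proof.
move=> mA mB Ay By.
have oA : (fun n => oscillation mu (kT n) \1_A) @ \oo --> 0%E.
  by apply: (fk_approx fT); [exact: measurable_indic|rewrite -/(sqint _ _) sqint_indic].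
have oB : (fun n => oscillation nu (kU n) \1_B) @ \oo --> 0%E.
  by apply: (fk_approx fU); [exact: measurable_indic|rewrite -/(sqint _ _) sqint_indic].
have fA : mu A \is a fin_num by rewrite ge0_fin_numE.
have fB : nu B \is a fin_num by rewrite ge0_fin_numE.
apply: (ge0_ecvg0_le _ (fun n => oscillation_rectangle n mA mB)).
  by move=> n; exact: (oscillation_ge0 (sm n)).
rewrite -(fineK fA) -(fineK fB).
apply: ge0_ecvg0D; apply: ge0_ecvg0Z; last exact: ge0_ecvg0Z.
by under eq_fun do rewrite muleC; exact: ge0_ecvg0Z.
Qed.

(** Most fields come from the two factors coordinate by coordinate. The approximation property does
    not factor for a general [h]; it is reduced to rectangles of finite measure by
    [cvg_oscillation]. *)
Lemma fourier_kernel_prod : fourier_kernel munu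
  (fun x y => dT x.1 y.1 + dU x.2 y.2) (cT * cU)
  (fun n x => wT n x.1 * wU n x.2) (fun n x y => kT n x.1 y.1 * kU n x.2 y.2).
Proof.
have mw n : measurable_fun setT (w n).
  apply: measurable_funM; first exact: (measurableT_comp (fk_mw fT n) measurable_fst).
  exact: (measurableT_comp (fk_mw fU n) measurable_snd).
have w0T := fk_w0 fT; have w0U := fk_w0 fU.
split.
- by move=> x y; rewrite (fk_dotC fT) (fk_dotC fU).
- by apply: measurable_funD; [exact: (mTT (fk_mdot fT))|exact: (mUU (fk_mdot fU))].
- by rewrite mulr_gt0 ?(fk_c fT) ?(fk_c fU).
- exact: mw.
- by move=> n x; rewrite mulr_ge0.
- by move=> n x; rewrite mulr_ile1// ?(fk_w1 fT) ?(fk_w1 fU).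
- move=> x m n mn; apply: ler_pM => //; [exact: (fk_wnd fT)|exact: (fk_wnd fU)].
- move=> x; rewrite -[X in _ --> X]mulr1; apply: cvgM; [exact: (fk_wcvg fT)|exact: (fk_wcvg fU)].
- move=> n; have [||+ _] := @cintegrable_prod _ _ _ _ _ mu nu
    (fun x => real_complex R (wT n x)) (fun x => real_complex R (wU n x)).
  + by split; [exact: (fk_wint fT)|exact: integrable0].
  + by split; [exact: (fk_wint fU)|exact: integrable0].
  by apply: eq_integrable => // z _; rewrite /= mulr0 subr0.
- by move=> n x y; exact: (sm_k0 (sm n)).
- by move=> n x y; exact: (sm_kC (sm n)).
- by move=> n; exact: (sm_mk (sm n)).
- by move=> n; exact: (sm_kint (sm n)).
- move=> n; have [M hM] := fk_kbd fT n; have [N hN] := fk_kbd fU n.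
  exists (M * N) => x y; apply: ler_pM => //; [exact: (fk_k0 fT)|exact: (fk_k0 fU)].
- move=> n x y.
  have -> : real_complex R (cT * cU * (kT n x.1 y.1 * kU n x.2 y.2)) =
      real_complex R (cT * kT n x.1 y.1) * real_complex R (cU * kU n x.2 y.2).
    by rewrite -[RHS]rmorphM /=; congr (real_complex R _); ring.
  rewrite -(fk_FT fT) -(fk_FT fU) -(cintegral_prod (mu := mu) (nu := nu)).
  + congr cintegral; apply/funext => s; rewrite opprD !expiD.
    rewrite (_ : real_complex R (wT n s.1 * wU n s.2) =
      real_complex R (wT n s.1) * real_complex R (wU n s.2)); last exact: rmorphM.
    ring.
  + apply: (@cintegrable_bounded _ _ _ _ 1).
    * apply: cmeasurableM; apply: cmeasurable_expi.
        exact: (measurableT_comp (fk_mdot fT) (measurable_pair2 _)).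
      apply: measurableT_comp => //.
      exact: (measurableT_comp (fk_mdot fT) (measurable_pair2 _)).
    * by split; [exact: (fk_wint fT)|exact: integrable0].
    * by move=> s; rewrite Normc.normcM !normc_expi mulr1.
  + apply: (@cintegrable_bounded _ _ _ _ 1).
    * apply: cmeasurableM; apply: cmeasurable_expi.
        exact: (measurableT_comp (fk_mdot fU) (measurable_pair2 _)).
      apply: measurableT_comp => //.
      exact: (measurableT_comp (fk_mdot fU) (measurable_pair2 _)).
    * by split; [exact: (fk_wint fU)|exact: integrable0].
    * by move=> s; rewrite Normc.normcM !normc_expi mulr1.
- move=> h mh h2.
  have [F [G [FG ndFG FGT]]] := rectangle_exhaustion mu nu.
  apply: (cvg_oscillation (mu := munu) (k := k) sm
    (@measurable_prod_measurableType _ _ T U) (@setI_closed_rectangle _ _ T U)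
    (B := fun n => F n `*` G n) _ ndFG FGT _ _ _ mh h2).
  + by move=> n; have [? ? _ _] := FG n; exact: measurableX.
  + by move=> n; have [? ? ? ?] := FG n; exact: product_measure_fin.
  + move=> m _ [A mA [B mB <-]]; have [mF mG Foo Goo] := FG m.
    rewrite -setXI; apply: cvg_oscillation_rectangle; try exact: measurableI.
    * by apply: le_lt_trans Foo; apply: le_measure; rewrite ?inE//; exact: measurableI.
    * by apply: le_lt_trans Goo; apply: le_measure; rewrite ?inE//; exact: measurableI.
  + by move=> m; have [? ? ? ?] := FG m; exact: cvg_oscillation_rectangle.
Qed.

End product_kernel.

Lemma fourier_kernel_poisson2 (R : realType) :
  exists w k, fourier_kernel (product_sigma_finite (@lebesgue_measure R) (@lebesgue_measure R))
    (@dot2 R)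
    ((pi *+ 2) * (pi *+ 2)) w k.
Proof.
by have := fourier_kernel_prod (@fourier_kernel_poisson R) (@fourier_kernel_poisson R);
  eexists; eexists; eassumption.
Qed.

(** * Polar coordinates *)

Section measure_transfer.
Local Open Scope ereal_scope.

Lemma ge0_integral_mrestr d (T : measurableType d) (R : realType)
    (mu : {measure set T -> \bar R}) (D : set T) (mD : measurable D)
    (f : T -> \bar R) : measurable_fun setT f -> (forall x, 0 <= f x) ->
  \int[mrestr mu mD]_x f x = \int[mu]_(x in D) f x.
Proof.
move=> mf f0; rewrite -(setUv D) ge0_integral_setU//; last 3 first.
- exact: measurableC.
- exact: measurable_funTS.
- exact/disj_setPCl.
rewrite (@eq_measure_integral _ _ _ D mu); last first.
  by move=> A mA AD /=; rewrite /mrestr setIidl.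
rewrite (@eq_measure_integral _ _ _ (~` D) mzero); last first.
  move=> A mA AD /=; rewrite /mrestr /mzero (_ : A `&` D = set0) ?measure0//.
  by apply/seteqP; split => // x [/AD].
by rewrite integral_measure_zero adde0.
Qed.

(* The measure with density [rho], pushed forward by [phi], is the image of
   the product measure restricted to the subgraph of [rho]. *)
Lemma density_image d d' (T : measurableType d) (U : measurableType d')
    (R : realType) (mu : {sigma_finite_measure set T -> \bar R})
    (rho : T -> R) (phi : T -> U) : measurable_fun setT rho ->
  (forall x, 0 <= rho x)%R -> measurable_fun setT phi ->
  exists nu : {measure set U -> \bar R}, forall f : U -> \bar R,
    measurable_fun setT f -> (forall y, 0 <= f y) ->
    \int[nu]_y f y = \int[mu]_x (f (phi x) * (rho x)%:E).
Proof.
move=> mrho rho0 mphi.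
pose S : set (T * measurableTypeR R) := [set z | (0 <= z.2)%R /\ (z.2 < rho z.1)%R].
have m1 : measurable_fun setT (fun z : T * measurableTypeR R => rho z.1).
  exact: (measurableT_comp mrho measurable_fst).
have mS : measurable S.
  have -> : S = [set z | (0 <= z.2)%R] `&` [set z | (z.2 < rho z.1)%R] by [].
  apply: measurableI.
    have mle : measurable_fun setT (fun z : T * measurableTypeR R => (0 <= z.2 :> R)%R).
      by apply: measurable_fun_ler => //; exact: measurable_snd.
    by have := mle measurableT [set true] I; rewrite setTI.
  have mlt : measurable_fun setT (fun z : T * measurableTypeR R => (z.2 < rho z.1 :> R)%R).
    by apply: measurable_fun_ltr => //; exact: measurable_snd.
  by have := mlt measurableT [set true] I; rewrite setTI.
have mp : measurable_fun setT (fun z : T * measurableTypeR R => phi z.1).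
  exact: (measurableT_comp mphi measurable_fst).
exists (image_measure (mrestr (mu \x @lebesgue_measure R) mS) mp) => f mf f0.
rewrite ge0_integral_pushforward// preimage_setT /=.
rewrite ge0_integral_mrestr//; last exact: (measurableT_comp mf mp).
rewrite integral_mkcond fubini_tonelli1 /fubini_F /=; last 2 first.
- apply/(measurable_restrictT _ mS)/measurable_funTS.
  exact: (measurableT_comp mf mp).
- by move=> z; rewrite patchE; case: ifP.
apply: eq_integral => x _.
have -> : (fun y => ((fun z : T * R => f (phi z.1)) \_ S) (x, y)) =
    (fun y => f (phi x) * (\1_(`[0%R, rho x[%classic : set R) y)%:E).
  apply/funext => y; rewrite patchE indicE.
  have -> : ((x, y) \in S) = (y \in (`[0%R, rho x[%classic : set R)).
    apply/idP/idP; rewrite !inE /S /= in_itv /=; first by move=> [-> ->].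
    by move=> /andP[].
  by case: (_ \in _); rewrite ?mule1 ?mule0.
have mind : measurable_fun setT
    (fun y : measurableTypeR R => (\1_(`[0%R, rho x[%classic : set R) y : R)%:E).
  by apply/measurable_EFinP; exact: measurable_indic.
rewrite (ge0_integralZl _ _ mind)//.
rewrite integral_indic// setIT.
congr (_ * _).
suff : lebesgue_measure (`[0%R, rho x[%classic : set R) = (rho x)%:E by [].
rewrite lebesgue_measure_itv /= lte_fin.
have [|] := ltP 0%R (rho x); first by rewrite sube0.
by move=> h; have /eqP -> : rho x == 0%R by rewrite eq_le h rho0.
Qed.

End measure_transfer.

(** * Substitution by the tangent *)

Section tangent_substitution.
Variable R : realType.
Local Notation mu := (@lebesgue_measure R).

(** [x / x^2] expresses the inverse through a real power of a nonnegative number; at 0 both sides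
    are 0. *)
Lemma measurable_invr : measurable_fun setT (fun x : R => x^-1).
Proof.
have -> : (fun x : R => x^-1) = (fun x => x * (x ^+ 2) `^ (-1)).
  apply/funext => x; have [->|x0] := eqVneq x 0; first by rewrite invr0 mul0r.
  by rewrite powR_inv1 ?sqr_ge0// expr2 invfM mulrA divff// mul1r.
apply: measurable_funM => //.
apply: (@measurableT_comp _ _ _ _ _ _ (fun y : R => y `^ (-1)) _ (fun x : R => x ^+ 2)) => //.
Qed.

Let I : set R := `](- (pi / 2)), (pi / 2)[%classic.

Let mcos : measurable_fun setT (@cos R).
Proof. by apply: continuous_measurable_fun; exact: continuous_cos. Qed.

Let msin : measurable_fun setT (@sin R).
Proof. by apply: continuous_measurable_fun; exact: continuous_sin. Qed.

Let minvcos : measurable_fun setT (fun t : R => (cos t)^-1).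
Proof. exact: (measurableT_comp measurable_invr mcos). Qed.

Lemma measurable_tan : measurable_fun setT (@tan R).
Proof. by apply: measurable_funM => //. Qed.

Let rho (t : R) : R := \1_I t * (cos t)^-1 ^+ 2.

Let mrho : measurable_fun setT rho.
Proof.
apply: measurable_funM; last by apply: measurable_funX; exact: minvcos.
by apply: measurable_indic; exact: measurable_itv.
Qed.

Let rho0 t : 0 <= rho t.
Proof. by rewrite mulr_ge0// sqr_ge0. Qed.

(** Within [I], the preimage of []a, b]] under [tan] is []atan a, atan b]], and there [tan] is a
    primitive of the density. *)
Let integral_sec2 (a b : R) : a < b ->
  (\int[mu]_t ((\1_(`]a, b]%classic : set R) (tan t))%:E * (rho t)%:E) = (b - a)%:E)%E.
Proof.
move=> ab; have aab := lt_atan ab.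
have atan_mono := leW_mono (@le_mono _ _ _ _ _ (@lt_atan R)).
have cos_atan0 x : 0 < cos (atan x).
  by rewrite cos_gt0_pihalf// atan_gtNpi2 atan_ltpi2.
have inI t : t \in `[atan a, atan b] -> t \in `](- (pi / 2)), (pi / 2)[.
  rewrite !in_itv /= => /andP[ta tb].
  by rewrite (lt_le_trans (atan_gtNpi2 a) ta) (le_lt_trans tb (atan_ltpi2 b)).
have cosN0 t : t \in `[atan a, atan b] -> cos t != 0.
  by move=> /inI; rewrite in_itv /= => h; rewrite gt_eqF// cos_gt0_pihalf.
transitivity (\int[mu]_(t in `]atan a, atan b]%classic) ((cos t)^-1 ^+ 2)%:E)%E.
  rewrite [RHS]integral_mkcond; apply: eq_integral => t _.
  rewrite patchE -EFinM /rho !indicE.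
  have [tI|tI] := boolP (t \in I); last first.
    rewrite mul0r mulr0 ifF//; apply/negbTE; apply: contra tI.
    rewrite !inE /I /= !in_itv /= => /andP[ta tb].
    by rewrite (lt_trans (atan_gtNpi2 a) ta) (le_lt_trans tb (atan_ltpi2 b)).
  rewrite mul1r; have tK : atan (tan t) = t by rewrite tanK//; move: tI; rewrite inE.
  have -> : (tan t \in (`]a, b]%classic : set R)) = (t \in (`]atan a, atan b]%classic : set R)).
    apply/idP/idP; rewrite !inE /= !in_itv /=.
      by rewrite -(atan_mono a) tK => /andP[-> tb]/=; rewrite -tK le_atan.
    rewrite -{1}tK atan_mono => /andP[-> tb] /=.
    by rewrite leNgt; apply/negP => bt; move: tb; rewrite leNgt -{1}tK (lt_atan bt).
  by case: ifP; rewrite ?mul1r ?mul0r.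
rewrite integral_itv_obnd_cbnd; last first.
  by apply/measurable_EFinP/measurable_funTS/measurable_funX.
have D t : t \in `[atan a, atan b] -> is_derive t (1 : R) (@tan R) ((cos t)^-1 ^+ 2).
  by move=> /cosN0 /is_derive_tan; rewrite exprVn.
have cT t : t \in `[atan a, atan b] -> {for t, continuous (@tan R)}.
  by move=> /D h; apply: differentiable_continuous; apply/derivable1_diffP; have [] := h.
rewrite (@continuous_FTC2 _ _ (@tan R))//.
- by rewrite !atanK EFinB.
- apply: continuous_in_subspaceT => t; rewrite inE => /cosN0 ct.
  by under eq_fun do rewrite expr2; apply: cvgM; apply: cvgV => //; exact: continuous_cos.
- split.
  + by move=> t /subset_itv_oo_cc/D[].
  + by apply: cvg_at_right_filter; apply: cT; rewrite in_itv /= lexx ltW.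
  + by apply: cvg_at_left_filter; apply: cT; rewrite in_itv /= lexx ltW.
- by move=> t /subset_itv_oo_cc/D[_ h]; rewrite derive1E h.
Qed.

(** The image under [tan] of the measure with density [rho] agrees with the Lebesgue measure on
    intervals, hence equals it. *)
Lemma ge0_integral_tan (f : R -> \bar R) : measurable_fun setT f ->
  (forall x, 0 <= f x)%E ->
  (\int[mu]_x f x = \int[mu]_(t in I) (f (tan t) * ((cos t)^-1 ^+ 2)%:E))%E.
Proof.
move=> mf f0.
have [nu nuE] := @density_image _ _ _ (measurableTypeR R) R mu rho (@tan R)
  mrho rho0 measurable_tan.
transitivity (\int[nu]_x f x)%E.
  apply: eq_measure_integral => A mA _; apply: lebesgue_measure_unique => // _ [[a b] _ <-].
  transitivity (\int[nu]_x (\1_(`]a, b]%classic : set R) x)%:E)%E; last first.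
    by rewrite integral_indic ?setIT.
  rewrite nuE//; last by apply/measurable_EFinP; exact: measurable_indic.
  have [ba|ab] := leP b a.
    rewrite [in RHS]set_itv_ge ?bnd_simp -?leNgt//.
    under [RHS]eq_integral do rewrite indic0 mul0e.
    rewrite integral0 lebesgue_measure_itv /= lte_fin ltNge ba//.
  by rewrite integral_sec2// lebesgue_measure_itv /= lte_fin ab EFinB.
rewrite nuE// [RHS]integral_mkcond; apply: eq_integral => t _.
by rewrite patchE /rho indicE; case: ifP; rewrite ?mul1r// mul0r mule0.
Qed.

End tangent_substitution.

(** * The plane in polar coordinates *)

Section polar_plane.
Variable R : realType.
Local Notation mu := (@lebesgue_measure R).
Local Notation RR := (measurableTypeR R * measurableTypeR R)%type.
Local Open Scope ereal_scope.

(** Domain restrictions are written as weights, here and in [pos_part], so that Tonelli and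
    substitutions run over the whole line. *)
Definition half_line (x : R) : \bar R := (\1_(`]0%R, +oo[%classic : set R) x)%:E.
Definition pos_part (x : R) : \bar R := (Num.max x 0)%:E.

Lemma half_line_ge0 x : 0 <= half_line x.
Proof. by rewrite lee_fin. Qed.

Lemma pos_part_ge0 x : 0 <= pos_part x.
Proof. by rewrite lee_fin le_max lexx orbT. Qed.

Lemma measurable_half_line : measurable_fun setT half_line.
Proof. by apply/measurable_EFinP; exact: measurable_indic. Qed.

Lemma measurable_pos_part : measurable_fun setT pos_part.
Proof. by apply/measurable_EFinP; exact: measurable_maxr. Qed.

Lemma half_lineE x : half_line x = if (0 < x)%R then 1 else 0.
Proof.
rewrite /half_line indicE; case: ifPn => x0.
  by rewrite mem_set//= in_itv/= x0.
by rewrite memNset//= in_itv/= andbT; exact/negP.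
Qed.

Lemma measurable_section1 (Phi : RR -> \bar R) x : measurable_fun setT Phi ->
  measurable_fun setT (fun y : measurableTypeR R => Phi (x, y)).
Proof. by move=> mPhi; exact: (measurableT_comp mPhi (measurable_pair1 x)). Qed.

(* Substitute y = x u, then x = s cos (atan u), then u = tan t. *)
Lemma polar_half_plane (Phi : RR -> \bar R) : measurable_fun setT Phi ->
  (forall z, 0 <= Phi z) ->
  \int[mu]_x (half_line x * \int[mu]_y Phi (x, y)) =
  \int[mu]_(t in `](- (pi / 2))%R, (pi / 2)%R[)
    \int[mu]_s (pos_part s * Phi (s * cos t, s * sin t)%R).
Proof.
move=> mPhi Phi0.
pose F (z : RR) := pos_part z.1 * Phi (z.1, z.1 * z.2)%R.
have mF : measurable_fun setT F.
  apply: emeasurable_funM; first exact: (measurableT_comp measurable_pos_part measurable_fst).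
  apply: (measurableT_comp mPhi); apply/measurable_fun_pair => //.
  by apply: measurable_funM; [exact: measurable_fst|exact: measurable_snd].
have F0 z : 0 <= F z by rewrite mule_ge0 ?pos_part_ge0.
pose G (z : RR) := pos_part z.2 * Phi (z.2 * cos z.1, z.2 * sin z.1)%R.
have mG : measurable_fun setT G.
  apply: emeasurable_funM; first exact: (measurableT_comp measurable_pos_part measurable_snd).
  apply: (measurableT_comp mPhi); apply/measurable_fun_pair => /=.
    apply: measurable_funM; first exact: measurable_snd.
    apply: measurableT_comp measurable_fst.
    by apply: continuous_measurable_fun; exact: continuous_cos.
  apply: measurable_funM; first exact: measurable_snd.
  apply: measurableT_comp measurable_fst.
  by apply: continuous_measurable_fun; exact: continuous_sin.
have G0 z : 0 <= G z by rewrite mule_ge0 ?pos_part_ge0.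
pose K t := \int[mu]_s G (t, s).
have mK : measurable_fun setT K.
  exact: (@measurable_fun_fubini_tonelli_F _ _ _ _ _ mu G).
have K0 t : 0 <= K t by apply: integral_ge0.
pose c (u : R) : R := cos (atan u).
have c0 u : (0 < c u)%R by rewrite cos_gt0_pihalf// atan_gtNpi2 atan_ltpi2.
have mc : measurable_fun setT c.
  apply: (@measurableT_comp _ _ _ _ _ _ (@cos R) _ (@atan R)).
    by apply: continuous_measurable_fun; exact: continuous_cos.
  by apply: continuous_measurable_fun; exact: continuous_atan.
have sE u : sin (atan u) = (c u * u)%R.
  rewrite /c -{3}(atanK u) /tan mulrCA mulfV ?mulr1//.
  by rewrite gt_eqF// -/(c u) c0.
transitivity (\int[mu]_x \int[mu]_u F (x, u)).
  apply: eq_integral => x _; rewrite half_lineE.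
  case: ifPn => [x0|]; last first.
    rewrite -leNgt => x0; rewrite mul0e (_ : (fun u => F (x, u)) = cst 0) ?integral0//.
    by apply/funext => u; rewrite /F /= /pos_part (max_idPr x0) mul0e.
  have mx := @measurable_section1 Phi x mPhi.
  rewrite mul1e (ge0_integral_affine 0 x0 mx)// -ge0_integralZl//.
  - apply: eq_integral => u _; rewrite /F /= /pos_part (max_idPl (ltW x0)).
    by rewrite addr0.
  - apply: (measurableT_comp mx).
    by apply: measurable_funD => //; exact: measurable_funM.
  - by rewrite lee_fin ltW.
rewrite (@fubini_tonelli _ _ _ _ _ mu mu F mF F0).
transitivity (\int[mu]_u ((c u ^+ 2)%:E * K (atan u))).
  apply: eq_integral => u _.
  have mFu : measurable_fun setT (fun x : measurableTypeR R => F (x, u)).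
    exact: (measurableT_comp mF (measurable_pair2 u)).
  rewrite (ge0_integral_affine 0 (c0 u) mFu)// /K.
  have mGu : measurable_fun setT (fun s : measurableTypeR R => G (atan u, s)).
    exact: (measurableT_comp mG (measurable_pair1 _)).
  rewrite expr2 EFinM -muleA; congr (_ * _).
  rewrite -ge0_integralZl//; last by rewrite lee_fin ltW.
  apply: eq_integral => s _; rewrite /F /G /= addr0 muleA; congr (_ * _).
    by rewrite /pos_part -EFinM maxr_pMr ?mulr0// ltW.
  by rewrite sE -/(c u) [(s * c u)%R]mulrC mulrCA mulrA.
rewrite ge0_integral_tan; last 2 first.
- apply: emeasurable_funM; first by apply/measurable_EFinP; exact: measurable_funX.
  apply: (measurableT_comp mK).
  by apply: continuous_measurable_fun; exact: continuous_atan.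
- by move=> u; rewrite mule_ge0 ?lee_fin ?sqr_ge0.
apply: eq_integral => t; rewrite inE /= => tI.
rewrite /c !(tanK tI) muleAC -EFinM -exprMn divff ?expr1n ?mul1e//.
by rewrite gt_eqF// cos_gt0_pihalf//; move: tI; rewrite in_itv.
Qed.

(** The left half-plane is carried to the right one by the reflection through the origin; the axis
    between them is a null set. *)
Lemma ge0_integral_plane (Phi : RR -> \bar R) : measurable_fun setT Phi ->
  (forall z, 0 <= Phi z) ->
  \int[mu]_x \int[mu]_y Phi (x, y) =
  \int[mu]_x (half_line x * \int[mu]_y Phi (x, y)) +
  \int[mu]_x (half_line x * \int[mu]_y Phi (- x, - y)%R).
Proof.
move=> mPhi Phi0; pose H x := \int[mu]_y Phi (x, y).
have mH : measurable_fun setT H.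
  exact: (@measurable_fun_fubini_tonelli_F _ _ _ _ _ mu Phi).
have H0 x : 0 <= H x by apply: integral_ge0.
have mhl := measurable_half_line.
have mhN : measurable_fun setT (fun x : measurableTypeR R => half_line (- x)).
  by apply: measurableT_comp => //; exact: oppr_measurable.
have m1 : measurable_fun setT (fun x => half_line x * H x) by exact: emeasurable_funM.
have m2 : measurable_fun setT (fun x : measurableTypeR R => half_line (- x) * H x) by exact: emeasurable_funM.
have -> : \int[mu]_x (half_line x * \int[mu]_y Phi (- x, - y)%R) =
    \int[mu]_x (half_line (- x) * H x).
  have p2 (x : R) : 0 <= half_line (- x) * H x by rewrite mule_ge0// half_line_ge0.
  rewrite [RHS](ge0_integral_opp m2 p2).
  apply: eq_integral => x _; rewrite opprK; congr (_ * _).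
  by rewrite /H [RHS]ge0_integral_opp//; exact: measurable_section1.
rewrite -ge0_integralD//; last 2 first.
- by move=> x _; apply: mule_ge0; [exact: half_line_ge0|exact: H0].
- by move=> x _; apply: mule_ge0; [exact: half_line_ge0|exact: H0].
apply: ae_eq_integral => //; first exact: emeasurable_funD.
exists [set 0%R]; split => //; first exact: lebesgue_measure_set1.
move=> x /=; apply: contra_notP => x0 _; rewrite !half_lineE oppr_gt0.
have [xn|xp|/esym//] := ltgtP x 0%R.
- by rewrite mul0e mul1e add0e.
- by rewrite mul0e mul1e adde0.
Qed.

End polar_plane.

(** * Arc length on the circle *)

Section circle_measure.
Variable R : realType.
Local Notation mu := (@lebesgue_measure R).
Local Open Scope ereal_scope.

Lemma circle_valK : injective (@circle_val R).
Proof. by move=> [u hu] [v hv] /= uv; exact: val_inj. Qed.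

Lemma measurable_circle_val : measurable_fun setT (@circle_val R).
Proof. by move=> _ B mB; exists B. Qed.

Lemma measurable_fun_circle d (T : measurableType d) (f : T -> circle R) :
  measurable_fun setT (@circle_val R \o f) -> measurable_fun setT f.
Proof.
move=> mf _ _ [B mB <-]; rewrite !setTI.
by have := mf measurableT _ mB; rewrite setTI.
Qed.

Lemma measurable_circle_opp : measurable_fun setT (@circle_opp R).
Proof.
apply: measurable_fun_circle; apply/measurable_fun_pair.
- have : measurable_fun setT (fun w : circle R => - (circle_val w).1)%R; last by [].
  apply: measurable_funN.
  exact: (measurableT_comp measurable_fst measurable_circle_val).
- have : measurable_fun setT (fun w : circle R => - (circle_val w).2)%R; last by [].
  apply: measurable_funN.
  exact: (measurableT_comp measurable_snd measurable_circle_val).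
Qed.

Lemma circle_oppK : involutive (@circle_opp R).
Proof.
by move=> [[a b] h]; apply: circle_valK; rewrite /circle_val /circle_opp /= !opprK.
Qed.

Lemma circle_paramDpi (t : R) : circle_param (t + pi)%R = circle_opp (circle_param t).
Proof. by apply: circle_valK; rewrite /circle_val /= cosDpi sinDpi. Qed.

Lemma circle_paramD2pi (t : R) : circle_param (t + pi *+ 2)%R = circle_param t.
Proof. by apply: circle_valK; rewrite /circle_val /= cosD2pi sinD2pi. Qed.

(** Arc length is defined by angles in [[0, 2 pi[], whereas the tangent substitution yields the
    angles of a half-turn around 0. Antipodes are shifts by [pi], and the angles in [](- (pi / 2)),
    0[] are moved to the last quarter by a shift of [2 pi]. *)
Lemma ge0_integral_arc (psi : circle R -> \bar R) : measurable_fun setT psi ->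
  (forall w, 0 <= psi w) ->
  \int[arc_length]_w psi w =
  \int[mu]_(t in `](- (pi / 2))%R, (pi / 2)%R[)
    (psi (circle_param t) + psi (circle_opp (circle_param t))).
Proof.
move=> mpsi psi0; pose f (t : measurableTypeR R) := psi (circle_param t).
have mf : measurable_fun setT f := measurableT_comp mpsi (@measurable_circle_param R).
have f0 t : 0 <= f t by exact: psi0.
(* Intervals become weights, so that each shift is an affine substitution over the whole line. *)
pose J (a b : itv_bound R) (t : measurableTypeR R) : \bar R :=
  (\1_([set` Interval a b] : set R) t)%:E.
have mJ a b : measurable_fun setT (J a b).
  by apply/measurable_EFinP; apply: measurable_indic; exact: measurable_itv.
have J0 a b t : 0 <= J a b t by rewrite lee_fin.
have JE a b t : J a b t = if t \in Interval a b then 1 else 0.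
  rewrite /J indicE; case: ifPn => h; first by rewrite mem_set.
  by rewrite memNset//; exact/negP.
have Jint a b (g : R -> \bar R) : (forall t, 0 <= g t) ->
    \int[mu]_(t in [set` Interval a b]) g t = \int[mu]_t (J a b t * g t).
  move=> g0; rewrite integral_mkcond; apply: eq_integral => t _.
  by rewrite patchE /J indicE; case: ifP; rewrite ?mul1e ?mul0e.
have mJf a b (g : measurableTypeR R -> \bar R) : measurable_fun setT g ->
    measurable_fun setT (fun t => J a b t * g t).
  by move=> mg; exact: emeasurable_funM.
have shift a : measurable_fun setT (fun t : measurableTypeR R => 1 * t + a)%R.
  by apply: measurable_funD => //; exact: measurable_funM.
have pi0 := pi_gt0 R.
have -> : \int[arc_length]_w psi w = \int[mu]_t (J (BLeft 0%R) (BLeft (pi *+ 2)%R) t * f t).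
  rewrite -Jint// -(@ge0_integral_mrestr _ _ _ mu _ (measurable_itv `[0%R, (pi *+ 2)%R[))//.
  have := @ge0_integral_pushforward _ _ _ _ _ _ (@measurable_circle_param R)
    (mrestr mu (measurable_itv `[0%R, (pi *+ 2)%R[)) setT psi measurableT mpsi.
  by rewrite preimage_setT; apply => y _; exact: psi0.
transitivity (\int[mu]_(t in `](- (pi / 2))%R, (pi / 2)%R]) (f t + f (t + pi)%R)); last first.
  rewrite -integral_itv_bndo_bndc; last first.
    apply: measurable_funTS; apply: emeasurable_funD => //; apply: (measurableT_comp mf).
    exact: measurable_funD.
  by apply: eq_integral => t _; rewrite /f circle_paramDpi.
have mfpi : measurable_fun setT (fun t : measurableTypeR R => f (t + pi)%R).
  by apply: (measurableT_comp mf); exact: measurable_funD.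
have D0 t : 0 <= f t + f (t + pi)%R by rewrite adde_ge0.
rewrite Jint//.
under [RHS]eq_integral do rewrite ge0_muleDr//.
rewrite ge0_integralD//; last 4 first.
- by move=> t _; rewrite mule_ge0.
- exact: mJf.
- by move=> t _; rewrite mule_ge0.
- exact: mJf.
set JA := J (BRight (- (pi / 2))%R) (BRight (pi / 2)%R).
have -> : \int[mu]_t (JA t * f (t + pi)%R) =
    \int[mu]_t (J (BRight (pi / 2)%R) (BRight (pi / 2 + pi)%R) t * f t).
  rewrite [RHS](@ge0_integral_affine _ 1 pi)//; [|exact: mJf|by move=> t; rewrite mule_ge0].
  rewrite mul1e; apply: eq_integral => t _; rewrite mul1r; congr (_ * _).
  rewrite /JA !JE !in_itv /= lerD2r; congr (if _ && _ then _ else _).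
  by rewrite -ltrBlDr; congr (_ < _)%R; lra.
have -> : \int[mu]_t (JA t * f t) =
    \int[mu]_t (J (BRight (- (pi / 2))%R) (BLeft 0%R) t * f t) +
    \int[mu]_t (J (BLeft 0%R) (BRight (pi / 2)%R) t * f t).
  rewrite -ge0_integralD//; last 4 first.
  - by move=> t _; rewrite mule_ge0.
  - exact: mJf.
  - by move=> t _; rewrite mule_ge0.
  - exact: mJf.
  apply: eq_integral => t _; rewrite -ge0_muleDl//; congr (_ * _).
  rewrite /JA !JE !in_itv /=.
  have [t0|t0] := ltP t 0%R; rewrite ?andbT ?andbF ?adde0 ?add0e /=.
    by rewrite (le_trans (ltW t0)) ?andbT// divr_ge0// ltW.
  by rewrite (lt_le_trans _ t0)//= oppr_lt0 divr_gt0.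
have -> : \int[mu]_t (J (BRight (- (pi / 2))%R) (BLeft 0%R) t * f t) =
    \int[mu]_t (J (BRight (pi / 2 + pi)%R) (BLeft (pi *+ 2)%R) t * f t).
  rewrite [RHS](@ge0_integral_affine _ 1 (pi *+ 2))//; [|exact: mJf|by move=> t; rewrite mule_ge0].
  rewrite mul1e; apply: eq_integral => t _; rewrite mul1r /f circle_paramD2pi; congr (_ * _).
  rewrite !JE !in_itv /=; congr (if _ && _ then _ else _).
    by move: (@pi R) => p; apply/idP/idP; rewrite [(p *+ 2)%R]mulr2n; lra.
  by move: (@pi R) => p; apply/idP/idP; rewrite [(p *+ 2)%R]mulr2n; lra.
rewrite -!ge0_integralD//; last 8 first.
all: try by move=> t _; rewrite ?adde_ge0// mule_ge0.
all: try exact: mJf.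
  by apply: emeasurable_funD; exact: mJf.
apply: eq_integral => t _; rewrite -!ge0_muleDl// ?adde_ge0//; congr (_ * _).
rewrite !JE !in_itv /= [(pi *+ 2)%R]mulr2n.
move: (@pi R) pi0 => p p0.
(* The intervals [[0, p / 2]], []p / 2, 3 p / 2]] and []3 p / 2, 2 p[] partition [[0, 2 p[]. *)
have [t1|t1] := ltP t 0%R.
  have -> : (p / 2 + p < t)%R = false by apply/negbTE; rewrite -leNgt; lra.
  have -> : (p / 2 < t)%R = false by apply/negbTE; rewrite -leNgt; lra.
  by rewrite /= !adde0.
have [t2|t2] := leP t (p / 2)%R.
  have -> : (t < p + p)%R by lra.
  have -> : (p / 2 + p < t)%R = false by apply/negbTE; rewrite -leNgt; lra.
  by rewrite /= ?add0e ?adde0.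
have [t3|t3] := leP t (p / 2 + p)%R.
  have -> : (t < p + p)%R by lra.
  by rewrite /= ?add0e ?adde0.
by rewrite /= ?adde0 ?add0e.
Qed.

Lemma ge0_integral_arc_opp (psi : circle R -> \bar R) : measurable_fun setT psi ->
  (forall w, 0 <= psi w) ->
  \int[arc_length]_w psi (circle_opp w) = \int[arc_length]_w psi w.
Proof.
move=> mpsi psi0; rewrite ge0_integral_arc//; last first.
  exact: (measurableT_comp mpsi measurable_circle_opp).
rewrite ge0_integral_arc//; apply: eq_integral => t _.
by rewrite circle_oppK addeC.
Qed.

End circle_measure.

(** * The cylinder, its reflection and polar points *)

Section cylinder.
Variable R : realType.
Local Notation mu := (@lebesgue_measure R).
Local Notation arc := (@arc_length R).
Local Notation RR := (measurableTypeR R * measurableTypeR R)%type.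
Local Notation cyl := (measurableTypeR R * circle R)%type.

(** [p] and [refl p] parametrise the same line of the plane, and on the spectral side the same
    point. *)
Definition refl (p : cyl) : cyl := (- p.1, circle_opp p.2).

Definition polar_point (p : cyl) : RR := (p.1 * (val p.2).1, p.1 * (val p.2).2).

Lemma measurable_refl : measurable_fun setT refl.
Proof.
apply/measurable_fun_pair.
- by apply: (measurableT_comp (@oppr_measurable R setT) measurable_fst).
- exact: (measurableT_comp (@measurable_circle_opp R) measurable_snd).
Qed.

Lemma measurable_polar_point : measurable_fun setT polar_point.
Proof.
have m : measurable_fun setT (fun p : cyl => circle_val p.2).
  exact: (measurableT_comp (@measurable_circle_val R) measurable_snd).
apply/measurable_fun_pair.
- apply: measurable_funM; first exact: measurable_fst.
  exact: (measurableT_comp measurable_fst m).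
- apply: measurable_funM; first exact: measurable_fst.
  exact: (measurableT_comp measurable_snd m).
Qed.

Lemma polar_point_refl p : polar_point (refl p) = polar_point p.
Proof. by case: p => s [[a b] h]; rewrite /polar_point /refl /= !mulrNN. Qed.

Section integrals.
Local Open Scope ereal_scope.

Lemma measurable_cylinder_integral (psi : cyl -> \bar R) :
  measurable_fun setT psi -> (forall p, 0 <= psi p) ->
  measurable_fun setT (fun w => \int[mu]_s psi (s, w)).
Proof.
by move=> mpsi psi0; exact: (@measurable_fun_fubini_tonelli_G _ _ _ _ _ mu psi).
Qed.

Lemma ge0_integral_cylinder (psi : cyl -> \bar R) : measurable_fun setT psi ->
  (forall p, 0 <= psi p) ->
  \int[cylinder_measure R]_p psi p = \int[arc]_w \int[mu]_s psi (s, w).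
Proof. by move=> mpsi psi0; rewrite -fubini_tonelli2. Qed.

Lemma ge0_integral_refl (psi : cyl -> \bar R) : measurable_fun setT psi ->
  (forall p, 0 <= psi p) ->
  \int[cylinder_measure R]_p psi (refl p) = \int[cylinder_measure R]_p psi p.
Proof.
move=> mpsi psi0; rewrite !ge0_integral_cylinder//; last first.
  exact: (measurableT_comp mpsi measurable_refl).
rewrite -[RHS]ge0_integral_arc_opp//.
- apply: eq_integral => w _; rewrite /refl [RHS]ge0_integral_opp//.
  exact: (measurableT_comp mpsi (measurable_pair2 _)).
- exact: measurable_cylinder_integral.
- by move=> w; apply: integral_ge0.
Qed.

(** The right half-plane contributes the directions [circle_param t], the reflected left half-plane
    their antipodes; their sum is the integrand of [ge0_integral_arc]. *)
Lemma ge0_integral_polar (Phi : RR -> \bar R) : measurable_fun setT Phi ->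
  (forall z, 0 <= Phi z) ->
  \int[lebesgue_measure2 R]_z Phi z =
  \int[cylinder_measure R]_p (pos_part p.1 * Phi (polar_point p)).
Proof.
move=> mPhi Phi0.
have mP : measurable_fun setT (fun p : cyl => pos_part p.1 * Phi (polar_point p)).
  apply: emeasurable_funM; first exact: (measurableT_comp (@measurable_pos_part R) measurable_fst).
  exact: (measurableT_comp mPhi measurable_polar_point).
have P0 p : 0 <= pos_part p.1 * Phi (polar_point p) by rewrite mule_ge0 ?pos_part_ge0.
have mPhiN : measurable_fun setT (fun z : RR => Phi (- z.1, - z.2)%R).
  apply: (measurableT_comp mPhi); apply/measurable_fun_pair.
    exact: (measurableT_comp (@oppr_measurable R setT) measurable_fst).
  exact: (measurableT_comp (@oppr_measurable R setT) measurable_snd).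
rewrite ge0_integral_cylinder//.
transitivity (\int[mu]_x \int[mu]_y Phi (x, y)).
  exact: (fubini_tonelli1 Phi mPhi Phi0).
rewrite ge0_integral_plane//.
rewrite polar_half_plane// (@polar_half_plane _ (fun z => Phi (- z.1, - z.2)%R))//.
pose psi w := \int[mu]_s (pos_part s * Phi (polar_point (s, w))).
have mpsi : measurable_fun setT psi.
  exact: (measurable_cylinder_integral mP).
have psi0 w : 0 <= psi w by apply: integral_ge0 => s _; exact: (P0 (s, w)).
have m1 : measurable_fun setT (fun t => psi (circle_param t)).
  exact: (measurableT_comp mpsi (@measurable_circle_param R)).
have m2 : measurable_fun setT (fun t => psi (circle_opp (circle_param t))).
  apply: (measurableT_comp mpsi).
  exact: (measurableT_comp (@measurable_circle_opp R) (@measurable_circle_param R)).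
rewrite [RHS](ge0_integral_arc mpsi psi0) [RHS]ge0_integralD//; last 2 first.
- exact: measurable_funTS.
- exact: measurable_funTS.
congr (_ + _); apply: eq_integral => t _; apply: eq_integral => s _ //.
by rewrite /polar_point /= !mulrN.
Qed.

End integrals.

(** The reflection preserves the measure, by [ge0_integral_refl] for indicators. *)
Lemma ae_refl (P : cyl -> Prop) : {ae cylinder_measure R, forall p, P p} ->
  {ae cylinder_measure R, forall p, P (refl p)}.
Proof.
move=> [A [mA A0 PA]]; exists (refl @^-1` A); split.
- by rewrite -[X in measurable X]setTI; exact: measurable_refl.
- have mR : measurable (refl @^-1` A).
    by rewrite -[X in measurable X]setTI; exact: measurable_refl.
  have mi : measurable_fun setT (fun p : cyl => (\1_A p : R)%:E).
    by apply/measurable_EFinP; exact: measurable_indic.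
  have h := ge0_integral_refl mi (fun p => lee_tofin (ler0n _ _)).
  apply: etrans A0.
  have hA (B : set cyl) : measurable B ->
      (\int[cylinder_measure R]_p (\1_B p)%:E = cylinder_measure R B)%E.
    by move=> mB; rewrite integral_indic// setIT.
  by rewrite -(hA _ mR) -(hA _ mA) -h.
- by move=> p /= h; apply: PA.
Qed.

Lemma ae_radius_neq0 : {ae cylinder_measure R, forall p, p.1 != 0}.
Proof.
exists ([set 0] `*` setT); split.
- by apply: measurableX => //; exact: measurable_set1.
- have -> : cylinder_measure R ([set 0] `*` setT) = (mu [set (0%R : R)] * arc setT)%E.
    exact: (@product_measure1E _ _ _ _ _ mu arc).
  by rewrite lebesgue_measure_set1 mul0e.
- by move=> [s w] /= /negP; rewrite negbK => /eqP.
Qed.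

End cylinder.

(** * The Fourier transform along the lines of the cylinder *)

Section cylinder_fourier.
Variable R : realType.
Local Notation mu := (@lebesgue_measure R).
Local Notation arc := (@arc_length R).
Local Notation cyl := (measurableTypeR R * circle R)%type.
Local Notation RR := (measurableTypeR R * measurableTypeR R)%type.
Local Notation nu := (cylinder_measure R).
Local Notation c := (pi *+ 2 : R).
Let fk := @fourier_kernel_poisson R.

(** [polar F] is already invariant under [refl], so extending its half with nonnegative radius gives
    it back. *)
Lemma even_ext_polar (F : RR -> R[i]) : even_ext (polar F) = F \o @polar_point R.
Proof.
apply/funext => p; rewrite /even_ext /=; case: ifP => // _.
by rewrite -[RHS]/(F (polar_point p)) -polar_point_refl.
Qed.

(** The polar formula added to its own reflection: the positive parts of [s] and [- s] add up to
    [|s|], and the plane is covered twice. *)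
Lemma ge0_integral_abs_polar (Phi : RR -> \bar R) : measurable_fun setT Phi ->
  (forall z, 0 <= Phi z)%E ->
  (\int[nu]_p (`|p.1|%:E * Phi (polar_point p)) =
   2%:E * \int[lebesgue_measure2 R]_z Phi z)%E.
Proof.
move=> mPhi Phi0.
have mP : measurable_fun setT (fun p : cyl => pos_part p.1 * Phi (polar_point p))%E.
  apply: emeasurable_funM.
    exact: (measurableT_comp (@measurable_pos_part R) measurable_fst).
  exact: (measurableT_comp mPhi (@measurable_polar_point R)).
have P0 p : (0 <= pos_part p.1 * Phi (@polar_point R p))%E.
  by rewrite mule_ge0 ?pos_part_ge0.
have mPr : measurable_fun setT
    (fun p : cyl => pos_part (refl p).1 * Phi (polar_point (refl p)))%E.
  exact: (measurableT_comp mP (@measurable_refl R)).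
rewrite mule_natl mule2n ge0_integral_polar//.
rewrite -[X in (_ = _ + X)%E]ge0_integral_refl// -ge0_integralD//.
apply: eq_integral => p _; rewrite polar_point_refl -ge0_muleDl ?pos_part_ge0//.
congr (_ * _)%E; rewrite /pos_part /= -EFinD; congr (_%:E).
have [h|h|h] := ltgtP p.1 0.
- by rewrite (@max_l _ _ (- p.1)) ?oppr_ge0 ?ltW// ltr0_norm// add0r.
- by rewrite (@max_r _ _ (- p.1)) ?oppr_le0 ?ltW// gtr0_norm// addr0.
- by rewrite h oppr0 !maxxx normr0 addr0.
Qed.

(** For a null set [A] of the plane, [|s|] times the indicator of [A] at the polar point has
    integral 0, hence vanishes almost everywhere; and [s] is almost never 0. *)
Lemma ae_polar (P : RR -> Prop) : {ae lebesgue_measure2 R, forall z, P z} ->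
  {ae nu, forall p, P (polar_point p)}.
Proof.
move=> [A [mA A0 PA]].
have mi : measurable_fun setT (fun z : RR => (\1_A z : R)%:E).
  by apply/measurable_EFinP; exact: measurable_indic.
have h := ge0_integral_abs_polar mi (fun z => lee_tofin (ler0n _ _)).
have m : measurable_fun setT (fun p : cyl => `|p.1|%:E * (\1_A (polar_point p) : R)%:E)%E.
  apply: emeasurable_funM; last exact: (measurableT_comp mi (@measurable_polar_point R)).
  apply/measurable_EFinP; apply: (measurableT_comp _ measurable_fst).
  exact: normr_measurable.
have [+ _] := ae_eq_integral_abs nu measurableT m.
have -> : (\int[nu]_p abse (`|p.1|%:E * (\1_A (polar_point p) : R)%:E) = 0)%E.
  transitivity (\int[nu]_p (`|p.1|%:E * (\1_A (polar_point p) : R)%:E))%E.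
    by apply: eq_integral => p _; rewrite gee0_abs// mule_ge0// lee_fin ?ler0n.
  apply: (etrans h).
  have -> : (\int[lebesgue_measure2 R]_z (\1_A z)%:E = 0)%E.
    by apply: etrans A0; rewrite (integral_indic _ measurableT mA) setIT.
  by rewrite mule0.
move=> /(_ erefl) h0.
have := ae_radius_neq0 R; move: h0; apply: ae_imply2 => p /(_ I) hp p0.
apply: contrapT => nP; have Ap : A (polar_point p) by exact: PA.
move: hp; rewrite indicE mem_set//= mule1 => -[h1].
by move: p0; rewrite -normr_eq0 h1 eqxx.
Qed.

Lemma radius_polar_point p : dot2 (polar_point p) (polar_point p) = (p : cyl).1 ^+ 2.
Proof.
case: p => s [[a b] h]; rewrite /dot2 /polar_point /= -!expr2 !exprMn -mulrDr.
by rewrite /= in h; rewrite (eqP h) mulr1.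
Qed.

Lemma ball0_polar_point rho p : 0 < rho ->
  Defs.ball0 (@dot2 R) rho (polar_point p) <-> `|(p : cyl).1| < rho.
Proof. by move=> rho0; rewrite /Defs.ball0 /= radius_polar_point sqrtr_sqr. Qed.

(* Unqualified, [ball0] would be the one of mathcomp-analysis. *)
Definition annulus (r r' : R) : set RR := Defs.ball0 (@dot2 R) r' `\` Defs.ball0 (@dot2 R) r.

Lemma annulus_polar_point r r' p : 0 < r -> 0 < r' ->
  annulus r r' (polar_point p) <-> r <= `|(p : cyl).1| < r'.
Proof.
move=> r0 r'0; split.
  move=> [/(ball0_polar_point _ r'0) h1 h2]; rewrite h1 andbT leNgt.
  by apply/negP => h; apply: h2; apply/ball0_polar_point.
move=> /andP[h1 h2]; split; first exact/ball0_polar_point.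
by move/(ball0_polar_point _ r0); rewrite ltNge h1.
Qed.

Lemma N2_polar_bounds (r r' : R) (F : RR -> R[i]) : 0 < r -> 0 < r' -> cmeasurable F ->
  {ae lebesgue_measure2 R, forall z, (~` annulus r r') z -> F z = 0} ->
  (r%:E * N2 nu (F \o @polar_point R) <= 2%:E * N2 (lebesgue_measure2 R) F)%E /\
  (2%:E * N2 (lebesgue_measure2 R) F <= r'%:E * N2 nu (F \o @polar_point R))%E.
Proof.
move=> r0 r'0 mF F0.
have mH := cmeasurable_comp mF (@measurable_polar_point R).
have mn : measurable_fun setT (fun p : cyl => `|p.1|%:E).
  apply/measurable_EFinP; apply: (measurableT_comp _ measurable_fst).
  exact: normr_measurable.
have m := emeasurable_funM mn (emeasurable_sqn mH).
have H0 : {ae nu, forall p, ~ (r <= `|p.1| < r') -> F (polar_point p) = 0}.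
  have := ae_polar F0; apply: ae_imply => p hp h; apply: hp => ha.
  by apply: h; apply/(annulus_polar_point _ r0 r'0).
have s0 z : (0 <= (sqn (z : R[i]))%:E)%E by rewrite lee_fin sqn_ge0.
(* The middle term becomes the integral weighted by [|s|], which can be compared pointwise with both
   outer terms. *)
have <- : (\int[nu]_p (`|p.1|%:E * (sqn (F (polar_point p)))%:E) =
    2%:E * N2 (lebesgue_measure2 R) F)%E.
  exact: (ge0_integral_abs_polar (emeasurable_sqn mF) (fun z => s0 (F z))).
rewrite /N2 -!ge0_integralZl//; try exact: emeasurable_sqn; try exact: ltW.
split.
- apply: ae_ge0_le_integral => //.
  + by move=> p _; rewrite mule_ge0// lee_fin ltW.
  + by apply: measurable_funeM; exact: emeasurable_sqn.
  + by move=> p _; rewrite mule_ge0// lee_fin.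
  + move: H0; apply: ae_imply => p hp _ /=.
    have [h|h] := boolP (r <= `|p.1| < r'); last first.
      by rewrite hp ?sqn0 ?mule0//; exact/negP.
    by apply: lee_wpmul2r => //; rewrite lee_fin; case/andP: h.
- apply: ae_ge0_le_integral => //.
  + by move=> p _; rewrite mule_ge0// lee_fin.
  + by move=> p _; rewrite mule_ge0// lee_fin ltW.
  + by apply: measurable_funeM; exact: emeasurable_sqn.
  + move: H0; apply: ae_imply => p hp _ /=.
    have [h|h] := boolP (r <= `|p.1| < r'); last first.
      by rewrite hp ?sqn0 ?mule0//; exact/negP.
    by apply: lee_wpmul2r => //; rewrite lee_fin ltW//; case/andP: h.
Qed.

Lemma cmeasurable_fibre (g : cyl -> R[i]) w : cmeasurable g ->
  cmeasurable (fun s : measurableTypeR R => g (s, w)).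
Proof. by move=> mg; exact: (cmeasurable_comp mg (measurable_pair2 w)). Qed.

Lemma N2_fibre (g : cyl -> R[i]) : cmeasurable g ->
  (N2 nu g = \int[arc]_w N2 mu (fun s => g (s, w)))%E.
Proof.
move=> mg; rewrite /N2 (ge0_integral_cylinder (emeasurable_sqn mg))//.
by move=> p; rewrite lee_fin sqn_ge0.
Qed.

Lemma measurable_N2_fibre (g : cyl -> R[i]) : cmeasurable g ->
  measurable_fun setT (fun w => N2 mu (fun s => g (s, w))).
Proof.
move=> mg; apply: (measurable_cylinder_integral (emeasurable_sqn mg)) => p.
by rewrite lee_fin sqn_ge0.
Qed.

Lemma L2_fibre (g : cyl -> R[i]) : L2 nu g ->
  {ae arc, forall w, L2 mu (fun s => g (s, w))}.
Proof.
move=> /L2P[mg g2]; have : arc.-integrable setT (fun w => N2 mu (fun s => g (s, w))).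
  apply/integrableP; split; first exact: measurable_N2_fibre.
  under eq_integral do rewrite gee0_abs ?N2_ge0//.
  by rewrite -N2_fibre.
move=> /integrable_ae -/(_ measurableT); apply: ae_imply => w /(_ I) hw.
apply/L2P; split; first exact: cmeasurable_fibre.
by rewrite -ge0_fin_numE// N2_ge0.
Qed.

Lemma is_fourier_s_N2 (g h : cyl -> R[i]) : is_fourier_s g h ->
  N2 nu h = (c%:E * N2 nu g)%E.
Proof.
move=> [[mg _] [mh _] gh]; rewrite !N2_fibre// -ge0_integralZl//; last 3 first.
- exact: measurable_N2_fibre.
- by move=> w _; exact: N2_ge0.
- by rewrite lee_fin mulrn_wge0// pi_ge0.
apply: ae_eq_integral => //; first exact: measurable_N2_fibre.
  by apply: measurable_funeM; exact: measurable_N2_fibre.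
by move: gh; apply: ae_imply => w gh _; exact: (is_fourier_N2 fk gh).
Qed.

Lemma is_fourier_sD (a : R[i]) (g h g' h' : cyl -> R[i]) :
  is_fourier_s g h -> is_fourier_s g' h' ->
  is_fourier_s (fun p => a * g p + g' p) (fun p => a * h p + h' p).
Proof.
move=> [g2 h2 gh] [g'2 h'2 gh']; split.
- by apply: L2D => //; exact: L2Z.
- by apply: L2D => //; exact: L2Z.
- by move: gh gh'; apply: ae_imply2 => w ? ?; exact: (is_fourierD fk).
Qed.

Lemma is_fourier_sB (g h g' h' : cyl -> R[i]) :
  is_fourier_s g h -> is_fourier_s g' h' ->
  is_fourier_s (fun p => g p - g' p) (fun p => h p - h' p).
Proof.
move=> [g2 h2 gh] [g'2 h'2 gh']; split.
- exact: L2B.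
- exact: L2B.
- by move: gh gh'; apply: ae_imply2 => w ? ?; exact: (is_fourierB fk).
Qed.

(** A single integral with parameters [(s, w)]: this is what makes the inverse transform jointly
    measurable. *)
Definition inv_fourier_s (h : cyl -> R[i]) : cyl -> R[i] :=
  fun p => inv_fourier mu (@dot1 R) c (fun sigma => h (sigma, p.2)) p.1.

Lemma cmeasurable_inv_fourier_s h : cmeasurable h -> cmeasurable (inv_fourier_s h).
Proof.
move=> mh; apply: cmeasurableM; first exact: cmeasurable_cst.
apply: (@cmeasurable_cintegral _ _ cyl (measurableTypeR R) R mu
  (fun z : cyl * measurableTypeR R => h (z.2, z.1.2) * expi (dot1 z.1.1 z.2))).
apply: cmeasurableM.
  apply: (cmeasurable_comp mh); apply/measurable_fun_pair; first exact: measurable_snd.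
  exact: (measurableT_comp measurable_snd measurable_fst).
apply: cmeasurable_expi; apply: measurable_funM.
  exact: (measurableT_comp measurable_fst measurable_fst).
exact: measurable_snd.
Qed.

Lemma cintegrable_bounded_support (h : measurableTypeR R -> R[i]) (rho : R) :
  0 < rho -> L2 mu h -> (forall s, rho <= `|s| -> h s = 0) -> cintegrable mu h.
Proof.
move=> rho0 h2 h0.
pose A : set R := `[- rho, rho]%classic.
apply: (@cintegrable_support _ _ _ mu A) => //; first exact: measurable_itv.
- suff : (mu A < +oo)%E by [].
  by rewrite lebesgue_measure_itv /=; case: ifP => _; rewrite ltry.
- move=> s nA; apply: h0; rewrite leNgt; apply/negP => hs; apply: nA.
  by rewrite /A /= in_itv /= -ler_norml ltW.
Qed.

(** Almost every fibre of [h] is square integrable with bounded support, hence integrable, and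
    inversion holds on its line. Plancherel integrated over the directions shows that the result is
    square integrable on the cylinder. *)
Lemma is_fourier_s_inv (h : cyl -> R[i]) (rho : R) : 0 < rho -> L2 nu h ->
  (forall p, rho <= `|p.1| -> h p = 0) -> is_fourier_s (inv_fourier_s h) h.
Proof.
move=> rho0 h2 h0; have [mh hoo] := (L2P _ _).1 h2.
have mg := cmeasurable_inv_fourier_s mh.
have hf : {ae arc, forall w, L2 mu (fun s => h (s, w)) /\
    cintegrable mu (fun s => h (s, w))}.
  have := L2_fibre h2; apply: ae_imply => w hw; split => //.
  by apply: (cintegrable_bounded_support rho0 hw) => s hs; exact: h0.
split => //; last first.
  move: hf; apply: ae_imply => w [hw2 hw1].
  exact: (is_fourier_inv_fourier fk hw1 hw2).
apply/L2P; split => //.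
have -> : (N2 nu (inv_fourier_s h) = (c^-1)%:E * N2 nu h)%E.
  rewrite !N2_fibre// -ge0_integralZl//; last 3 first.
  - exact: measurable_N2_fibre.
  - by move=> w _; exact: N2_ge0.
  - by rewrite lee_fin invr_ge0 mulrn_wge0// pi_ge0.
  apply: ae_eq_integral => //; first exact: measurable_N2_fibre.
    by apply: measurable_funeM; exact: measurable_N2_fibre.
  by move: hf; apply: ae_imply => w [hw2 hw1] _; exact: (N2_inv_fourier fk hw1 hw2).
by rewrite lte_mul_pinfty// lee_fin invr_ge0 mulrn_wge0// pi_ge0.
Qed.

(** The substitution of [- x] for the integration variable absorbs the sign of [s] in the
    character. *)
Lemma inv_fourier_s_refl (h : cyl -> R[i]) : cmeasurable h ->
  inv_fourier_s h \o @refl R = inv_fourier_s (h \o @refl R).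
Proof.
move=> mh; apply/funext => -[s w]; rewrite /inv_fourier_s /inv_fourier /=; congr (_ * _).
rewrite [RHS]cintegral_opp; last first.
  apply: cmeasurableM.
    exact: (cmeasurable_fibre _ (cmeasurable_comp mh (@measurable_refl R))).
  by apply: cmeasurable_expi; apply: measurable_funM.
congr cintegral; apply/funext => x /=.
by rewrite /refl /= opprK /dot1 mulNr mulrN.
Qed.

End cylinder_fourier.

(** * Completeness of L^2 and density of tensor sums *)

Section riesz_fischer.
Context d (T : measurableType d) (R : realType).
Variable mu : {measure set T -> \bar R}.

(** Nested intervals: [2 * s * 2^-1 ^+ n] is the largest variation still possible after [n].
    Lowering or raising [a n] by it gives monotone sequences, so the limit comes with its error
    bound. *)
Lemma fast_cauchy_cvg (a : nat -> R) (s : R) :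
  (forall n, `|a n.+1 - a n| <= s * 2^-1 ^+ n) ->
  exists l, a @ \oo --> l /\ forall n, `|a n - l| <= 2 * s * 2^-1 ^+ n.
Proof.
move=> ha.
have s0 : 0 <= s by have := le_trans (normr_ge0 _) (ha 0%N); rewrite expr0 mulr1.
pose b n := a n - 2 * s * 2^-1 ^+ n; pose e n := a n + 2 * s * 2^-1 ^+ n.
have eps0 n : 0 <= 2 * s * (2^-1 : R) ^+ n by rewrite !mulr_ge0// exprn_ge0.
have step n : b n <= b n.+1 /\ e n.+1 <= e n.
  have := ha n; rewrite ler_norml /b /e exprS; move: (2^-1 ^+ n) => t /andP[h1 h2].
  by split; lra.
have ndb : nondecreasing_seq b by apply/nondecreasing_seqP => n; case: (step n).
have nie : nonincreasing_seq e by apply/nonincreasing_seqP => n; case: (step n).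
have be n m : b n <= e m.
  have : b (maxn n m) <= e (maxn n m) by rewrite /b /e; have := eps0 (maxn n m); lra.
  move=> h; apply: le_trans (ndb _ _ (leq_maxl n m)) _.
  by apply: le_trans h _; exact: nie (leq_maxr n m).
have cb : cvgn b.
  by apply: nondecreasing_is_cvgn => //; exists (e 0%N) => _ [n _ <-]; exact: be.
have bl n : b n <= limn b by exact: nondecreasing_cvgn_le.
have le n : limn b <= e n by apply: limr_le => //; near=> m; exact: be.
exists (limn b); split.
- have h : (fun n => b n + 2 * s * 2^-1 ^+ n) @ \oo --> limn b + 2 * s * 0.
    apply: cvgD => //; apply: cvgMr; apply: cvg_expr.
    by rewrite ger0_norm ?invr_ge0// invf_lt1// ltr1n.
  by move: h; rewrite mulr0 addr0; under eq_fun do rewrite /b subrK.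
- by move=> n; rewrite ler_distl; have := bl n; have := le n; rewrite /b /e => h1 h2; apply/andP; split; lra.
Unshelve. all: end_near. Qed.

Lemma sum_inv4_le n : \sum_(0 <= k < n) (4^-1 : R) ^+ k <= 2.
Proof.
suff : \sum_(0 <= k < n) (4^-1 : R) ^+ k <= 2 - 2 * 4^-1 ^+ n.
  by move=> h; apply: le_trans h _; rewrite gerBl mulr_ge0// exprn_ge0.
elim: n => [|n IH]; first by rewrite big_nil expr0 mulr1 subrr.
rewrite big_nat_recr//= exprS.
have := @exprn_ge0 R n 4^-1 ltac:(by []); move: (_ ^+ n) IH => t; lra.
Qed.

(** The rates are matched: since the squared norms of the increments are at most [16^-k], the sum
    [A] of the squared increments weighted by [4^k] has integral at most 2, and [sqrt A / 2^k] then
    bounds the k-th increment pointwise and is summable. *)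
Lemma L2_complete (v : nat -> T -> R[i]) : (forall n, L2 mu (v n)) ->
  (forall n, N2 mu (fun x => v n.+1 x - v n x)%R <= (16^-1 ^+ n)%:E)%E ->
  exists h, L2 mu h /\ (fun n => N2 mu (fun x => v n x - h x)%R) @ \oo --> 0%E.
Proof.
move=> v2 hv.
pose g k x : \bar R := ((4 ^+ k) * sqn (v k.+1 x - v k x))%:E.
have mv n : cmeasurable (v n) by case: (v2 n).
have mg k : measurable_fun setT (g k).
  apply/measurable_EFinP; apply: measurable_funM => //.
  by apply: measurable_sqn; exact: cmeasurableB.
have g0 k x : (0 <= g k x)%E by rewrite lee_fin mulr_ge0 ?sqn_ge0// exprn_ge0.
(* [A] bounds the k-th squared increment by [A / 4^k]; where [A] is infinite the
   bounds below are vacuous, so that no null set has to be removed. *)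
pose A x : \bar R := (\sum_(0 <= k <oo) g k x)%E.
have mA : measurable_fun setT A by exact: ge0_emeasurable_sum.
have A0 x : (0 <= A x)%E by exact: nneseries_ge0.
have gA k x : (g k x <= A x)%E.
  apply: le_trans (nneseries_lim_ge k.+1 (fun n _ _ => g0 n x)).
  by rewrite big_nat_recr//= leeDr// sume_ge0.
have intA : (\int[mu]_x A x <= 2%:E)%E.
  rewrite integral_nneseries//; apply: lime_le.
    by apply: is_cvg_nneseries => n _ _; apply: integral_ge0.
  apply: nearW => n; apply: le_trans (_ : _ <= (\sum_(0 <= k < n) (4^-1 : R) ^+ k)%:E)%E _.
    rewrite -sumEFin; apply: lee_sum => k _.
    rewrite /g; under eq_integral do rewrite EFinM.
    have mk := emeasurable_sqn (cmeasurableB (mv k.+1) (mv k)).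
    have k0 x : setT x -> (0 <= (sqn (v k.+1 x - v k x))%:E)%E by rewrite lee_fin sqn_ge0.
    rewrite (ge0_integralZl_EFin mu measurableT k0 mk (exprn_ge0 k (ler0n R 4))).
    have h4 : (0 <= (4 ^+ k : R)%:E)%E by rewrite lee_fin exprn_ge0.
    apply: le_trans (lee_wpmul2l h4 (hv k)) _.
    rewrite -EFinM lee_fin -exprMn; apply: lerXn2r => //; rewrite ?nnegrE ?mulr_ge0//; lra.
  by rewrite lee_fin sum_inv4_le.
have q4 n : ((2^-1 : R) ^+ n) ^+ 2 = 4^-1 ^+ n.
  by rewrite -exprM mulnC exprM; congr (_ ^+ _); rewrite exprVn -natrX.
pose E := [set x | (A x < +oo)%E].
have mE : measurable E.
  by rewrite -[E]setTI; apply: emeasurable_fun_infty_o.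
(* To be used for the real and the imaginary part. With the factor [\1_E], convergence holds at
   every point, so the limit is measurable. *)
have key (p : R[i] -> R) (pB : forall z w, p (z - w) = p z - p w)
    (psqn : forall z, p z ^+ 2 <= sqn z)
    (mp : forall n, measurable_fun setT (fun x => p (v n x))) :
  exists h : T -> R, measurable_fun setT h /\
    forall x, E x -> forall n, (p (v n x) - h x) ^+ 2 <= 4 * fine (A x) * 4^-1 ^+ n.
  have cv x : exists l, (fun n => \1_E x * p (v n x)) @ \oo --> l /\
      (E x -> forall n, (p (v n x) - l) ^+ 2 <= 4 * fine (A x) * 4^-1 ^+ n).
    have [Ex|nEx] := pselect (E x); last first.
      exists 0; split => //; rewrite indicE memNset//.
      by under eq_fun do rewrite mul0r; exact: cvg_cst.
    have fA : A x = (fine (A x))%:E by rewrite fineK// ge0_fin_numE.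
    have A0' : 0 <= fine (A x) by rewrite fine_ge0.
    have [n|l [cl hl]] := @fast_cauchy_cvg (fun n => p (v n x)) (Num.sqrt (fine (A x))).
      rewrite -ler_sqr ?nnegrE ?mulr_ge0 ?sqrtr_ge0 ?exprn_ge0//.
      rewrite -normrX ger0_norm ?sqr_ge0// exprMn sqr_sqrtr// -pB.
      apply: le_trans (psqn _) _.
      have := gA n x; rewrite fA lee_fin mulrC -ler_pdivlMr ?exprn_gt0// => h.
      by apply: le_trans h _; rewrite q4 exprVn.
    exists l; split.
      by rewrite indicE mem_set//; under eq_fun do rewrite mul1r.
    move=> _ n; have := hl n; rewrite -ler_sqr ?nnegrE ?mulr_ge0 ?sqrtr_ge0 ?exprn_ge0//.
    rewrite -normrX ger0_norm ?sqr_ge0// => h; apply: le_trans h _.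
    by rewrite !exprMn sqr_sqrtr// q4 -natrX.
  have [h hh] := choice cv; exists h; split; last by move=> x; case: (hh x).
  apply: (@measurable_fun_cvg _ _ _ _ (fun n x => \1_E x * p (v n x))) => [n|x _].
    by apply: measurable_funM.
  by case: (hh x).
have [h1 [mh1 h1P]] := key (@complex.Re R) (fun z w => ltac:(by rewrite !ReImE))
  (fun z => ltac:(by rewrite lerDl sqr_ge0)) (fun n => (mv n).1).
have [h2 [mh2 h2P]] := key (@complex.Im R) (fun z w => ltac:(by rewrite !ReImE))
  (fun z => ltac:(by rewrite lerDr sqr_ge0)) (fun n => (mv n).2).
pose h x := Complex (h1 x) (h2 x).
have mh : cmeasurable h by [].
(* Each part contributes [4 * A * 4^-n]; their sum is [8 * A * 4^-n], and the integral of [A] is at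
   most 2. *)
have hN n : (N2 mu (fun x => v n x - h x)%R <= (16 * 4^-1 ^+ n)%:E)%E.
  have e0 : 0 <= 8 * (4^-1 : R) ^+ n by rewrite mulr_ge0// exprn_ge0.
  apply: (@le_trans _ _ (\int[mu]_x ((8 * 4^-1 ^+ n)%:E * A x))%E).
    apply: ge0_le_integral => //.
    + by move=> x _; rewrite lee_fin sqn_ge0.
    + by apply: emeasurable_sqn; exact: cmeasurableB.
    + by apply: measurable_funeM.
    + move=> x _; have [Ex|] := boolP (A x < +oo)%E; last first.
        by rewrite -leNgt leye_eq => /eqP ->; rewrite gt0_muley ?leey//.
      rewrite -[A x]fineK ?ge0_fin_numE// -EFinM lee_fin /sqn !ReImE /=.
      by have := h1P x Ex n; have := h2P x Ex n; nra.
  rewrite ge0_integralZl_EFin//; apply: le_trans (lee_wpmul2l _ intA) _ => //.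
  by rewrite -EFinM lee_fin; lra.
have vh0 : (fun n => N2 mu (fun x => v n x - h x)%R) @ \oo --> 0%E.
  apply: (@ge0_ecvg0_le _ _ (fun n => (16 * 4^-1 ^+ n)%:E)) => //.
    by move=> n; exact: N2_ge0.
  rewrite -[0%E]/((0 : R)%:E); apply: cvg_EFin; first exact: nearW.
  rewrite -[X in _ --> X](mulr0 16); apply: cvgMr; apply: cvg_expr.
  by rewrite ger0_norm ?invr_ge0// invf_lt1// ltr1n.
exists h; split => //.
have d2 : L2 mu (fun x => v 0%N x - h x).
  by apply/L2P; split; [exact: cmeasurableB|exact: le_lt_trans (hN _) (ltry _)].
have -> : h = (fun x => v 0%N x - (v 0%N x - h x)) by apply/funext => x; rewrite subKr.
exact: L2B.
Qed.

End riesz_fischer.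

Section tensor_density.
Context d d' (T : measurableType d) (U : measurableType d') (R : realType).
Variable mu : {sigma_finite_measure set T -> \bar R}.
Variable nu : {sigma_finite_measure set U -> \bar R}.
Implicit Types g h : T * U -> R[i].

Lemma L2_tensor (a : T -> R[i]) (b : U -> R[i]) : L2 mu a -> L2 nu b ->
  L2 (mu \x nu)%E (fun z => a z.1 * b z.2).
Proof.
move=> /L2P[ma a2] /L2P[mb b2]; apply/L2P; split.
  apply: cmeasurableM.
    exact: (cmeasurable_comp ma measurable_fst).
  exact: (cmeasurable_comp mb measurable_snd).
rewrite /N2; under eq_integral do rewrite sqnM EFinM.
rewrite (@ge0_integral_prod _ _ _ _ _ mu nu (fun x => (sqn (a x))%:E) (fun y => (sqn (b y))%:E)).
- by rewrite lte_mul_pinfty ?N2_ge0// ge0_fin_numE ?N2_ge0.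
- exact: emeasurable_sqn.
- exact: emeasurable_sqn.
- by move=> x; rewrite lee_fin sqn_ge0.
- by move=> x; rewrite lee_fin sqn_ge0.
Qed.

Lemma L2_tensor_sum n (a : 'I_n -> T -> R[i]) (b : 'I_n -> U -> R[i]) :
  (forall i, L2 mu (a i) /\ L2 nu (b i)) -> L2 (mu \x nu)%E (tensor_sum a b).
Proof.
move=> ab; apply: L2_sum => i; have [? ?] := ab i; exact: L2_tensor.
Qed.

(** The closure of the tensor sums with arbitrary square integrable factors; band limits are imposed
    afterwards by [cut]. *)
Definition tensor_approximable h := forall eps : R, 0 < eps ->
  exists n (a : 'I_n -> T -> R[i]) (b : 'I_n -> U -> R[i]),
    (forall i, L2 mu (a i) /\ L2 nu (b i)) /\
    (N2 (mu \x nu)%E (fun z => h z - tensor_sum a b z)%R < eps%:E)%E.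

Lemma tensor_approximableD g h : cmeasurable g -> cmeasurable h ->
  tensor_approximable g -> tensor_approximable h ->
  tensor_approximable (fun z => g z + h z).
Proof.
move=> mg mh gV hV eps eps0; have e4 : 0 < eps / 4 by rewrite divr_gt0.
have [n [a [b [ab abN]]]] := gV _ e4; have [m [a' [b' [ab' abN']]]] := hV _ e4.
pose s T' (u : 'I_n -> T' -> R[i]) (v : 'I_m -> T' -> R[i]) (i : 'I_(n + m)) :=
  match fintype.split i with inl j => u j | inr j => v j end.
have sE T' u v j : (@s T' u v (lshift m j) = u j).
  by rewrite /s -/(unsplit (inl j)) unsplitK.
have sE' T' u v j : (@s T' u v (rshift n j) = v j).
  by rewrite /s -/(unsplit (inr j)) unsplitK.
exists (n + m)%N, (s _ a a'), (s _ b b'); split.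
  by move=> i; rewrite /s; case: (fintype.split i).
have -> : (fun z => g z + h z - tensor_sum (s _ a a') (s _ b b') z) =
    (fun z => (g z - tensor_sum a b z) + (h z - tensor_sum a' b' z)).
  apply/funext => z; rewrite /tensor_sum big_split_ord /=.
  under eq_bigr do rewrite !sE.
  under [X in _ - (_ + X)]eq_bigr do rewrite !sE'.
  by rewrite opprD addrACA.
have m1 : cmeasurable (fun z => g z - tensor_sum a b z).
  by apply: cmeasurableB => //; case: (L2_tensor_sum ab).
have m2 : cmeasurable (fun z => h z - tensor_sum a' b' z).
  by apply: cmeasurableB => //; case: (L2_tensor_sum ab').
apply: le_lt_trans (N2D_le _ m1 m2) _.
have -> : eps%:E = (2%:E * (eps / 4)%:E + 2%:E * (eps / 4)%:E)%E.
  by rewrite -!EFinM -EFinD; congr (_%:E); lra.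
by apply: lteD; rewrite lte_pmul2l.
Qed.

Lemma tensor_approximableZ (t : R[i]) h : cmeasurable h ->
  tensor_approximable h -> tensor_approximable (fun z => t * h z).
Proof.
move=> mh hV eps eps0.
(* [1 + sqn t] in place of [sqn t], so that the division is legitimate for [t = 0] as well. *)
have t0 : 0 < 1 + sqn t by rewrite ltr_wpDr// sqn_ge0.
have e0 : 0 < eps / (1 + sqn t) by rewrite divr_gt0.
have [n [a [b [ab abN]]]] := hV _ e0.
exists n, (fun i x => t * a i x), b; split.
  by move=> i; have [? ?] := ab i; split => //; exact: L2Z.
have -> : (fun z => t * h z - tensor_sum (fun i x => t * a i x) b z) =
    (fun z => t * (h z - tensor_sum a b z)).
  apply/funext => z; rewrite mulrBr /tensor_sum mulr_sumr.
  by congr (_ - _); apply: eq_bigr => i _; rewrite mulrA.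
rewrite N2Z; last by apply: cmeasurableB => //; case: (L2_tensor_sum ab).
apply: (@le_lt_trans _ _ ((1 + sqn t)%:E * N2 (mu \x nu)%E (fun z => h z - tensor_sum a b z)%R)%E).
  by apply: lee_wpmul2r; [exact: N2_ge0|rewrite lee_fin lerDr].
rewrite (_ : eps = (1 + sqn t) * (eps / (1 + sqn t))) ?EFinM ?lte_pmul2l//.
by rewrite mulrC divfK// gt_eqF.
Qed.

Lemma tensor_approximable_lim (v : nat -> T * U -> R[i]) h :
  (forall n, cmeasurable (v n)) -> cmeasurable h ->
  (forall n, tensor_approximable (v n)) ->
  (fun n => N2 (mu \x nu)%E (fun z => v n z - h z)%R) @ \oo --> 0%E ->
  tensor_approximable h.
Proof.
move=> mv mh Vv /ge0_ecvg0P vh eps eps0; have e4 : 0 < eps / 4 by rewrite divr_gt0.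
have [|N _ /(_ _ (leqnn N)) /= hN] := vh _ _ e4; first by move=> n; exact: N2_ge0.
have [n [a [b [ab abN]]]] := Vv N _ e4; exists n, a, b; split => //.
have mt : cmeasurable (tensor_sum a b) by case: (L2_tensor_sum ab).
have -> : (fun z => h z - tensor_sum a b z) =
    (fun z => - (v N z - h z) + (v N z - tensor_sum a b z)).
  by apply/funext => z; rewrite opprB addrA subrK.
apply: le_lt_trans (N2D_le _ _ _) _.
- by apply: cmeasurableN; exact: cmeasurableB.
- exact: cmeasurableB.
rewrite N2N; have -> : eps%:E = (2%:E * (eps / 4)%:E + 2%:E * (eps / 4)%:E)%E.
  by rewrite -!EFinM -EFinD; congr (_%:E); lra.
by apply: lteD; rewrite lte_pmul2l.
Qed.

Lemma tensor_approximable_rectangle (A : set T) (B : set U) :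
  measurable A -> measurable B -> (mu A < +oo)%E -> (nu B < +oo)%E ->
  tensor_approximable (fun z => real_complex R (\1_(A `*` B) z)).
Proof.
move=> mA mB Aoo Boo eps eps0.
exists 1%N, (fun _ x => real_complex R (\1_A x)), (fun _ y => real_complex R (\1_B y)).
split; first by move=> i; split; exact: L2_indic.
have -> : (fun z => real_complex R (\1_(A `*` B) z) - tensor_sum
    (fun (_ : 'I_1) x => real_complex R (\1_A x)) (fun _ y => real_complex R (\1_B y)) z) = fun=> 0.
  apply/funext => -[x y]; rewrite /tensor_sum big_ord1 -[real_complex R _ * _]rmorphM /=.
  rewrite !indicE -natrM mulnb in_setX /=; exact: subrr.
by rewrite /N2; under eq_integral do rewrite sqn0; rewrite integral0 lte_fin.
Qed.

(** The indicator of a rectangle is a single tensor and rectangles generate the product;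
    [square_integrable_density] then gives the real and the imaginary part. *)
Lemma L2_tensor_approximable h : L2 (mu \x nu)%E h -> tensor_approximable h.
Proof.
pose V (u : T * U -> R) := measurable_fun setT u /\
  tensor_approximable (fun z => real_complex R (u z)).
have VT u : measurable_fun setT u -> (sqint (mu \x nu)%E u < +oo)%E -> V u.
  move=> m2 u2.
  have [F [G [FG ndFG FGT]]] := rectangle_exhaustion mu nu.
  refine (square_integrable_density (V := V)
    (@measurable_prod_measurableType _ _ T U) (@setI_closed_rectangle _ _ T U)
    (B := fun n => F n `*` G n) _ ndFG FGT _ _ _ _ _ _ m2 u2).
  + by move=> n; have [? ? _ _] := FG n; exact: measurableX.
  + by move=> n; have [? ? ? ?] := FG n; exact: product_measure_fin.
  + move=> u' v [mu' Vu] [mv Vv]; split; first exact: measurable_funD.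
    have -> : (fun z => real_complex R (u' z + v z)) =
        (fun z => real_complex R (u' z) + real_complex R (v z)).
      by apply/funext => z; exact: rmorphD.
    by apply: tensor_approximableD => //; exact: cmeasurableR.
  + move=> a u' [mu' Vu]; split; first exact: measurable_funM.
    have -> : (fun z => real_complex R (a * u' z)) =
        (fun z => real_complex R a * real_complex R (u' z)).
      by apply/funext => z; exact: rmorphM.
    by apply: tensor_approximableZ => //; exact: cmeasurableR.
  + move=> v u' Vv mu' _ vu; split => //.
    have mv n : measurable_fun setT (v n) by case: (Vv n).
    apply: (@tensor_approximable_lim (fun n z => real_complex R (v n z))).
    * by move=> n; exact: cmeasurableR.
    * exact: cmeasurableR.
    * by move=> n; case: (Vv n).
    * suff -> : (fun n => N2 (mu \x nu)%E (fun z => real_complex R (v n z) - real_complex R (u' z))) =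
        (fun n => sqint (mu \x nu)%E (fun z => v n z - u' z)) by [].
      apply/funext => n; rewrite -N2R; congr N2; apply/funext => z.
      by rewrite -rmorphB.
  + move=> m _ [A mA [B mB <-]]; have [mF mG Foo Goo] := FG m.
    rewrite -setXI; split.
      by apply: measurable_indic; apply: measurableX; exact: measurableI.
    apply: tensor_approximable_rectangle; try exact: measurableI.
    * by apply: le_lt_trans Foo; apply: le_measure; rewrite ?inE//; exact: measurableI.
    * by apply: le_lt_trans Goo; apply: le_measure; rewrite ?inE//; exact: measurableI.
  + move=> m; have [mF mG Foo Goo] := FG m.
    split; first by apply: measurable_indic; exact: measurableX.
    exact: tensor_approximable_rectangle.
move=> h2; have [[m1 m2] _] := h2.
have [_ V1] := VT _ m1 (L2_Re (mu := product_sigma_finite mu nu) h2); have [_ V2] := VT _ m2 (L2_Im (mu := product_sigma_finite mu nu) h2).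
have -> : h = (fun z => real_complex R (complex.Re (h z)) +
    Complex 0 1 * real_complex R (complex.Im (h z))).
  by apply/funext => z; apply: complex_ext; rewrite !ReImE /=; ring.
have c1 := cmeasurableR m1; have c2 := cmeasurableR m2.
apply: tensor_approximableD => //; first exact: cmeasurableM (cmeasurable_cst _ _) c2.
exact: tensor_approximableZ.
Qed.

End tensor_density.

(** * The Radon transform of bandpass functions *)

(** It turns an inequality between squared norms into a continuity modulus; plane and cylinder will
    take the two roles in both orders. *)
Lemma L2norm_transfer (R : realType) d (T : measurableType d) d' (U : measurableType d')
    (mu : {measure set T -> \bar R}) (nu : {measure set U -> \bar R}) (A B eps : R) :
  0 < A -> 0 < B -> 0 < eps ->
  exists delta : R, 0 < delta /\ forall f g, (A%:E * N2 nu g <= B%:E * N2 mu f)%E ->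
    (L2norm mu f < delta%:E)%E -> (L2norm nu g < eps%:E)%E.
Proof.
(* The solution of [B * delta ^+ 2 = A * eps ^+ 2]. *)
move=> A0 B0 eps0; pose delta := Num.sqrt (eps ^+ 2 * (A / B)).
have d0 : 0 < eps ^+ 2 * (A / B) by rewrite mulr_gt0 ?exprn_gt0 ?divr_gt0.
exists delta; split; first by rewrite sqrtr_gt0.
move=> f g fg; rewrite !L2norm_ltE ?sqrtr_gt0// sqr_sqrtr ?ltW// => fd.
rewrite -(@lte_pmul2l _ A%:E)//; apply: le_lt_trans fg _.
rewrite -EFinM (_ : A * eps ^+ 2 = B * (eps ^+ 2 * (A / B))); last first.
  by field; rewrite gt_eqF.
by rewrite [X in (_ < X)%E]EFinM lte_pmul2l.
Qed.

Section bandpass_functions.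
Context d (T : measurableType d) (R : realType).
Variable mu : {sigma_finite_measure set T -> \bar R}.
Variables (dot : T -> T -> R) (c : R) (w : nat -> T -> R) (k : nat -> T -> T -> R).
Hypothesis fk : fourier_kernel mu dot c w k.
Variables r r' : R.
Local Notation shell := (Defs.ball0 dot r' `\` Defs.ball0 dot r).

Lemma measurable_ball0 rho : measurable (Defs.ball0 dot rho).
Proof.
have m : measurable_fun setT (fun x => Num.sqrt (dot x x)).
  apply: (measurableT_comp (f := @Num.sqrt R)).
    by apply: continuous_measurable_fun; exact: sqrt_continuous.
  exact: (measurableT_comp (fk_mdot fk)
    (measurable_fun_pair (@measurable_id _ T setT) (@measurable_id _ T setT))).
rewrite (_ : Defs.ball0 dot rho = (fun x => Num.sqrt (dot x x)) @^-1` `]-oo, rho[).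
  by rewrite -[X in measurable X]setTI; apply: m => //; exact: measurable_itv.
by apply/seteqP; split => x; rewrite /Defs.ball0 /= in_itv.
Qed.

Lemma measurable_shell : measurable shell.
Proof. by apply: measurableD; exact: measurable_ball0. Qed.

(** The given spectrum vanishes almost everywhere off the shell; cutting it changes a null set and
    makes the support condition hold at every point. *)
Lemma bandpass_spectrum f : bandpass mu dot r r' f ->
  exists F, is_fourier mu dot f F /\ forall xi, ~ shell xi -> F xi = 0.
Proof.
move=> [f2 [F [fF F0]]]; exists (cut shell F); split; last by move=> xi; exact: cut_out.
have [_ F2 _] := fF.
apply: (is_fourier_ae fk fF f2); first exact: (L2_cut measurable_shell).
  exact: aeW.
move: F0; apply: ae_imply => xi h _.
by have [?|?] := pselect (shell xi); [rewrite cut_in|rewrite cut_out//; exact: h].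
Qed.

Lemma bandpass_inv_fourier F : cintegrable mu F -> L2 mu F ->
  (forall xi, ~ shell xi -> F xi = 0) -> bandpass mu dot r r' (inv_fourier mu dot c F).
Proof.
move=> F1 F2 F0; have fF := is_fourier_inv_fourier fk F1 F2.
split; first by case: fF.
by exists F; split => //; apply: aeW => xi h; exact: F0.
Qed.

Lemma bandpassD (a : R[i]) f g : bandpass mu dot r r' f -> bandpass mu dot r r' g ->
  bandpass mu dot r r' (fun x => a * f x + g x).
Proof.
move=> [f2 [F [fF F0]]] [g2 [G [gG G0]]]; split; first by apply: L2D => //; exact: L2Z.
exists (fun x => a * F x + G x); split; first exact: (is_fourierD fk).
by move: F0 G0; apply: ae_imply2 => x hF hG h; rewrite hF// hG// mulr0 addr0.
Qed.

Lemma is_fourier0 : is_fourier mu dot (fun=> 0) (fun=> 0).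
Proof.
have h0 := @L2_cst0 _ T R mu.
have c0 : cintegrable mu (fun=> 0 : R[i]) by split; exact: integrable0.
apply: (is_fourier_ae fk (is_fourier_inv_fourier fk c0 h0)) => //; apply: aeW => x _ //.
rewrite /inv_fourier (_ : cintegral _ _ = 0) ?mulr0//.
under eq_fun do rewrite mul0r.
by rewrite /cintegral /Rintegral integral0.
Qed.

(** The form taken by a tensor sum on a fixed line [w], with [z i] for [b i w]. *)
Lemma is_fourier_sum n (z : 'I_n -> R[i]) (f F : 'I_n -> T -> R[i]) :
  (forall i, is_fourier mu dot (f i) (F i)) ->
  is_fourier mu dot (fun x => \sum_i f i x * z i) (fun x => \sum_i F i x * z i).
Proof.
elim: n z f F => [|n IH] z f F fF.
  have E (u : 'I_0 -> T -> R[i]) : (fun x => \sum_i u i x * z i) = fun=> 0.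
    by apply/funext => x; rewrite big_ord0.
  by rewrite !E; exact: is_fourier0.
have E (u : 'I_n.+1 -> T -> R[i]) : (fun x => \sum_i u i x * z i) =
    (fun x => z ord0 * u ord0 x + \sum_i u (lift ord0 i) x * z (lift ord0 i)).
  by apply/funext => x; rewrite big_ord_recl mulrC.
by rewrite !E; apply: (is_fourierD fk) => //; exact: IH.
Qed.

End bandpass_functions.

(** * Existence, bounds and uniqueness of the Radon transform *)

Section radon_bandpass.
Variable R : realType.
Local Notation mu := (@lebesgue_measure R).
Local Notation arc := (@arc_length R).
Local Notation cyl := (measurableTypeR R * circle R)%type.
Local Notation RR := (measurableTypeR R * measurableTypeR R)%type.
Local Notation nu := (cylinder_measure R).
Local Notation la2 := (lebesgue_measure2 R).
Local Notation c := (pi *+ 2 : R).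
Variables r r' : R.
Hypotheses (r0 : 0 < r) (r'0 : 0 < r').
Let fk := @fourier_kernel_poisson R.
Let c0 : 0 < c. Proof. by rewrite mulrn_wgt0// pi_gt0. Qed.

Lemma shell1P (s : R) :
  (Defs.ball0 (@dot1 R) r' `\` Defs.ball0 (@dot1 R) r) s <-> r <= `|s| < r'.
Proof.
rewrite /Defs.ball0 /dot1 /= -expr2 sqrtr_sqr; split.
  by move=> [h /negP]; rewrite -leNgt => ->.
by move=> /andP[h ->]; split => //; apply/negP; rewrite -leNgt.
Qed.

Lemma is_fourier_s_tensor_sum n (f F : 'I_n -> R -> R[i]) (b : 'I_n -> circle R -> R[i]) :
  (forall i, is_fourier mu (@dot1 R) (f i) (F i) /\ L2 arc (b i)) ->
  is_fourier_s (tensor_sum f b) (tensor_sum F b).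
Proof.
move=> fF; split.
- by apply: L2_tensor_sum => i; have [[? _ _] ?] := fF i.
- by apply: L2_tensor_sum => i; have [[_ ? _] ?] := fF i.
- by apply: aeW => w; exact: (is_fourier_sum fk (fun i => b i w) (fun i => (fF i).1)).
Qed.

Definition band : set cyl := [set p | r <= `|p.1| < r'].

Lemma measurable_band : measurable band.
Proof.
have -> : band = fst @^-1` (Defs.ball0 (@dot1 R) r' `\` Defs.ball0 (@dot1 R) r).
  by apply/seteqP; split => p /shell1P.
rewrite -[X in measurable X]setTI; apply: measurable_fst => //.
exact: (measurable_shell fk).
Qed.

Lemma is_fourier_s_band h : L2 nu h -> (forall p, ~ band p -> h p = 0) ->
  is_fourier_s (inv_fourier_s h) h.
Proof.
move=> h2 h0; apply: (is_fourier_s_inv r'0 h2) => p hp; apply: h0.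
by rewrite /band /= ltNge hp andbF.
Qed.

(** The band is a condition on the radius only, so cutting the first factors cuts the whole sum. *)
Lemma tensor_sum_cut n (a : 'I_n -> R -> R[i]) (b : 'I_n -> circle R -> R[i]) :
  tensor_sum (fun i => cut (Defs.ball0 (@dot1 R) r' `\` Defs.ball0 (@dot1 R) r) (a i)) b =
  cut band (tensor_sum a b).
Proof.
apply/funext => p; rewrite /tensor_sum /cut mulr_sumr; apply: eq_bigr => i _.
rewrite mulrA; congr (_ * _ * _); congr (real_complex R _); rewrite !indicE.
congr (_ %:R); congr nat_of_bool; apply/idP/idP; rewrite !inE => /shell1P //.
Qed.

(** The approximation is made on the spectral side: tensor sums close to [h] are cut to the band
    without loss, transformed back line by line, and Plancherel carries the estimate over. *)
Lemma hilbert_tensor_inv_fourier_s h : L2 nu h -> (forall p, ~ band p -> h p = 0) ->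
  hilbert_tensor mu arc (bandpass1 r r') (L2 arc) (inv_fourier_s h).
Proof.
move=> h2 h0; have gh := is_fourier_s_band h2 h0.
split; first by case: gh.
(* The threshold for the squared distance of the spectra, since Plancherel multiplies squared norms
   by [c]. *)
move=> eps eps0; have ce0 : 0 < c * eps ^+ 2 by rewrite mulr_gt0// exprn_gt0.
have [n [a [b [ab abN]]]] := L2_tensor_approximable h2 ce0.
pose S := Defs.ball0 (@dot1 R) r' `\` Defs.ball0 (@dot1 R) r.
pose A i := cut S (a i).
have A0 i s : ~ S s -> A i s = 0 by exact: cut_out.
have A2 i : L2 mu (A i) by have [? _] := ab i; exact: (L2_cut (measurable_shell fk _ _)).
have A1 i : cintegrable mu (A i).
  apply: (cintegrable_bounded_support r'0 (A2 i)) => s hs; apply: A0 => /shell1P.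
  by rewrite ltNge hs andbF.
exists n, (fun i => inv_fourier mu (@dot1 R) c (A i)), b; split.
  move=> i; split; last by case: (ab i).
  exact: (bandpass_inv_fourier fk (A1 i) (A2 i) (A0 i)).
have fA : is_fourier_s (tensor_sum (fun i => inv_fourier mu (@dot1 R) c (A i)) b) (tensor_sum A b).
  apply: is_fourier_s_tensor_sum => i; split; last by case: (ab i).
  exact: (is_fourier_inv_fourier fk (A1 i) (A2 i)).
have := is_fourier_s_N2 (is_fourier_sB gh fA) => N2E.
suff : (L2norm nu (fun p => inv_fourier_s h p -
    tensor_sum (fun i => inv_fourier mu (@dot1 R) c (A i)) b p)%R < eps%:E)%E by [].
rewrite L2norm_ltE// -(@lte_pmul2l _ c%:E)// -N2E -EFinM.
apply: le_lt_trans abN; rewrite tensor_sum_cut.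
apply: (N2_cutB _ measurable_band) => //; last by case: h2.
by case: (L2_tensor_sum ab).
Qed.

Lemma hilbert_tensor_ae g g' : cmeasurable g' -> g = g' %[ae nu] ->
  hilbert_tensor mu arc (bandpass1 r r') (L2 arc) g ->
  hilbert_tensor mu arc (bandpass1 r r') (L2 arc) g'.
Proof.
move=> mg' gg' [g2 h]; split; first exact: (L2_ae_eq mg' gg' g2).
move=> eps /h[n [a [b [ab lt]]]]; exists n, a, b; split => //.
apply: le_lt_trans lt; rewrite (L2norm_ae_eq (g := fun p => g p - tensor_sum a b p)) //.
- apply: cmeasurableB => //; have [] // : L2 (mu \x arc)%E (tensor_sum a b).
  by apply: L2_tensor_sum => i; have [[? _] ?] := ab i.
- apply: cmeasurableB; first by case: g2.
  have [] // : L2 (mu \x arc)%E (tensor_sum a b).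
  by apply: L2_tensor_sum => i; have [[? _] ?] := ab i.
- by move: gg'; apply: ae_imply => p gp _; rewrite /= gp.
Qed.

Lemma annulus_finite : (la2 (annulus r r') < +oo)%E.
Proof.
pose I : set R := `]- r', r'[%classic.
have mI : measurable (I : set (measurableTypeR R)) by exact: measurable_itv.
have Ioo : (mu I < +oo)%E.
  by rewrite lebesgue_measure_itv /=; case: ifP => _; rewrite ltry.
have [w [k fk2]] := fourier_kernel_poisson2 R.
apply: (@le_lt_trans _ _ (la2 (I `*` I))).
  apply: le_measure; rewrite ?inE.
  - exact: (measurable_shell fk2).
  - exact: measurableX.
  - have itv (x y : R) : Num.sqrt (x * x + y * y) < r' -> I x.
      move=> h; rewrite /I /= in_itv /= -ltr_norml; apply: le_lt_trans h.
      by rewrite -sqrtr_sqr ler_wsqrtr// expr2 lerDl -expr2 sqr_ge0.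
    move=> [x y] [h _]; split => /=; first exact: itv h.
    by apply: (itv y x); rewrite addrC.
exact: (@product_measure_fin _ _ _ _ _ mu mu).
Qed.

Lemma bandpass2_spectrum f : bandpass2 r r' f ->
  exists F, is_fourier la2 (@dot2 R) f F /\ forall xi, ~ annulus r r' xi -> F xi = 0.
Proof.
by have [w [k fk2]] := fourier_kernel_poisson2 R; exact: (bandpass_spectrum fk2).
Qed.

Lemma bandpass2_inv_fourier F : L2 la2 F -> (forall xi, ~ annulus r r' xi -> F xi = 0) ->
  let f := inv_fourier (product_sigma_finite mu mu) (@dot2 R) (c * c) F in
  bandpass2 r r' f /\ is_fourier la2 (@dot2 R) f F.
Proof.
have [w [k fk2]] := fourier_kernel_poisson2 R => F2 F0 f.
have F1 : cintegrable la2 F.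
  by apply: (cintegrable_support _ annulus_finite F2 F0); exact: (measurable_shell fk2).
by split; [exact: (bandpass_inv_fourier fk2)|exact: (is_fourier_inv_fourier fk2)].
Qed.

(** Here the inner radius matters: polar coordinates carry the weight [|s|], and it is [r <= |s|] on
    the support that gives square integrability with respect to [ds dw]. *)
Lemma polar_spectrum F : L2 la2 F -> (forall xi, ~ annulus r r' xi -> F xi = 0) ->
  L2 nu (F \o @polar_point R) /\ forall p, ~ band p -> F (polar_point p) = 0.
Proof.
move=> /L2P[mF F2] F0; split; last first.
  by move=> p np; apply: F0 => /(annulus_polar_point _ r0 r'0).
apply/L2P; split; first exact: (cmeasurable_comp mF (@measurable_polar_point R)).
have [h _] := N2_polar_bounds r0 r'0 mF (aeW la2 F0).
rewrite -(@lte_pmul2l _ r%:E)//; apply: le_lt_trans h _.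
by rewrite gt0_muley//; apply: lte_mul_pinfty.
Qed.

Lemma is_radon_exists f : bandpass2 r r' f -> exists F, [/\ cmeasurable F,
  is_radon f (inv_fourier_s (F \o @polar_point R)),
  L2 nu (F \o @polar_point R) & forall p, ~ band p -> F (polar_point p) = 0].
Proof.
move=> /bandpass2_spectrum[F [fF F0]]; have [_ F2 _] := fF.
have [h2 h0] := polar_spectrum F2 F0; exists F; split => //; first by case: F2.
exists F, (F \o @polar_point R); split => //; first exact: is_fourier_s_band.
by apply: aeW => p _; rewrite even_ext_polar.
Qed.

Lemma is_radonD (a : R[i]) f g f' g' : is_radon f g -> is_radon f' g' ->
  is_radon (fun x => a * f x + f' x) (fun p => a * g p + g' p).
Proof.
move=> [F [h [fF gh hF]]] [F' [h' [fF' gh' hF']]].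
exists (fun x => a * F x + F' x), (fun p => a * h p + h' p); split.
- by have [w [k fk2]] := fourier_kernel_poisson2 R; exact: (is_fourierD fk2).
- exact: is_fourier_sD.
- move: hF hF'; apply: ae_imply2 => p; rewrite !even_ext_polar => hp hp' _.
  by rewrite hp// hp'.
Qed.

(** [is_radon] provides some spectrum [F]; by uniqueness it agrees almost everywhere with one
    supported in the annulus, so [N2_polar_bounds] applies. Plancherel brings [c] on the lines and
    [c * c] on the plane. *)
Lemma is_radon_bounds f g : bandpass2 r r' f -> is_radon f g ->
  ((r * c)%:E * N2 nu g <= (2 * (c * c))%:E * N2 la2 f)%E /\
  ((2 * (c * c))%:E * N2 la2 f <= (r' * c)%:E * N2 nu g)%E.
Proof.
have [w [k fk2]] := fourier_kernel_poisson2 R.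
move=> /bandpass2_spectrum[F0 [fF0 F00]] [F [h [fF gh hF]]].
have [_ F2 _] := fF; have mF : cmeasurable F by case: F2.
have FF0 : F = F0 %[ae la2].
  by apply: (is_fourier_uniq fk2 fF fF0); exact: aeW.
have aF0 : {ae la2, forall z, (~` annulus r r') z -> F z = 0}.
  by move: FF0; apply: ae_imply => z -> // hz; exact: F00.
have [h1 h2] := N2_polar_bounds r0 r'0 mF aF0.
have E1 : N2 nu h = N2 nu (F \o @polar_point R).
  apply: N2_ae_eq; first by case: gh => _ [].
    exact: (cmeasurable_comp mF (@measurable_polar_point R)).
  by move: hF; rewrite even_ext_polar.
have E2 : N2 la2 F = ((c * c)%:E * N2 la2 f)%E := is_fourier_N2 fk2 fF.
move: h1 h2; rewrite -E1 (is_fourier_s_N2 gh) E2.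
by rewrite !muleA -!EFinM.
Qed.

Lemma is_radonB (f : RR -> R[i]) g f' g' : is_radon f g -> is_radon f' g' ->
  is_radon (f \- f') (g \- g').
Proof.
move=> fg fg'; have := is_radonD (-1) fg' fg.
have E U (u v : U -> R[i]) : (fun x => -1 * v x + u x) = u \- v.
  by apply/funext => x; rewrite mulN1r addrC.
by rewrite !E.
Qed.

Lemma bandpass2B (f f' : RR -> R[i]) : bandpass2 r r' f -> bandpass2 r r' f' -> bandpass2 r r' (f \- f').
Proof.
have [w [k fk2]] := fourier_kernel_poisson2 R => bf bf'.
have := bandpassD fk2 (-1) bf' bf.
suff -> : (fun x => -1 * f' x + f x) = f \- f' by [].
by apply/funext => x; rewrite mulN1r addrC.
Qed.

Lemma is_radon_measurable f (g : cyl -> R[i]) : is_radon f g -> cmeasurable g.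
Proof. by move=> [F [h [_ [[] ] ]]]. Qed.

(** The bounds applied to the difference: one squared norm vanishes exactly when the other does.
    Well-definedness, injectivity and uniqueness of the Radon transform all come from this
    equivalence. *)
Lemma is_radon_ae (f : RR -> R[i]) (g : cyl -> R[i]) f' g' : bandpass2 r r' f -> bandpass2 r r' f' ->
  is_radon f g -> is_radon f' g' -> f = f' %[ae la2] <-> g = g' %[ae nu].
Proof.
move=> bf bf' fg fg'.
have [h1 h2] := is_radon_bounds (bandpass2B bf bf') (is_radonB fg fg').
have mf : cmeasurable (f : RR -> R[i]) by case: bf => -[].
have mf' : cmeasurable (f' : RR -> R[i]) by case: bf' => -[].
have mg := is_radon_measurable fg; have mg' := is_radon_measurable fg'.
rewrite -(N2B_eq0 la2 mf mf') -(N2B_eq0 nu mg mg'); split => E.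
- move: h1; rewrite /= E mule0 => h1; apply/eqP; rewrite eq_le N2_ge0 andbT.
  by move: h1; rewrite pmule_rle0// lte_fin mulr_gt0.
- move: h2; rewrite /= E mule0 => h2; apply/eqP; rewrite eq_le N2_ge0 andbT.
  by move: h2; rewrite pmule_rle0// lte_fin !mulr_gt0.
Qed.

Lemma radonP f : bandpass2 r r' f -> is_radon f (radon f).
Proof.
move=> /is_radon_exists[F [_ h _ _]].
exact: (@xgetPex _ (fun=> 0) [set g | is_radon f g] (ex_intro _ _ h)).
Qed.

Lemma radon_uniq f g : bandpass2 r r' f -> is_radon f g -> g = radon f %[ae nu].
Proof.
by move=> bf fg; apply/(is_radon_ae bf bf fg (radonP bf)); exact: aeW.
Qed.

(** Both conditions are checked for the explicit inverse transform, which is even because [F] at the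
    polar point is invariant under [refl], and then transferred to [radon f], equal to it almost
    everywhere. *)
Lemma radon_bandpass_cylinder f : bandpass2 r r' f -> bandpass_cylinder r r' (radon f).
Proof.
move=> bf; have [F [mF fg h2 h0]] := is_radon_exists bf.
have fr := radonP bf; have E := radon_uniq bf fg; split.
  apply: (hilbert_tensor_ae (is_radon_measurable fr) E).
  exact: hilbert_tensor_inv_fourier_s.
have mh := cmeasurable_comp mF (@measurable_polar_point R).
(* Evenness compares the values at two points, so the equality is needed at almost every reflected
   point too. *)
have Erefl := ae_refl E.
move: E Erefl; apply: ae_imply2 => p /(_ I) <- /(_ I).
rewrite -[X in _ = X]/(radon f (refl p)) => hr.
have -> : radon f (- p.1, circle_opp p.2) = radon f (refl p) by [].
rewrite -hr -[LHS]/((inv_fourier_s (F \o @polar_point R) \o @refl R) p).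
rewrite inv_fourier_s_refl//; congr (inv_fourier_s _ p).
by apply/funext => q /=; rewrite polar_point_refl.
Qed.

End radon_bandpass.

(** * Surjectivity *)

Section radon_onto.
Variable R : realType.
Local Notation mu := (@lebesgue_measure R).
Local Notation arc := (@arc_length R).
Local Notation cyl := (measurableTypeR R * circle R)%type.
Local Notation RR := (measurableTypeR R * measurableTypeR R)%type.
Local Notation nu := (cylinder_measure R).
Local Notation la2 := (lebesgue_measure2 R).
Local Notation c := (pi *+ 2 : R).
Variables r r' : R.
Hypotheses (r0 : 0 < r) (r'0 : 0 < r').
Let fk := @fourier_kernel_poisson R.
Let c0 : 0 < c. Proof. by rewrite mulrn_wgt0// pi_gt0. Qed.
Local Notation band := (@band R r r').

Lemma tensor_sum_spectrum n (f : 'I_n -> R -> R[i]) (b : 'I_n -> circle R -> R[i]) :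
  (forall i, bandpass1 r r' (f i) /\ L2 arc (b i)) ->
  exists h, is_fourier_s (tensor_sum f b) h /\ forall p, ~ band p -> h p = 0.
Proof.
move=> fb; have /choice[F hF] : forall i, exists F, is_fourier mu (@dot1 R) (f i) F /\
    forall s, ~ (Defs.ball0 (@dot1 R) r' `\` Defs.ball0 (@dot1 R) r) s -> F s = 0.
  by move=> i; have [bf _] := fb i; exact: (bandpass_spectrum fk bf).
exists (tensor_sum F b); split.
  by apply: is_fourier_s_tensor_sum => i; have [? _] := hF i; have [_ ?] := fb i.
move=> p np; rewrite /tensor_sum big1// => i _.
by have [_ ->] := hF i; [rewrite mul0r|move/shell1P].
Qed.

(** [g] itself is never transformed: the inverse transform of the limiting spectrum and [g] are
    limits in L^2 of the same tensor sums, hence equal almost everywhere. *)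
Lemma hilbert_tensor_spectrum g :
  hilbert_tensor mu arc (bandpass1 r r') (L2 arc) g ->
  exists h, [/\ L2 nu h, forall p, ~ band p -> h p = 0 & inv_fourier_s h = g %[ae nu]].
Proof.
(* [e] is such that [c * (2 * e n.+1 + 2 * e n) <= 16^-n], as [L2_complete] requires. *)
move=> [g2 hg]; pose e n : R := 16^-1 ^+ n / (4 * c).
have e0 n : 0 < e n by rewrite divr_gt0 ?mulr_gt0// exprn_gt0// invr_gt0.
have /choice[t /choice[T ht]] : forall n, exists t T, [/\ is_fourier_s t T,
    forall p, ~ band p -> T p = 0 & (N2 nu (fun p => g p - t p)%R < (e n)%:E)%E].
  move=> n; have [|m [a [b [ab lt]]]] := hg (Num.sqrt (e n)); first by rewrite sqrtr_gt0.
  have [h [fh h0]] := tensor_sum_spectrum ab.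
  exists (tensor_sum a b), h; split => //.
  by move: lt; rewrite L2norm_ltE ?sqrtr_gt0// sqr_sqrtr// ltW.
have mg : cmeasurable g by case: g2.
have t2 n : L2 nu (t n) by have [[]] := ht n.
have mt n : cmeasurable (t n) by case: (t2 n).
have T2 n : L2 nu (T n) by have [[]] := ht n.
have mT n : cmeasurable (T n) by case: (T2 n).
have tg n : (N2 nu (fun p => t n p - g p)%R < (e n)%:E)%E.
  have [_ _] := ht n; rewrite -N2N; congr (_ < _)%E; congr N2.
  by apply/funext => p; rewrite opprB.
have step n : (N2 nu (fun p => T n.+1 p - T n p)%R <= (16^-1 ^+ n)%:E)%E.
  have [f1 _ _] := ht n.+1; have [f2 _ lt2] := ht n.
  rewrite (is_fourier_s_N2 (is_fourier_sB f1 f2)).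
  have -> : (fun p => t n.+1 p - t n p) = (fun p => (t n.+1 p - g p) + (g p - t n p)).
    by apply/funext => p; rewrite addrA subrK.
  have h := N2D_le nu (cmeasurableB (mt n.+1) mg) (cmeasurableB mg (mt n)).
  have cE : (0 <= c%:E)%E by rewrite lee_fin ltW.
  apply: le_trans (lee_wpmul2l cE h) _.
  have h2 : (2%:E * N2 nu (fun p => t n.+1 p - g p)%R +
      2%:E * N2 nu (fun p => g p - t n p)%R <= (2 * e n.+1 + 2 * e n)%:E)%E.
    rewrite [leRHS]EFinD [X in (_ <= X + _)%E]EFinM [X in (_ <= _ + X)%E]EFinM.
    have hn : (N2 nu (fun p => g p - t n p)%R <= (e n)%:E)%E by exact: ltW.
    by apply: leeD; apply: lee_wpmul2l => //; exact: ltW.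
  apply: le_trans (lee_wpmul2l cE h2) _; rewrite -EFinM lee_fin /e exprS.
  have := @exprn_ge0 R n 16^-1 ltac:(by []); move: (16^-1 ^+ n) (c) c0 => x y y0 x0.
  rewrite (_ : y * _ = (16^-1 * x + x) / 2); last by field; rewrite gt_eqF.
  by lra.
have [H0 [H02 TH0]] := L2_complete T2 step.
have mH0 : cmeasurable H0 by case: H02.
have mB := @measurable_band R r r'.
(* A limit of spectra supported in the band has this support up to a null set; cutting restores it
   pointwise and does not increase the distances to the [T n]. *)
have H2 := L2_cut mB H02.
have H0band p : ~ band p -> cut band H0 p = 0 by exact: cut_out.
exists (cut band H0); split => //.
have fH := is_fourier_s_band r'0 H2 H0band.
have [G2 _ _] := fH.
have tG : (fun n => N2 nu (fun p => t n p - inv_fourier_s (cut band H0) p)%R) @ \oo --> 0%E.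
  apply: (@ge0_ecvg0_le _ _ (fun n => (c^-1)%:E * N2 nu (fun p => T n p - H0 p)%R)%E).
  - by move=> n; exact: N2_ge0.
  - move=> n; have [f1 T0 _] := ht n.
    rewrite -(@lee_pmul2l _ c%:E)// -(is_fourier_s_N2 (is_fourier_sB f1 fH)).
    rewrite muleA -EFinM divff ?gt_eqF// mul1e.
    exact: (N2_cutB _ mB mH0 (mT n) T0).
  - exact: ge0_ecvg0Z.
have tgl : (fun n => N2 nu (fun p => t n p - g p)%R) @ \oo --> 0%E.
  apply: (@ge0_ecvg0_le _ _ (fun n => ((4 * c)^-1)%:E * (16^-1 ^+ n)%:E)%E).
  - by move=> n; exact: N2_ge0.
  - by move=> n; rewrite -EFinM mulrC ltW//; exact: tg.
  - apply: ge0_ecvg0Z; rewrite -[0%E]/((0 : R)%:E); apply: cvg_EFin; first exact: nearW.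
    by apply: cvg_expr; rewrite ger0_norm ?invr_ge0// invf_lt1// ltr1n.
exact: (L2_cvg_ae_eq t2 G2 g2 ((cvg_L2norm_N2 nu _).2 tG) ((cvg_L2norm_N2 nu _).2 tgl)).
Qed.

(** Inversion commutes with [refl], so Plancherel for the difference passes evenness from the
    inverse transform to [h]. *)
Lemma spectrum_even h : L2 nu h -> (forall p, ~ band p -> h p = 0) ->
  inv_fourier_s h \o @refl R = inv_fourier_s h %[ae nu] -> h \o @refl R = h %[ae nu].
Proof.
move=> h2 h0 E; have [mh hoo] := (L2P _ _).1 h2.
have mhr := cmeasurable_comp mh (@measurable_refl R).
have hr2 : L2 nu (h \o @refl R).
  apply/L2P; split => //; apply: le_lt_trans hoo.
  rewrite /N2 (@ge0_integral_refl _ (fun p => (sqn (h p))%:E))//; first exact: emeasurable_sqn.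
  by move=> p; rewrite lee_fin sqn_ge0.
have hr0 p : ~ band p -> (h \o @refl R) p = 0.
  by move=> np; apply: h0; rewrite /band /= normrN.
have f1 := is_fourier_s_band r'0 hr2 hr0; have f2 := is_fourier_s_band r'0 h2 h0.
apply/(N2B_eq0 nu mhr mh); rewrite (is_fourier_s_N2 (is_fourier_sB f1 f2)).
rewrite -inv_fourier_s_refl//.
have [[m1 _] _ _] := f1; have [[m2 _] _ _] := f2; rewrite -inv_fourier_s_refl// in m1.
by rewrite ((N2B_eq0 nu m1 m2).2 E) mule0.
Qed.

(** The preimage under [polar_point] with nonnegative radius. At the origin the quotients are 0 and
    do not form a unit vector; [insubd] then supplies the direction of angle 0. *)
Definition polar_coordinates (xi : RR) : cyl :=
  let rho := Num.sqrt (dot2 xi xi) in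
  (rho, insubd (circle_param 0) (xi.1 / rho, xi.2 / rho)).

Lemma measurable_polar_coordinates : measurable_fun setT polar_coordinates.
Proof.
have mrho : measurable_fun setT (fun xi : RR => Num.sqrt (dot2 xi xi)).
  apply: (measurableT_comp (f := @Num.sqrt R)).
    by apply: continuous_measurable_fun; exact: sqrt_continuous.
  apply: measurable_funD; apply: measurable_funM;
    by [exact: measurable_fst|exact: measurable_snd].
have mV := measurableT_comp (@measurable_invr R) mrho.
have m1 : measurable_fun setT (fun xi : RR => xi.1 / Num.sqrt (dot2 xi xi)).
  exact: (measurable_funM measurable_fst mV).
have m2 : measurable_fun setT (fun xi : RR => xi.2 / Num.sqrt (dot2 xi xi)).
  exact: (measurable_funM measurable_snd mV).
apply/measurable_fun_pair; first exact: mrho.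
apply: measurable_fun_circle.
have E : @circle_val R \o (fun xi => (polar_coordinates xi).2) =
   (fun xi : RR => if (xi.1 / Num.sqrt (dot2 xi xi)) ^+ 2 + (xi.2 / Num.sqrt (dot2 xi xi)) ^+ 2 == 1
     then (xi.1 / Num.sqrt (dot2 xi xi), xi.2 / Num.sqrt (dot2 xi xi)) else (cos 0, sin 0)).
  by apply/funext => xi; rewrite /circle_val /polar_coordinates /= val_insubd.
rewrite E; apply: measurable_fun_ifT.
- apply: measurable_fun_eqr => //.
  by apply: measurable_funD; apply: measurable_funX.
- exact: measurable_fun_pair.
- exact: measurable_cst.
Qed.

Lemma polar_coordinatesK p : p.1 != 0 ->
  polar_coordinates (polar_point p) = p \/ polar_coordinates (polar_point p) = refl p.
Proof.
have rhoE (q : cyl) : 0 < q.1 -> polar_coordinates (polar_point q) = q.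
  case: q => s w /= s0; rewrite /polar_coordinates radius_polar_point sqrtr_sqr /=.
  rewrite gtr0_norm//; congr pair; apply: val_inj; rewrite val_insubd /=.
  have e (x : R) : s * x / s = x by rewrite mulrC mulKf ?gt_eqF.
  by rewrite !e; case: w => -[a b] /= ->.
move=> p0; have [lt0|gt0|E] := ltgtP p.1 0; last by rewrite E eqxx in p0.
- by right; rewrite -polar_point_refl rhoE//= oppr_gt0.
- by left; exact: rhoE.
Qed.

(** [h \o polar_coordinates] reads [h] at nonnegative radii only; evenness makes the choice between
    the two preimages immaterial almost everywhere. *)
Lemma radon_onto g : bandpass_cylinder r r' g ->
  exists f, bandpass2 r r' f /\ exists2 g', is_radon f g' & g' = g %[ae nu].
Proof.
move=> [/hilbert_tensor_spectrum[h [h2 h0 hg]] geven].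
have [mh hoo] := (L2P _ _).1 h2.
have hE : h \o @refl R = h %[ae nu].
  apply: spectrum_even => //; move: (ae_refl hg) => hgr.
  have : {ae nu, forall p, inv_fourier_s h (refl p) = g p}.
    by move: hgr geven; apply: ae_imply2 => p /(_ I) -> <-.
  by move: hg; apply: ae_imply2 => p /(_ I) hp1 hp2 _; rewrite /= hp2.
pose F := h \o polar_coordinates.
have mF : cmeasurable F := cmeasurable_comp mh measurable_polar_coordinates.
have F0 xi : ~ annulus r r' xi -> F xi = 0.
  move=> nA; apply: h0 => /andP[]; rewrite /= ger0_norm ?sqrtr_ge0// => b1 b2.
  by apply: nA; split => //; apply/negP; rewrite -leNgt.
have hF : h = F \o @polar_point R %[ae nu].
  move: hE (ae_radius_neq0 R); apply: ae_imply2 => p /(_ I) hp p0 _.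
  by rewrite /F /=; have [->|->] := polar_coordinatesK p0.
(* Here the outer radius matters: it bounds the weight [|s|] by [r'] on the band. *)
have F2 : L2 la2 F.
  apply/L2P; split => //; have [_ hb] := N2_polar_bounds r0 r'0 mF (aeW la2 F0).
  rewrite -(@lte_pmul2l _ 2%:E)//; apply: le_lt_trans hb _.
  have mFp := cmeasurable_comp mF (@measurable_polar_point R).
  rewrite -(N2_ae_eq mh mFp hF) gt0_muley//.
  by apply: lte_mul_pinfty => //; rewrite lee_fin ltW.
have [bf fF] := bandpass2_inv_fourier F2 F0.
eexists; split; first exact: bf.
exists (inv_fourier_s h) => //; exists F, h; split => //.
- exact: (is_fourier_s_band r'0 h2 h0).
- by rewrite even_ext_polar.
Qed.

End radon_onto.

(** [radon] is defined by choice with default value 0. The first conjunct shows that on bandpass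
    functions the default never stands in for a missing transform and that the choice is unique up
    to null sets, so the isomorphism does concern the Radon transform. *)
Theorem theorem4 (R : realType) (r r' : R) (hr : 0 < r) (hr' : 0 < r') :
  (forall f : R * R -> R[i], bandpass2 r r' f ->
     is_radon f (radon f) /\
     forall g : R * circle R -> R[i], is_radon f g ->
       g = radon f %[ae cylinder_measure R]) /\
  L2_isomorphism (lebesgue_measure2 R) (cylinder_measure R)
    (bandpass2 r r') (bandpass_cylinder r r') (@radon R).
Proof.
split.
  by move=> f bf; split; [exact: (radonP hr hr' bf)|move=> g; exact: (radon_uniq hr hr' bf)].
have pi2 : 0 < pi *+ 2 :> R by rewrite mulrn_wgt0// pi_gt0.
split.
- split; [split|].
  + exact: (radon_bandpass_cylinder hr hr').
  + move=> f f' bf bf'.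
    by have [] := is_radon_ae hr hr' bf bf' (radonP hr hr' bf) (radonP hr hr' bf').
  + move=> a f f' bf bf'; have [w [k fk2]] := fourier_kernel_poisson2 R.
    have := radon_uniq hr hr' (bandpassD fk2 a bf bf')
      (is_radonD a (radonP hr hr' bf) (radonP hr hr' bf')).
    by apply: ae_imply => p h _; rewrite h.
- move=> f f' bf bf'.
  by have [] := is_radon_ae hr hr' bf bf' (radonP hr hr' bf) (radonP hr hr' bf').
- move=> g /(radon_onto hr hr')[f [bf [g' fg' g'g]]]; exists f; split => //.
  move: (radon_uniq hr hr' bf fg') g'g.
  by apply: ae_imply2 => p h1 h2 _; rewrite -h1// h2.
- move=> f0 bf0 eps eps0.
  have [||delta [d0 hd]] := @L2norm_transfer R _ _ _ _ (lebesgue_measure2 R) (cylinder_measure R)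
    (r * (pi *+ 2)) (2 * (pi *+ 2 * (pi *+ 2))) eps _ _ eps0; rewrite ?mulr_gt0//.
  exists delta; split => // f bf; apply: hd.
  by have [] := is_radon_bounds hr hr' (bandpass2B bf bf0)
    (is_radonB (radonP hr hr' bf) (radonP hr hr' bf0)).
- move=> f0 bf0 eps eps0.
  have [||delta [d0 hd]] := @L2norm_transfer R _ _ _ _ (cylinder_measure R) (lebesgue_measure2 R)
    (2 * (pi *+ 2 * (pi *+ 2))) (r' * (pi *+ 2)) eps _ _ eps0; rewrite ?mulr_gt0//.
  exists delta; split => // f bf; apply: hd.
  by have [] := is_radon_bounds hr hr' (bandpass2B bf bf0)
    (is_radonB (radonP hr hr' bf) (radonP hr hr' bf0)).
Qed.
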